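(* Let $$\mathcal{V}=\{z=re^{i\beta} : r>0,\ \beta\in(-\pi/2,\pi/2)\}$$ be the open right half-plane and let $$\mathcal{W}=\{z=Re^{i\alpha}:\alpha\in(-\pi/2,\pi/2),\ 0<R<\cos\alpha\}=\{z:|z-\tfrac12|<\tfrac12\}=\{z:\operatorname{Re}(1/z)>1\}$$ be the open disk of radius $1/2$ centered at $1/2$. Then the normalized mean resultant map $$\mathcal{V}\ni re^{i\beta}\mapsto \mathcal{M}(\tan\beta,r)=Re^{i\alpha}\in\mathcal{W}$$ is strictly decreasing along the isogones (i.e. $R$ strictly decreases as $r$ increases along each isogone) and globally invertible, with radially strictly decreasing inverse (i.e. for each fixed $\alpha$, the modulus $r$ of the preimage of $Re^{i\alpha}$ is strictly decreasing in $R$). It maps $\mathcal{V}$ diffeomorphically onto $\mathcal{W}$, and for each $\alpha\in(-\pi/2,\pi/2)$ it maps the isogone $\{re^{i\beta}\in\mathcal{V}:\operatorname{Arg}\mathcal{M}(\tan\beta,r)=\alpha\}$ monotonically onto the open chord of the disk $\mathcal{W}$ between the points $z=0$ and $z=\cos\alpha\,e^{i\alpha}$.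
   Context: $I_\nu(r)=\sum_{p\ge0}\frac{1}{p!\,\Gamma(\nu+p+1)}(r/2)^{\nu+2p}$ is the modified Bessel function of the first kind of complex order $\nu$ ($r>0$). For $k\in\mathbb{R}$, $r>0$ the normalized mean resultant map is $$\mathcal{M}(k,r)=\frac{2I_{1-ik}(r)}{r\,I_{-ik}(r)}$$ (the denominator does not vanish). Isogones are the level sets of the argument of $\mathcal{M}$, i.e. the sets on which $\operatorname{Im}\mathcal{M}(k,r)/\operatorname{Re}\mathcal{M}(k,r)=\tan\alpha$ for fixed $\alpha\in(-\pi/2,\pi/2)$; each isogone is a curve parametrized by $r\in(0,\infty)$. *)

(* Defs.v *)
From Stdlib Require Import Reals Lra Factorial.
From Coquelicot Require Import Coquelicot.

Local Open Scope R_scope.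

Definition polar (r t : R) : C := (r * cos t, r * sin t).

(* Principal argument, with values in (-PI, PI] for z <> 0. *)
Definition Arg (z : C) : R :=
  if Rle_dec 0 (Im z) then acos (Re z / Cmod z) else - acos (Re z / Cmod z).

Definition half_pi_range (a : R) : Prop := - (PI / 2) < a < PI / 2.

(* x^s = exp (s * ln x), for x > 0 and a complex exponent s. *)
Definition Rcpow (x : R) (s : C) : C :=
  polar (exp (Re s * ln x)) (Im s * ln x).

Fixpoint rising (s : C) (n : nat) : C :=
  match n with
  | O => RtoC 1
  | S m => (rising s m * (s + RtoC (INR m)))%C
  end.

Definition Clim_seq (u : nat -> C) : C :=
  (real (Lim_seq (fun n => Re (u n))), real (Lim_seq (fun n => Im (u n)))).

Definition CSeries (u : nat -> C) : C :=
  (Series (fun n => Re (u n)), Series (fun n => Im (u n))).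

(* Gauss's product formula: Gamma(s) = lim n! n^s / (s (s+1) ... (s+n)).
   At the poles s = 0, -1, -2, ... the convention 1/0 = 0 makes the sequence
   eventually 0, so Gamma(s) = 0 there; hence [/ Gamma s] is the entire
   function 1/Gamma for every s. *)
Definition Gamma (s : C) : C :=
  Clim_seq (fun n =>
    (RtoC (INR (fact n)) * Rcpow (INR n) s / rising s (S n))%C).

Definition BesselI (nu : C) (r : R) : C :=
  CSeries (fun p =>
    (RtoC 1 / (RtoC (INR (fact p)) * Gamma (nu + RtoC (INR p) + RtoC 1))
     * Rcpow (r / 2) (nu + RtoC (2 * INR p)))%C).

Definition mean_resultant (k r : R) : C :=
  (RtoC 2 * BesselI (RtoC 1 - Ci * RtoC k) r
   / (RtoC r * BesselI (- (Ci * RtoC k)) r))%C.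

Definition calV (z : C) : Prop :=
  exists r b : R, 0 < r /\ half_pi_range b /\ z = polar r b.

Definition calW (w : C) : Prop :=
  exists rho a : R, half_pi_range a /\ 0 < rho < cos a /\ w = polar rho a.

(* r e^{ib} |-> M(tan b, r); see [mean_map_polar]. *)
Definition mean_map (z : C) : C := mean_resultant (tan (Arg z)) (Cmod z).

Definition isogone (a : R) (z : C) : Prop := calV z /\ Arg (mean_map z) = a.

Definition open_segment (p q w : C) : Prop :=
  exists t : R, 0 < t < 1 /\ w = (RtoC (1 - t) * p + RtoC t * q)%C.

Definition strictly_decreasing_along_isogone (a : R) : Prop :=
  forall z1 z2 : C, isogone a z1 -> isogone a z2 ->
    Cmod z1 < Cmod z2 -> Cmod (mean_map z2) < Cmod (mean_map z1).

Definition radially_strictly_decreasing (g : C -> C) : Prop :=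
  forall a R1 R2 : R, half_pi_range a -> 0 < R1 -> R1 < R2 -> R2 < cos a ->
    Cmod (g (polar R2 a)) < Cmod (g (polar R1 a)).

Definition is_image (f : C -> C) (A B : C -> Prop) : Prop :=
  forall w : C, B w <-> exists z : C, A z /\ f z = w.

Definition is_partial_x (f : C -> R) (z : C) (l : R) : Prop :=
  is_derive (fun x : R => f (x, Im z)) (Re z) l.

Definition is_partial_y (f : C -> R) (z : C) (l : R) : Prop :=
  is_derive (fun y : R => f (Re z, y)) (Im z) l.

(* U is meant to be open; the derivatives are real ones, C being R * R. *)
Fixpoint class_C (n : nat) (U : C -> Prop) (f : C -> R) : Prop :=
  (forall z : C, U z -> continuous f z) /\
  match n with
  | O => True
  | S m => exists fx fy : C -> R,
      (forall z : C, U z -> is_partial_x f z (fx z) /\ is_partial_y f z (fy z))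
      /\ class_C m U fx /\ class_C m U fy
  end.

Definition smooth_on (U : C -> Prop) (f : C -> C) : Prop :=
  forall n : nat,
    class_C n U (fun z => Re (f z)) /\ class_C n U (fun z => Im (f z)).

Definition mutually_inverse (U U' : C -> Prop) (f g : C -> C) : Prop :=
  (forall z : C, U z -> U' (f z)) /\ (forall w : C, U' w -> U (g w)) /\
  (forall z : C, U z -> g (f z) = z) /\ (forall w : C, U' w -> f (g w) = w).

Definition diffeomorphism (U U' : C -> Prop) (f g : C -> C) : Prop :=
  mutually_inverse U U' f g /\ smooth_on U f /\ smooth_on U' g.

Lemma Cmod_polar (r t : R) : 0 <= r -> Cmod (polar r t) = r.
Proof.
  intros Hr. unfold Cmod, polar; simpl fst; simpl snd.
  replace ((r * cos t) ^ 2 + (r * sin t) ^ 2) with (r * r).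
  - now apply sqrt_square.
  - generalize (sin2_cos2 t); unfold Rsqr; intro H.
    transitivity (r * r * (sin t * sin t + cos t * cos t)).
    + rewrite H; ring.
    + ring.
Qed.

Lemma Arg_polar (r t : R) : 0 < r -> - PI < t <= PI -> Arg (polar r t) = t.
Proof.
  intros Hr [H1 H2]. unfold Arg.
  rewrite Cmod_polar by lra.
  unfold polar, Re, Im; simpl fst; simpl snd.
  replace (r * cos t / r) with (cos t) by (field; lra).
  destruct (Rle_dec 0 (r * sin t)) as [H | H].
  - apply acos_cos. split; [|lra].
    destruct (Rle_dec 0 t) as [?|Ht]; [assumption|exfalso].
    assert (Hs : sin t < 0) by (apply sin_lt_0_var; lra).
    nra.
  - assert (Ht : t < 0).
    { destruct (Rlt_dec t 0) as [?|Ht]; [assumption|exfalso].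
      apply H, Rmult_le_pos; [lra|apply sin_ge_0; lra]. }
    rewrite <- cos_neg, acos_cos by lra. ring.
Qed.

Lemma mean_map_polar (r b : R) : 0 < r -> half_pi_range b ->
  mean_map (polar r b) = mean_resultant (tan b) r.
Proof.
  intros Hr [H1 H2]. generalize PI_RGT_0; intro HP. unfold mean_map.
  rewrite Arg_polar, Cmod_polar by lra. reflexivity.
Qed.

(* Main.v *)
Require Import Defs.
From Stdlib Require Import Reals Ranalysis5 Lra Lia Factorial ClassicalEpsilon.
From Coquelicot Require Import Coquelicot.
Local Open Scope R_scope.

(** Put x = r^2/4 and s_n = n + 1 - ik.  The power series of the Bessel
    functions give M(k, r) = 1 / N_0, where N_n = (r/2) I_nu / I_(nu+1) at
    nu = n - ik ([mean_resultant_cfrac]).  The N_n satisfy the recurrence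
    N_n = s_n + x / N_(n+1) and the Riccati equation x N' = x + s_n N - N^2.
    For large n the real part of N_n is positive, and the recurrence carries
    this down to Re N_n > n + 1; for n = 0 it says that M takes its values in
    the disk W = {Re(1/w) > 1}.

    Let T_n and D_n ([cfrac_x], [cfrac_nu]) be the derivatives of N_n ([cfrac])
    in x and in nu, and write T, D for n = 0. Everything rests on two
    inequalities: Re(D/N_0) > 0, so that the argument of M increases with k
    ([angle_increasing]), and Re(D/T) > 0, so that the map from (x, k) to the
    real and the negated imaginary part of N_0 has positive Jacobian
    ([jacobian]). For k > 0 they come from keeping D_n/N_n, T_n and an
    auxiliary quotient Phi_n in fixed quadrants or half-planes. Each of these
    functions of x solves a linear differential equation, so it can leave its
    sector only through a boundary ray, in the direction given by the equation
    ([stays_positive]); the recurrence, which relates level n to level n + 1,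
    excludes the rays where that direction points outwards. So the location
    descends from n + 1 to n, and for large n crude estimates suffice
    ([dlog_nu_quadrant], [cfrac_x_quadrant], [Phi_Im], [jacq_Re]). Negative k
    follow by conjugation, and for k = 0 all quantities are real.

    Write N_0 = A - iB, so that B/A is the tangent of arg M and, on the isogone
    with argument a, |M| = cos a / A.  For fixed x the function k |-> B/A is
    increasing, and onto because |N_0 - s_0| <= x/2; its inverse [kappa]
    parametrizes the isogones by x.  Along an isogone x |-> A is increasing by
    the Jacobian inequality, with range (1, infinity) since A <= 1 + x/2 and
    |N_0|^2 > x.  Inverting these two fibrewise monotone maps one after the
    other inverts M, and each inversion preserves smoothness
    ([fibre_inverse_class_C]).  The monotonicity and chord statements are the
    statements about A, read through |M| = cos a / A. *)

(** * Complex-valued derivatives and a first-crossing principle *)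

Lemma C_ext (z w : C) : Re z = Re w -> Im z = Im w -> z = w.
Proof. destruct z, w; simpl; intros -> ->; reflexivity. Qed.

Lemma norm2_pos (z : C) : z <> RtoC 0 -> 0 < Re z * Re z + Im z * Im z.
Proof.
  destruct z as [a b]; simpl; intro H.
  destruct (Req_dec a 0) as [Ha|Ha]; [destruct (Req_dec b 0) as [Hb|Hb]|]; [|nra|nra].
  exfalso; apply H; subst; reflexivity.
Qed.

Lemma RtoC_nz x : x <> 0 -> RtoC x <> RtoC 0.
Proof. intros H E. apply H. now apply RtoC_inj. Qed.

Lemma is_derive_eq (f : R -> R) (x l l' : R) : is_derive f x l -> l = l' -> is_derive f x l'.
Proof. now intros H <-. Qed.

Lemma is_derive_Rext (f g : R -> R) (x l : R) :
  (forall t, f t = g t) -> is_derive f x l -> is_derive g x l.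
Proof. apply (is_derive_ext f g x l). Qed.

Lemma is_derive_Rplus (f g : R -> R) (x l m : R) :
  is_derive f x l -> is_derive g x m -> is_derive (fun t => f t + g t) x (l + m).
Proof. intros; now apply (is_derive_plus (K := R_AbsRing) (V := R_NormedModule) f g). Qed.

Lemma is_derive_Rminus (f g : R -> R) (x l m : R) :
  is_derive f x l -> is_derive g x m -> is_derive (fun t => f t - g t) x (l - m).
Proof. intros; now apply (is_derive_minus (K := R_AbsRing) (V := R_NormedModule) f g). Qed.

Lemma is_derive_Ropp (f : R -> R) (x l : R) :
  is_derive f x l -> is_derive (fun t => - f t) x (- l).
Proof. intros; now apply (is_derive_opp (K := R_AbsRing) (V := R_NormedModule) f). Qed.

Lemma is_derive_Rmult (f g : R -> R) (x l m : R) :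
  is_derive f x l -> is_derive g x m ->
  is_derive (fun t => f t * g t) x (l * g x + f x * m).
Proof.
  intros Hf Hg. apply (is_derive_mult (K := R_AbsRing) f g); auto.
  intros; apply Rmult_comm.
Qed.

Lemma is_derive_Rconst (c x : R) : is_derive (fun _ : R => c) x 0.
Proof. exact (is_derive_const (K := R_AbsRing) (V := R_NormedModule) c x). Qed.

Lemma is_derive_Rid (x : R) : is_derive (fun t : R => t) x 1.
Proof. exact (is_derive_id (K := R_AbsRing) x). Qed.

(** Derivatives with respect to a real variable, taken componentwise, so that
    real derivative lemmas and the field tactic on complex numbers cooperate. *)
Definition Cderiv (f : R -> C) (x : R) (l : C) : Prop :=
  is_derive (fun t => Re (f t)) x (Re l) /\
  is_derive (fun t => Im (f t)) x (Im l).

Lemma Cderiv_eq f x l l' : Cderiv f x l -> l = l' -> Cderiv f x l'.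
Proof. now intros H <-. Qed.

Lemma Cderiv_ext_loc (f g : R -> C) x l :
  locally x (fun t => f t = g t) -> Cderiv f x l -> Cderiv g x l.
Proof.
  intros H [H1 H2]; split.
  - apply (is_derive_ext_loc (fun t => Re (f t))); [|exact H1].
    revert H; apply filter_imp; intros t ->; reflexivity.
  - apply (is_derive_ext_loc (fun t => Im (f t))); [|exact H2].
    revert H; apply filter_imp; intros t ->; reflexivity.
Qed.

Lemma Cderiv_ext (f g : R -> C) x l :
  (forall t, f t = g t) -> Cderiv f x l -> Cderiv g x l.
Proof. intro H; apply Cderiv_ext_loc; now apply filter_forall. Qed.

Lemma Cderiv_unique f x l l' : Cderiv f x l -> Cderiv f x l' -> l = l'.
Proof.
  intros [H1 H2] [H3 H4]; apply C_ext.
  - now rewrite <- (is_derive_unique _ _ _ H1), <- (is_derive_unique _ _ _ H3).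
  - now rewrite <- (is_derive_unique _ _ _ H2), <- (is_derive_unique _ _ _ H4).
Qed.

Lemma Cderiv_const c x : Cderiv (fun _ => c) x (RtoC 0).
Proof. split; simpl; apply @is_derive_const. Qed.

Lemma Cderiv_plus f g x l m : Cderiv f x l -> Cderiv g x m ->
  Cderiv (fun t => f t + g t)%C x (l + m)%C.
Proof. intros [H1 H2] [H3 H4]; split; simpl; now apply is_derive_Rplus. Qed.

Lemma Cderiv_opp f x l : Cderiv f x l -> Cderiv (fun t => - f t)%C x (- l)%C.
Proof. intros [H1 H2]; split; simpl; now apply is_derive_Ropp. Qed.

Lemma Cderiv_minus f g x l m : Cderiv f x l -> Cderiv g x m ->
  Cderiv (fun t => f t - g t)%C x (l - m)%C.
Proof. intros; apply Cderiv_plus; [assumption | now apply Cderiv_opp]. Qed.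

Lemma Cderiv_mult f g x l m : Cderiv f x l -> Cderiv g x m ->
  Cderiv (fun t => f t * g t)%C x (l * g x + f x * m)%C.
Proof.
  intros [H1 H2] [H3 H4]; split; simpl.
  - eapply is_derive_eq; [apply is_derive_Rminus; apply is_derive_Rmult; eassumption|].
    unfold Re, Im; ring.
  - eapply is_derive_eq; [apply is_derive_Rplus; apply is_derive_Rmult; eassumption|].
    unfold Re, Im; ring.
Qed.

Lemma Cderiv_inv f x l : Cderiv f x l -> f x <> RtoC 0 ->
  Cderiv (fun t => / f t)%C x (- l / (f x * f x))%C.
Proof.
  intros [H1 H2] Hx. generalize (norm2_pos _ Hx); intro Hn.
  set (d := fun t => Re (f t) ^ 2 + Im (f t) ^ 2).
  assert (Hd0 : d x <> 0) by (unfold d; nra).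
  assert (Hd : is_derive d x ((2 * Re (f x) * Re l + 2 * Im (f x) * Im l)%R : R)).
  { unfold d. apply (is_derive_Rext (fun t => Re (f t) * Re (f t) + Im (f t) * Im (f t))).
    - intro t; ring.
    - eapply is_derive_eq; [apply is_derive_Rplus; apply is_derive_Rmult; eassumption|unfold Re, Im; ring]. }
  generalize (is_derive_inv d x _ Hd Hd0); intro Hi.
  unfold d in Hd0, Hi. destruct l as [l1 l2]. unfold Re, Im in *. simpl fst in *; simpl snd in *.
  assert (Hq : fst (f x) * fst (f x) + snd (f x) * snd (f x) <> 0) by lra.
  assert (Hq2 : (fst (f x) * fst (f x) - snd (f x) * snd (f x)) ^ 2 +
    (fst (f x) * snd (f x) + snd (f x) * fst (f x)) ^ 2 <> 0).
  { replace (_ + _) with ((fst (f x) * fst (f x) + snd (f x) * snd (f x)) ^ 2) by ring.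
    apply pow_nonzero; exact Hq. }
  split; unfold Re, Im, Cdiv, Cmult, Copp, Cinv; cbn [fst snd].
  - eapply is_derive_eq; [apply (is_derive_Rmult _ _ _ _ _ H1 Hi)|].
    field; auto.
  - eapply is_derive_eq; [apply (is_derive_Rmult _ _ _ _ _ (is_derive_Ropp _ _ _ H2) Hi)|].
    field; auto.
Qed.

Lemma Cderiv_div f g x l m : Cderiv f x l -> Cderiv g x m -> g x <> RtoC 0 ->
  Cderiv (fun t => f t / g t)%C x ((l * g x - f x * m) / (g x * g x))%C.
Proof.
  intros Hf Hg Hx. eapply Cderiv_eq; [apply (Cderiv_mult _ _ _ _ _ Hf (Cderiv_inv _ _ _ Hg Hx))|].
  field; exact Hx.
Qed.

Lemma is_derive_continuous (f : R -> R) (x l : R) : is_derive f x l -> continuous f x.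
Proof.
  intro H. apply (ex_derive_continuous (K := R_AbsRing) (V := R_NormedModule) f x).
  now exists l.
Qed.

(** At the first zero of a function that starts positive the derivative is at
    most 0.  So positivity propagates as soon as every zero would be crossed
    upwards; this is how each sign below is carried along the axis x > 0. *)
Lemma stays_positive (f : R -> R) (X : R) :
  (forall x, 0 <= x <= X -> continuous f x) ->
  (forall x, 0 < x <= X -> f x = 0 -> exists l, is_derive f x l /\ 0 < l) ->
  0 < f 0 -> forall x, 0 <= x <= X -> 0 < f x.
Proof.
  intros Hc Hd H0 x1 Hx1.
  destruct (Rlt_dec 0 (f x1)) as [H|H]; [exact H|exfalso].
  set (S := fun t => 0 <= t <= x1 /\ forall u, 0 <= u <= t -> 0 < f u).
  assert (HS0 : S 0) by (split; [lra|]; intros u Hu; replace u with 0 by lra; exact H0).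
  destruct (completeness S) as [t [Ht1 Ht2]].
  { exists x1. intros t [Ht _]; lra. }
  { now exists 0. }
  assert (Ht0 : 0 <= t) by now apply Ht1.
  assert (Htx : t <= x1) by (apply Ht2; intros u [Hu _]; lra).
  assert (Hbelow : forall u, 0 <= u < t -> 0 < f u).
  { intros u Hu. destruct (Rlt_dec 0 (f u)) as [h|h]; [exact h|exfalso].
    assert (t <= u); [|lra]. apply Ht2. intros v [Hv1 Hv2].
    destruct (Rle_dec v u) as [h'|h']; [exact h'|]. exfalso; apply h, Hv2; lra. }
  assert (Hct : continuous f t) by (apply Hc; lra).
  assert (Hloc : forall e, 0 < e -> exists d : posreal, forall y, Rabs (y - t) < d -> Rabs (f y - f t) < e).
  { intros e He. destruct (proj1 (filterlim_locally f (f t)) Hct (mkposreal e He)) as [d Hd'].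
    exists d; intros y Hy. now apply (Hd' y). }
  assert (Hft : f t = 0).
  { destruct (Rtotal_order (f t) 0) as [Hn|[Hz|Hp]]; [exfalso|exact Hz|exfalso].
    - assert (Htp : 0 < t).
      { destruct Ht0 as [h|h]; [exact h|]. rewrite <- h in Hn; lra. }
      destruct (Hloc (- f t)) as [d Hd']; [lra|].
      set (y := Rmax (t / 2) (t - d / 2)).
      generalize (cond_pos d); intro Hdp.
      assert (0 <= y < t) by (unfold y; split; [apply Rle_trans with (t/2); [lra|apply Rmax_l] | apply Rmax_lub_lt; lra]).
      assert (t - d / 2 <= y) by apply Rmax_r.
      assert (Hy : Rabs (y - t) < d) by (rewrite Rabs_left; lra).
      apply Hd' in Hy. apply Rabs_def2 in Hy. generalize (Hbelow y); lra.
    - destruct (Hloc (f t)) as [d Hd']; [lra|].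
      generalize (cond_pos d); intro Hdp.
      assert (Htx' : t < x1) by (destruct Htx as [h|h]; [exact h|rewrite h in Hp; lra]).
      set (y := Rmin x1 (t + d / 2)).
      assert (Hy1 : t < y) by (apply Rmin_glb_lt; lra).
      assert (Hy2 : y <= t + d / 2) by apply Rmin_r.
      assert (Hy3 : y <= x1) by apply Rmin_l.
      assert (y <= t); [|lra]. apply Ht1. split; [lra|].
      intros u Hu. destruct (Rlt_dec u t) as [h|h]; [apply Hbelow; lra|].
      assert (Hy : Rabs (u - t) < d) by (rewrite Rabs_right; lra).
      apply Hd' in Hy. apply Rabs_def2 in Hy. lra. }
  assert (Htp : 0 < t).
  { destruct Ht0 as [h|h]; [exact h|]. rewrite <- h in Hft; lra. }
  destruct (Hd t) as [l [Hl1 Hl2]]; [lra|exact Hft|].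
  apply is_derive_Reals in Hl1.
  destruct (Hl1 (l / 2)) as [d Hd']; [lra|].
  generalize (cond_pos d); intro Hdp.
  set (h := - Rmin (t / 2) (d / 2)).
  assert (Hh : 0 < Rmin (t / 2) (d / 2)) by (apply Rmin_glb_lt; lra).
  assert (Hh1 : Rmin (t / 2) (d / 2) <= t / 2) by apply Rmin_l.
  assert (Hh2 : Rmin (t / 2) (d / 2) <= d / 2) by apply Rmin_r.
  assert (Hdh := Hd' h). rewrite Hft in Hdh.
  assert (Hh3 : Rabs h < d) by (unfold h; rewrite Rabs_left; lra).
  assert (Hh4 : h <> 0) by (unfold h; lra).
  specialize (Hdh Hh4 Hh3). apply Rabs_def2 in Hdh.
  assert (Hfp : 0 < f (t + h)) by (apply Hbelow; unfold h; lra).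
  assert (Hq : (f (t + h) - 0) / h < 0).
  { unfold Rdiv. rewrite Rminus_0_r. apply Rmult_pos_neg; [exact Hfp|].
    apply Rinv_lt_0_compat. unfold h; lra. }
  lra.
Qed.
(** * Power series in x with coefficients depending on k *)

Definition geo_bounded (B q : R) (a : nat -> R) : Prop :=
  forall p, Rabs (a p) <= B * q ^ p.

Lemma fact_pos p : 0 < INR (fact p).
Proof. apply lt_0_INR, lt_O_fact. Qed.

Lemma is_series_expB B y :
  is_series (fun p => B * (y ^ p / INR (fact p))) (B * exp y).
Proof.
  apply (is_series_scal (K := R_AbsRing) (V := R_NormedModule) B).
  apply (is_series_ext (fun p => scal (pow_n y p) (/ INR (fact p)))).
  - intro p. rewrite pow_n_pow. reflexivity.
  - exact (is_exp_Reals y).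
Qed.

Lemma geo_term B q a x p : geo_bounded B q a ->
  Rabs (a p / INR (fact p) * x ^ p) <= B * ((q * Rabs x) ^ p / INR (fact p)).
Proof.
  intros H. generalize (fact_pos p); intro Hp.
  unfold Rdiv. rewrite !Rabs_mult, <- RPow_abs, Rpow_mult_distr.
  rewrite (Rabs_right (/ _)) by (left; now apply Rinv_0_lt_compat).
  replace (B * (q ^ p * Rabs x ^ p * / INR (fact p)))
    with (B * q ^ p * / INR (fact p) * Rabs x ^ p) by ring.
  apply Rmult_le_compat_r; [apply pow_le, Rabs_pos|].
  apply Rmult_le_compat_r; [left; now apply Rinv_0_lt_compat | apply H].
Qed.

Lemma geo_ex_abs B q a x : geo_bounded B q a ->
  ex_series (fun p => Rabs (a p / INR (fact p) * x ^ p)).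
Proof.
  intro H. apply (ex_series_le (K := R_AbsRing) (V := R_CompleteNormedModule) _
    (fun p => B * ((q * Rabs x) ^ p / INR (fact p)))).
  - intro p. unfold norm; simpl; unfold abs; simpl. rewrite Rabs_Rabsolu. now apply geo_term.
  - eexists; apply is_series_expB.
Qed.

Lemma geo_bound_sum B q a x : geo_bounded B q a ->
  Rabs (PSeries (fun p => a p / INR (fact p)) x) <= B * exp (q * Rabs x).
Proof.
  intro H. unfold PSeries.
  eapply Rle_trans; [apply Series_Rabs; eapply geo_ex_abs; eassumption|].
  rewrite <- (is_series_unique _ _ (is_series_expB B (q * Rabs x))).
  apply Series_le; [|eexists; apply is_series_expB].
  intro p; split; [apply Rabs_pos | now apply geo_term].
Qed.

Lemma geo_radius B q a : geo_bounded B q a ->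
  CV_radius (fun p => a p / INR (fact p)) = p_infty.
Proof.
  intro H.
  assert (forall r, Rbar_le (Finite r) (CV_radius (fun p => a p / INR (fact p)))).
  { intro r. destruct (Lub_Rbar_correct (CV_disk (fun p => a p / INR (fact p)))) as [h _].
    apply h. unfold CV_disk. eapply geo_ex_abs; eassumption. }
  destruct (CV_radius _) as [c| |] eqn:dlog_nu; [|reflexivity|].
  - exfalso. specialize (H0 (c + 1)). simpl in H0. lra.
  - exfalso. exact (H0 0).
Qed.

(** Dividing by p! makes every sequence of geometric growth admissible: the
    series is then entire in x, with a bound uniform in k. *)
Definition gen (a : nat -> R -> R) (x k : R) : R :=
  PSeries (fun p => a p k / INR (fact p)) x.

Definition rbounded (a : nat -> R -> R) : Prop :=
  exists B q, 0 <= B /\ 1 <= q /\ forall k, geo_bounded B q (fun p => a p k).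

(** This class is stable under both partial derivatives of [gen]: d/dk
    differentiates the coefficients and d/dx shifts them.  Smoothness of [gen]
    in the two variables jointly follows by induction on m. *)
Fixpoint rgood (m : nat) (a : nat -> R -> R) : Prop :=
  rbounded a /\
  match m with
  | O => True
  | S m' => exists a', (forall p k, is_derive (a p) k (a' p k)) /\ rgood m' a'
  end.

Lemma rbounded_shift a : rbounded a -> rbounded (fun p => a (S p)).
Proof.
  intros [B [q [HB [Hq H]]]]. exists (B * q), q. repeat split; [nra|exact Hq|].
  intros k p. generalize (H k (S p)). simpl. intro h.
  eapply Rle_trans; [exact h|right; ring].
Qed.

Lemma rgood_shift m : forall a, rgood m a -> rgood m (fun p => a (S p)).
Proof.
  induction m as [|m IH]; intros a [Hb H]; split; try (now apply rbounded_shift); [exact I|].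
  destruct H as [a' [H1 H2]]. exists (fun p => a' (S p)); split; [intros; apply H1|now apply IH].
Qed.

Lemma gen_derive_x a x k : rbounded a ->
  is_derive (fun t => gen a t k) x (gen (fun p => a (S p)) x k).
Proof.
  intros [B [q [HB [Hq H]]]]. unfold gen.
  eapply is_derive_eq.
  - apply is_derive_PSeries. rewrite (geo_radius B q _ (H k)). exact I.
  - apply PSeries_ext. intro p. unfold PS_derive.
    rewrite fact_simpl, mult_INR. generalize (fact_pos p), (lt_0_INR (S p) (Nat.lt_0_succ p)); intros.
    field; lra.
Qed.

Lemma MVT_R (f df : R -> R) a b :
  (forall t, is_derive f t (df t)) ->
  exists c, Rabs (c - a) <= Rabs (b - a) /\ f b - f a = df c * (b - a).
Proof.
  intro H. destruct (MVT_gen f a b df) as [c [Hc1 Hc2]].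
  - intros; apply H.
  - intros t _. apply continuity_pt_filterlim. exact (is_derive_continuous f t _ (H t)).
  - exists c; split; [|exact Hc2].
    unfold Rmin, Rmax in Hc1. destruct (Rle_dec a b);
    unfold Rabs; destruct (Rcase_abs (c - a)), (Rcase_abs (b - a)); lra.
Qed.

Lemma gen_lin a b x k c d : rbounded a -> rbounded b ->
  c * gen a x k + d * gen b x k = gen (fun p k => c * a p k + d * b p k) x k.
Proof.
  intros [B [q [_ [_ H]]]] [B' [q' [_ [_ H']]]]. unfold gen, PSeries.
  rewrite <- !Series_scal_l, <- Series_plus.
  - apply Series_ext; intro p. unfold Rdiv; ring.
  - apply (ex_series_scal (K:=R_AbsRing) (V:=R_NormedModule) c), ex_series_Rabs.
    exact (geo_ex_abs _ _ _ x (H k)).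
  - apply (ex_series_scal (K:=R_AbsRing) (V:=R_NormedModule) d), ex_series_Rabs.
    exact (geo_ex_abs _ _ _ x (H' k)).
Qed.

Lemma rbounded_lin a b c d : rbounded a -> rbounded b ->
  rbounded (fun p k => c * a p k + d * b p k).
Proof.
  intros [B [q [HB [Hq H]]]] [B' [q' [HB' [Hq' H']]]].
  exists (Rabs c * B + Rabs d * B'), (Rmax q q').
  assert (q <= Rmax q q') by apply Rmax_l. assert (q' <= Rmax q q') by apply Rmax_r.
  generalize (Rabs_pos c), (Rabs_pos d); intros.
  split; [nra|]. split; [lra|]. intros k p.
  eapply Rle_trans; [apply Rabs_triang|]. rewrite !Rabs_mult, Rmult_plus_distr_r.
  apply Rplus_le_compat; rewrite Rmult_assoc; apply Rmult_le_compat_l; auto.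
  - eapply Rle_trans; [apply H|]. apply Rmult_le_compat_l; [lra|]. apply pow_incr; lra.
  - eapply Rle_trans; [apply H'|]. apply Rmult_le_compat_l; [lra|]. apply pow_incr; lra.
Qed.

Lemma gen_freeze (a : nat -> R -> R) x k k0 : gen (fun p _ => a p k) x k0 = gen a x k.
Proof. reflexivity. Qed.

Lemma rbounded_freeze a k : rbounded a -> rbounded (fun p _ => a p k).
Proof. intros [B [q [HB [Hq H]]]]; exists B, q; repeat split; auto. Qed.

(** Differentiation under the sum: the second-order Taylor remainders of the
    coefficients are again of geometric growth, so the remainder of the sum
    is O(h^2). *)
Lemma gen_derive_k a a' x k : rgood 2 a -> (forall p t, is_derive (a p) t (a' p t)) ->
  is_derive (fun t => gen a x t) k (gen a' x k).
Proof.
  intros [Hb [a1 [H1 [Hb1 [a2 [H2 [Hb2 _]]]]]]] Ha'.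
  assert (Heq : forall p t, a' p t = a1 p t).
  { intros p t. rewrite <- (is_derive_unique _ _ _ (H1 p t)). symmetry; now apply is_derive_unique. }
  assert (Hg : gen a' x k = gen a1 x k) by (unfold gen; apply PSeries_ext; intro p; now rewrite Heq).
  rewrite Hg. clear a' Ha' Heq Hg.
  destruct Hb2 as [B [q [HB [Hq H]]]].
  assert (Key : forall h, Rabs (gen a x (k + h) - gen a x k - h * gen a1 x k)
                 <= h ^ 2 * (B * exp (q * Rabs x))).
  { intro h.
    replace (gen a x (k + h) - gen a x k - h * gen a1 x k)
      with (gen (fun p _ => 1 * (1 * a p (k + h) + (-1) * a p k) + (-h) * a1 p k) x 0).
    2:{ rewrite <- (gen_lin (fun p _ => 1 * a p (k + h) + (-1) * a p k) (fun p _ => a1 p k)).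
        rewrite <- (gen_lin (fun p _ => a p (k + h)) (fun p _ => a p k)).
        rewrite !gen_freeze; ring.
        all: try (apply (rbounded_lin (fun p _ => a p (k + h)) (fun p _ => a p k)));
        apply rbounded_freeze; assumption. }
    replace (h ^ 2 * (B * exp (q * Rabs x))) with (h ^ 2 * B * exp (q * Rabs x)) by ring.
    apply geo_bound_sum. intro p.
    destruct (MVT_R (a p) (a1 p) k (k + h)) as [c [Hc1 Hc2]]; [apply H1|].
    destruct (MVT_R (a1 p) (a2 p) k c) as [c' [_ Hc2']]; [apply H2|].
    replace (1 * (1 * a p (k + h) + -1 * a p k) + - h * a1 p k)
      with (a2 p c' * (c - k) * h).
    2:{ replace (1 * (1 * a p (k + h) + -1 * a p k)) with (a p (k + h) - a p k) by ring.
        rewrite Hc2. rewrite <- Hc2'. ring. }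
    rewrite !Rabs_mult. replace (k + h - k) with h in Hc1 by ring.
    replace (h ^ 2 * B * q ^ p) with (B * q ^ p * Rabs h * Rabs h).
    2:{ replace (h ^ 2) with (Rabs h * Rabs h). ring.
        rewrite <- Rabs_mult, Rabs_right; [ring|nra]. }
    apply Rmult_le_compat_r; [apply Rabs_pos|].
    apply Rmult_le_compat; auto using Rabs_pos. apply H. }
  apply is_derive_Reals. intros e He.
  set (L := B * exp (q * Rabs x) + 1).
  assert (HL : 0 < L).
  { unfold L. generalize (exp_pos (q * Rabs x)); nra. }
  assert (Hd : 0 < e / L) by (apply Rdiv_lt_0_compat; lra).
  exists (mkposreal _ Hd). simpl. intros h Hh0 Hh.
  replace ((gen a x (k + h) - gen a x k) / h - gen a1 x k)
    with ((gen a x (k + h) - gen a x k - h * gen a1 x k) / h) by (field; exact Hh0).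
  unfold Rdiv. rewrite Rabs_mult, Rabs_inv.
  assert (Hhp : 0 < Rabs h) by now apply Rabs_pos_lt.
  apply Rle_lt_trans with (Rabs h * L).
  - apply Rmult_le_reg_r with (Rabs h); [exact Hhp|].
    rewrite Rmult_assoc, Rinv_l by lra.
    eapply Rle_trans; [rewrite Rmult_1_r; apply Key|].
    replace (h ^ 2) with (Rabs h * Rabs h).
    2:{ rewrite <- Rabs_mult, Rabs_right; [ring|nra]. }
    unfold L. nra.
  - apply Rmult_lt_reg_r with (/ L); [now apply Rinv_0_lt_compat|].
    rewrite Rmult_assoc, Rinv_r by lra. unfold Rdiv in Hh; lra.
Qed.

(** Continuity in x for the base value of k, plus a Lipschitz bound in k that
    is uniform for x in a bounded interval. *)
Lemma gen_continuous a (z : C) : rgood 2 a ->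
  continuous (fun z : C => gen a (Re z) (Im z)) z.
Proof.
  intros Hg. destruct z as [x0 k0].
  assert (Hg' := Hg). destruct Hg as [Hb [a1 [H1 [Hb1 _]]]].
  assert (Hx : continuous (fun x => gen a x k0) x0)
    by (eapply is_derive_continuous, gen_derive_x; exact Hb).
  destruct Hb1 as [B [q [HB [Hq H]]]].
  set (L := B * exp (q * (Rabs x0 + 1)) + 1).
  assert (HL : 0 < L) by (unfold L; generalize (exp_pos (q * (Rabs x0 + 1))); nra).
  apply filterlim_locally. intro eps.
  destruct (proj1 (filterlim_locally _ _) Hx (pos_div_2 eps)) as [d1 Hd1].
  generalize (cond_pos eps), (cond_pos d1); intros He Hd1p.
  assert (Hd : 0 < Rmin (Rmin 1 d1) (eps / (2 * L))).
  { repeat apply Rmin_glb_lt; try lra. apply Rdiv_lt_0_compat; lra. }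
  exists (mkposreal _ Hd). intros [x k] [Hbx Hbk]. simpl in *.
  unfold ball in *; simpl in *; unfold AbsRing_ball, abs, minus, plus, opp in *; simpl in *.
  assert (E1 := Rmin_l (Rmin 1 d1) (eps / (2 * L))).
  assert (E2 := Rmin_r (Rmin 1 d1) (eps / (2 * L))).
  assert (E3 := Rmin_l 1 d1). assert (E4 := Rmin_r 1 d1).
  specialize (Hd1 x ltac:(lra)).
  destruct (MVT_R (fun t => gen a x t) (fun t => gen a1 x t) k0 k) as [c [_ Hc]].
  { intro t. apply gen_derive_k; auto. }
  replace (gen a x k + - gen a x0 k0) with ((gen a x k - gen a x k0) + (gen a x k0 + - gen a x0 k0)) by ring.
  eapply Rle_lt_trans; [apply Rabs_triang|].
  replace (pos eps) with (eps / 2 + eps / 2) by field.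
  apply Rplus_le_lt_compat; [|exact Hd1].
  rewrite Hc, Rabs_mult.
  assert (Hxb : Rabs x <= Rabs x0 + 1).
  { replace x with (x0 + (x + - x0)) by ring. eapply Rle_trans; [apply Rabs_triang|]. lra. }
  assert (Hgb : Rabs (gen a1 x c) <= L).
  { eapply Rle_trans; [exact (geo_bound_sum _ _ _ x (H c))|]. unfold L.
    assert (exp (q * Rabs x) <= exp (q * (Rabs x0 + 1))).
    { destruct (Rle_lt_or_eq_dec (q * Rabs x) (q * (Rabs x0 + 1))) as [h|h]; [nra| |].
      left; now apply exp_increasing. rewrite h; lra. }
    nra. }
  apply Rle_trans with (L * (eps / (2 * L))).
  - apply Rmult_le_compat; auto using Rabs_pos. unfold Rminus; lra.
  - right; field; lra.
Qed.

Lemma rgood_S m : forall a, rgood (S m) a -> rgood m a.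
Proof.
  induction m as [|m IH]; intros a [Hb [a' [Hd Ha']]]; split; auto.
  exists a'; split; auto.
Qed.

Lemma rgood_le m m' a : (m <= m')%nat -> rgood m' a -> rgood m a.
Proof. induction 1; auto using rgood_S. Qed.

Lemma gen_class_C n (U : C -> Prop) : forall a, rgood (n + 2) a ->
  class_C n U (fun z => gen a (Re z) (Im z)).
Proof.
  induction n as [|n IH]; intros a Ha.
  - split; [|exact I]. intros; now apply gen_continuous.
  - assert (H2 : rgood 2 a) by (apply (rgood_le 2 (S n + 2)); [lia|exact Ha]).
    assert (Ha0 := rgood_S _ _ Ha).
    split; [intros; now apply gen_continuous|].
    destruct Ha as [Hb [a' [Hd Ha']]].
    exists (fun z => gen (fun p => a (S p)) (Re z) (Im z)), (fun z => gen a' (Re z) (Im z)).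
    split; [|split].
    + intros z _; split.
      * unfold is_partial_x; simpl. now apply gen_derive_x.
      * unfold is_partial_y; simpl. now apply gen_derive_k.
    + apply IH. now apply rgood_shift.
    + now apply IH.
Qed.
(** * The series 0F1(; n + 1 - ik; x) *)

Definition cbounded (a : nat -> R -> C) : Prop :=
  exists B q, 0 <= B /\ 1 <= q /\ forall k p, Cmod (a p k) <= B * q ^ p.

(** Complex counterpart of [rgood].  The recursive form makes closure under
    products an induction on m, which suits the coefficients below: their
    logarithmic derivatives belong to the same class. *)
Fixpoint cgood (m : nat) (a : nat -> R -> C) : Prop :=
  cbounded a /\
  match m with
  | O => True
  | S m' => exists a', (forall p k, Cderiv (a p) k (a' p k)) /\ cgood m' a'
  end.

Lemma cgood_bounded m a : cgood m a -> cbounded a.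
Proof. destruct m; now intros []. Qed.

Lemma cgood_S m : forall a, cgood (S m) a -> cgood m a.
Proof.
  induction m as [|m IH]; intros a [Hb [a' [Hd Ha']]]; split; auto.
  exists a'; split; auto.
Qed.

Lemma Re_le_Cmod z : Rabs (Re z) <= Cmod z.
Proof. eapply Rle_trans; [|apply Rmax_Cmod]. apply Rmax_l. Qed.

Lemma Im_le_Cmod z : Rabs (Im z) <= Cmod z.
Proof. eapply Rle_trans; [|apply Rmax_Cmod]. apply Rmax_r. Qed.

Lemma cgood_rgood m : forall a, cgood m a ->
  rgood m (fun p k => Re (a p k)) /\ rgood m (fun p k => Im (a p k)).
Proof.
  induction m as [|m IH]; intros a [[B [q [HB [Hq H]]]] Ha].
  - split; (split; [exists B, q; repeat split; auto; intros k p|exact I]).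
    + eapply Rle_trans; [apply Re_le_Cmod|apply H].
    + eapply Rle_trans; [apply Im_le_Cmod|apply H].
  - destruct Ha as [a' [Hd Ha']]. destruct (IH _ Ha') as [G1 G2].
    split; (split; [exists B, q; repeat split; auto; intros k p|]).
    + eapply Rle_trans; [apply Re_le_Cmod|apply H].
    + eexists; split; [|exact G1]. intros; apply Hd.
    + eapply Rle_trans; [apply Im_le_Cmod|apply H].
    + eexists; split; [|exact G2]. intros; apply Hd.
Qed.

Lemma cbounded_plus a b : cbounded a -> cbounded b -> cbounded (fun p k => a p k + b p k)%C.
Proof.
  intros [B [q [HB [Hq H]]]] [B' [q' [HB' [Hq' H']]]].
  exists (B + B'), (Rmax q q').
  assert (q <= Rmax q q') by apply Rmax_l. assert (q' <= Rmax q q') by apply Rmax_r.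
  split; [lra|]. split; [lra|]. intros k p.
  eapply Rle_trans; [apply Cmod_triangle|]. rewrite Rmult_plus_distr_r.
  apply Rplus_le_compat.
  - eapply Rle_trans; [apply H|]. apply Rmult_le_compat_l; [lra|]. apply pow_incr; lra.
  - eapply Rle_trans; [apply H'|]. apply Rmult_le_compat_l; [lra|]. apply pow_incr; lra.
Qed.

Lemma cbounded_mult a b : cbounded a -> cbounded b -> cbounded (fun p k => a p k * b p k)%C.
Proof.
  intros [B [q [HB [Hq H]]]] [B' [q' [HB' [Hq' H']]]].
  exists (B * B'), (q * q'). split; [nra|]. split; [nra|]. intros k p.
  rewrite Cmod_mult, Rpow_mult_distr.
  replace (B * B' * (q ^ p * q' ^ p)) with ((B * q ^ p) * (B' * q' ^ p)) by ring.
  apply Rmult_le_compat; auto using Cmod_ge_0.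
Qed.

Lemma cgood_plus m : forall a b, cgood m a -> cgood m b -> cgood m (fun p k => a p k + b p k)%C.
Proof.
  induction m as [|m IH]; intros a b [Ha Ha'] [Hb Hb'].
  - split; [now apply cbounded_plus|exact I].
  - split; [now apply cbounded_plus|].
    destruct Ha' as [a' [Hd Ha']], Hb' as [b' [Hd' Hb']].
    exists (fun p k => a' p k + b' p k)%C; split; auto.
    intros; now apply Cderiv_plus.
Qed.

Lemma cgood_mult m : forall a b, cgood m a -> cgood m b -> cgood m (fun p k => a p k * b p k)%C.
Proof.
  induction m as [|m IH]; intros a b Ga Gb.
  - split; [|exact I]. apply cbounded_mult; eapply cgood_bounded; eassumption.
  - split; [apply cbounded_mult; eapply cgood_bounded; eassumption|].
    assert (Ga0 := cgood_S _ _ Ga). assert (Gb0 := cgood_S _ _ Gb).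
    destruct Ga as [_ [a' [Hd Ha']]], Gb as [_ [b' [Hd' Hb']]].
    exists (fun p k => a' p k * b p k + a p k * b' p k)%C; split.
    + intros; now apply Cderiv_mult.
    + apply cgood_plus; apply IH; auto.
Qed.

Lemma cgood_const m : forall c, cgood m (fun _ _ => c).
Proof.
  induction m as [|m IH]; intro c.
  - split; [|exact I]. exists (Cmod c), 1. split; [apply Cmod_ge_0|]. split; [lra|].
    intros; rewrite pow1; lra.
  - split; [apply (cgood_bounded m), IH|].
    exists (fun _ _ => RtoC 0); split; [intros; apply Cderiv_const|apply IH].
Qed.

(** The logarithmic derivative of 1 / (s)_p is such a partial sum. *)
Fixpoint csum (a : nat -> R -> C) (p : nat) (k : R) : C :=
  match p with O => RtoC 0 | S p' => (csum a p' k + a p' k)%C end.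

Lemma cgood_csum m : forall a, cgood m a -> cgood m (csum a).
Proof.
  assert (Hb : forall a, cbounded a -> cbounded (csum a)).
  { intros a [B [q [HB [Hq H]]]]. exists B, (2 * q). split; [lra|]. split; [lra|].
    intros k p. rewrite Rpow_mult_distr.
    induction p as [|p IHp]; simpl; [rewrite Cmod_0; lra|].
    eapply Rle_trans; [apply Cmod_triangle|].
    specialize (H k p).
    assert (1 <= q ^ p) by now apply pow_R1_Rle.
    assert (1 <= 2 ^ p) by (apply pow_R1_Rle; lra).
    assert (E : B * q ^ p <= B * (2 ^ p * q ^ p)).
    { rewrite <- (Rmult_1_l (q ^ p)) at 1. apply Rmult_le_compat_l; [lra|].
      apply Rmult_le_compat_r; lra. }
    assert (0 <= B * (2 ^ p * q ^ p)) by (apply Rmult_le_pos; nra).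
    replace (B * (2 * 2 ^ p * (q * q ^ p))) with (2 * q * (B * (2 ^ p * q ^ p))) by ring.
    nra. }
  induction m as [|m IH]; intros a [Ha Ha'].
  - split; auto.
  - split; auto. destruct Ha' as [a' [Hd Ha']]. exists (csum a'); split; auto.
    intros p k; induction p as [|p IHp]; simpl; [apply Cderiv_const|].
    apply Cderiv_plus; auto.
Qed.

(** nu + n + 1 for the order nu = - i k. *)
Definition sn (n : nat) (k : R) : C := (INR n + 1, - k).

Lemma sn_S n k : sn (S n) k = (sn n k + RtoC 1)%C.
Proof. apply C_ext; unfold sn; rewrite ?S_INR; simpl; ring. Qed.

Lemma sn_add n p k : (sn n k + RtoC (INR p))%C = sn (n + p) k.
Proof. apply C_ext; unfold sn; rewrite ?plus_INR; simpl; ring. Qed.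

Lemma Cmod_ge_Re z r : r <= Re z -> r <= Cmod z.
Proof. intro H. eapply Rle_trans; [exact H|]. eapply Rle_trans; [apply Rle_abs|apply Re_le_Cmod]. Qed.

Lemma sn_mod n k : INR n + 1 <= Cmod (sn n k).
Proof. apply Cmod_ge_Re. simpl; lra. Qed.

Lemma sn_nz n k : sn n k <> RtoC 0.
Proof. intro H. generalize (f_equal Re H), (pos_INR n); simpl; lra. Qed.

Lemma sn_deriv n k : Cderiv (sn n) k (- Ci)%C.
Proof.
  split; unfold sn; simpl.
  - eapply is_derive_eq; [apply @is_derive_const|]. unfold zero; simpl; ring.
  - eapply is_derive_eq; [apply is_derive_Ropp, @is_derive_id|]. unfold one; simpl; ring.
Qed.

Lemma rising_nz n k p : rising (sn n k) p <> RtoC 0.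
Proof.
  induction p as [|p IH]; simpl.
  - intro H; apply (f_equal Re) in H; simpl in H; lra.
  - apply Cmult_neq_0; [exact IH|]. rewrite sn_add. apply sn_nz.
Qed.

Lemma rising_shift n k p : rising (sn n k) (S p) = (sn n k * rising (sn (S n) k) p)%C.
Proof.
  induction p as [|p IH]; [simpl; ring|].
  change (rising (sn n k) (S (S p))) with (rising (sn n k) (S p) * (sn n k + RtoC (INR (S p))))%C.
  rewrite IH. simpl rising. rewrite sn_add, sn_add.
  replace (n + S p)%nat with (S n + p)%nat by lia. ring.
Qed.

Definition coef (n p : nat) (k : R) : C := (/ rising (sn n k) p)%C.

Lemma coef_bound n p k : Cmod (coef n p k) <= (/ (INR n + 1)) ^ p.
Proof.
  unfold coef. generalize (pos_INR n); intro Hn.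
  rewrite Cmod_inv by apply rising_nz.
  rewrite pow_inv. apply Rinv_le_contravar; [apply pow_lt; lra|].
  induction p as [|p IH]; simpl; [rewrite Cmod_1; lra|].
  rewrite Cmod_mult, Rmult_comm, sn_add.
  apply Rmult_le_compat; try lra; [apply pow_le; lra|].
  eapply Rle_trans; [|apply sn_mod]. rewrite plus_INR. generalize (pos_INR p); lra.
Qed.

Definition recip (n : nat) (j : nat) (k : R) : C := (/ sn (n + j) k)%C.

Lemma recip_bounded n : cbounded (recip n).
Proof.
  exists 1, 1. split; [lra|]. split; [lra|]. intros k j. rewrite pow1, Rmult_1_l.
  unfold recip. rewrite Cmod_inv by apply sn_nz.
  rewrite <- Rinv_1. apply Rinv_le_contravar; [lra|].
  eapply Rle_trans; [|apply sn_mod]. generalize (pos_INR (n + j)); lra.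
Qed.

(** The derivative of 1 / s is i (1 / s)^2, a product of members of the class,
    so induction on m closes. *)
Lemma recip_good n m : cgood m (recip n).
Proof.
  induction m as [|m IH]; (split; [apply recip_bounded|]); [exact I|].
  exists (fun p k => Ci * (recip n p k * recip n p k))%C; split.
  - intros p k. unfold recip.
    eapply Cderiv_eq; [apply Cderiv_inv; [apply sn_deriv|apply sn_nz]|].
    field. apply sn_nz.
  - apply (cgood_mult m (fun _ _ => Ci)); [apply cgood_const|]. now apply cgood_mult.
Qed.

Lemma coef_deriv n p k :
  Cderiv (coef n p) k (Ci * (coef n p k * csum (recip n) p k))%C.
Proof.
  induction p as [|p IH].
  - apply (Cderiv_ext (fun _ => (/ RtoC 1)%C)); [reflexivity|].
    eapply Cderiv_eq; [apply Cderiv_const|]. simpl; ring.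
  - apply (Cderiv_ext (fun k => coef n p k * recip n p k)%C).
    + intro t. unfold coef, recip. simpl. rewrite sn_add. field.
      split; [apply sn_nz | apply rising_nz].
    + eapply Cderiv_eq.
      * apply Cderiv_mult; [exact IH|]. unfold recip.
        apply Cderiv_inv; [apply sn_deriv|apply sn_nz].
      * unfold coef, recip. simpl. rewrite sn_add. unfold recip. field.
        split; [apply sn_nz | apply rising_nz].
Qed.

(** The derivative of a coefficient is the coefficient times a partial sum of
    reciprocals; both are in the class, so induction on m closes. *)
Lemma coef_good n m : cgood m (coef n).
Proof.
  assert (Hb : cbounded (coef n)).
  { exists 1, 1. split; [lra|]. split; [lra|]. intros k p. rewrite pow1, Rmult_1_l.
    eapply Rle_trans; [apply coef_bound|]. rewrite <- (pow1 p) at 2.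
    generalize (pos_INR n); intro. apply pow_incr. split; [left; apply Rinv_0_lt_compat; lra|].
    rewrite <- Rinv_1. apply Rinv_le_contravar; lra. }
  induction m as [|m IH]; (split; [exact Hb|]); [exact I|].
  exists (fun p k => Ci * (coef n p k * csum (recip n) p k))%C; split.
  - intros; apply coef_deriv.
  - apply (cgood_mult m (fun _ _ => Ci)); [apply cgood_const|].
    apply cgood_mult; [exact IH | apply cgood_csum, recip_good].
Qed.

Definition cgen (a : nat -> R -> C) (x k : R) : C :=
  (gen (fun p k => Re (a p k)) x k, gen (fun p k => Im (a p k)) x k).

Lemma cgen_ext a b x k : (forall p, a p k = b p k) -> cgen a x k = cgen b x k.
Proof.
  intro H. unfold cgen, gen. f_equal; apply PSeries_ext; intro p; now rewrite H.
Qed.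

Lemma cbounded_rbounded a : cbounded a ->
  rbounded (fun p k => Re (a p k)) /\ rbounded (fun p k => Im (a p k)).
Proof.
  intro H. destruct (cgood_rgood 0 a) as [[h _] [h' _]]; [split; auto|]. now split.
Qed.

Lemma cgen_scal a x k (c : C) : cbounded a -> cgen (fun p k => c * a p k)%C x k = (c * cgen a x k)%C.
Proof.
  intro H. destruct (cbounded_rbounded _ H) as [H1 H2].
  unfold cgen. apply C_ext; simpl.
  - replace (fst c * _ - _) with (fst c * gen (fun p k => Re (a p k)) x k +
      (- snd c) * gen (fun p k => Im (a p k)) x k) by ring.
    rewrite gen_lin by assumption. unfold gen; apply PSeries_ext; intro p. f_equal. unfold Re, Im; ring.
  - replace (fst c * _ + _) with (snd c * gen (fun p k => Re (a p k)) x k +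
      fst c * gen (fun p k => Im (a p k)) x k) by ring.
    rewrite gen_lin by assumption. unfold gen; apply PSeries_ext; intro p. f_equal. unfold Re, Im; ring.
Qed.

Lemma cgen_derive_x a x k : cbounded a ->
  Cderiv (fun t => cgen a t k) x (cgen (fun p => a (S p)) x k).
Proof.
  intro H. destruct (cbounded_rbounded _ H) as [H1 H2].
  split; simpl; [exact (gen_derive_x _ x k H1) | exact (gen_derive_x _ x k H2)].
Qed.

Lemma cgen_derive_k a a' x k : cgood 2 a -> (forall p t, Cderiv (a p) t (a' p t)) ->
  Cderiv (fun t => cgen a x t) k (cgen a' x k).
Proof.
  intros H Hd. destruct (cgood_rgood _ _ H) as [H1 H2].
  split; simpl; apply gen_derive_k; auto; intros; apply Hd.
Qed.

(** Multiplied by (r/2)^nu / Gamma(nu + 1) this is I_nu(r), where nu = n - i k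
    and x = r^2 / 4. *)
Definition hyp01 (n : nat) (x k : R) : C := cgen (coef n) x k.

Definition dcoef (n p : nat) (k : R) : C := (Ci * (coef n p k * csum (recip n) p k))%C.
Definition hyp01_k (n : nat) (x k : R) : C := cgen (dcoef n) x k.

Lemma dcoef_good n m : cgood m (dcoef n).
Proof.
  apply (cgood_mult m (fun _ _ => Ci)); [apply cgood_const|].
  apply cgood_mult; [apply coef_good | apply cgood_csum, recip_good].
Qed.

Lemma coef_shift n p k : coef n (S p) k = (/ sn n k * coef (S n) p k)%C.
Proof.
  unfold coef. rewrite rising_shift. field. split; [apply rising_nz|apply sn_nz].
Qed.

Lemma hyp01_shift n x k : cgen (fun p => coef n (S p)) x k = (hyp01 (S n) x k / sn n k)%C.
Proof.
  rewrite (cgen_ext _ (fun p k' => / sn n k * coef (S n) p k')%C) by (intro; apply coef_shift).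
  rewrite cgen_scal by (eapply (cgood_bounded 0), coef_good).
  unfold hyp01. field. apply sn_nz.
Qed.

Lemma hyp01_deriv_x n x k : Cderiv (fun t => hyp01 n t k) x (hyp01 (S n) x k / sn n k)%C.
Proof.
  rewrite <- hyp01_shift. apply cgen_derive_x, (cgood_bounded 0), coef_good.
Qed.

Lemma hyp01_deriv_k n x k : Cderiv (fun t => hyp01 n x t) k (hyp01_k n x k).
Proof. apply cgen_derive_k; [apply coef_good | apply coef_deriv]. Qed.

(** The mixed partial derivatives agree because both come from the sequence
    obtained by shifting and differentiating the coefficients. *)
Lemma hyp01_k_deriv_x n x k :
  Cderiv (fun t => hyp01_k n t k) x (hyp01_k (S n) x k / sn n k + Ci * hyp01 (S n) x k / (sn n k * sn n k))%C.
Proof.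
  eapply Cderiv_eq; [apply cgen_derive_x, (cgood_bounded 0), dcoef_good|].
  apply (Cderiv_unique (fun t => cgen (fun p => coef n (S p)) x t) k).
  - apply cgen_derive_k; [|intros; apply coef_deriv].
    destruct (coef_good n 2) as [Hb [a1 [Ha1 [Hb1 [a2 [Ha2 [Hb2 _]]]]]]].
    assert (Hs : forall b, cbounded b -> cbounded (fun p => b (S p))).
    { intros b [B [q [HB [Hq H]]]]. exists (B * q), q. split; [nra|]. split; [exact Hq|].
      intros t p. eapply Rle_trans; [apply H|right; simpl; ring]. }
    split; [now apply Hs|]. exists (fun p => a1 (S p)). split; [intros; apply Ha1|].
    split; [now apply Hs|]. exists (fun p => a2 (S p)). split; [intros; apply Ha2|].
    split; [now apply Hs|exact I].
  - apply (Cderiv_ext (fun t => hyp01 (S n) x t / sn n t)%C).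
    + intro t. symmetry; apply hyp01_shift.
    + eapply Cderiv_eq; [apply Cderiv_div; [apply hyp01_deriv_k|apply sn_deriv|apply sn_nz]|].
      field. apply sn_nz.
Qed.
(** * The contiguity relation and the continued fraction *)

Lemma cgen_plus a b x k : cbounded a -> cbounded b ->
  cgen (fun p k => a p k + b p k)%C x k = (cgen a x k + cgen b x k)%C.
Proof.
  intros Ha Hb. destruct (cbounded_rbounded _ Ha) as [A1 A2], (cbounded_rbounded _ Hb) as [B1 B2].
  apply C_ext; unfold cgen; simpl.
  - transitivity (1 * gen (fun p k => Re (a p k)) x k + 1 * gen (fun p k => Re (b p k)) x k); [|ring].
    rewrite gen_lin by assumption. unfold gen; apply PSeries_ext; intro p. f_equal. unfold Re, Im; simpl; ring.
  - transitivity (1 * gen (fun p k => Im (a p k)) x k + 1 * gen (fun p k => Im (b p k)) x k); [|ring].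
    rewrite gen_lin by assumption. unfold gen; apply PSeries_ext; intro p. f_equal. unfold Re, Im; simpl; ring.
Qed.

Definition incr (a : nat -> R -> C) (p : nat) (k : R) : C :=
  match p with O => RtoC 0 | S p' => (RtoC (INR (S p')) * a p' k)%C end.

Lemma cbounded_incr a : cbounded a -> cbounded (incr a).
Proof.
  intros [B [q [HB [Hq H]]]]. exists B, (2 * q). split; [lra|]. split; [lra|].
  intros k [|p]; unfold incr; [rewrite Cmod_0; simpl; lra|].
  rewrite Cmod_mult, Cmod_R, Rabs_right by (apply Rle_ge, pos_INR).
  specialize (H k p).
  assert (INR (S p) <= 2 ^ S p).
  { clear. induction p as [|p IH]; [simpl; lra|]. rewrite S_INR. simpl pow in *.
    assert (1 <= 2 ^ p) by (apply pow_R1_Rle; lra). lra. }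
  assert (1 <= q ^ p) by now apply pow_R1_Rle.
  rewrite Rpow_mult_distr. generalize (pos_INR (S p)), (Cmod_ge_0 (a p k)); intros.
  apply Rle_trans with (2 ^ S p * (B * q ^ p)); [nra|].
  replace (B * (2 ^ S p * q ^ S p)) with (2 ^ S p * (B * q ^ p) * q) by (simpl; ring).
  assert (0 <= 2 ^ S p * (B * q ^ p)) by (apply Rmult_le_pos; [apply pow_le; lra | nra]). nra.
Qed.

Lemma cgen_incr a x k : cgen (incr a) x k = (RtoC x * cgen a x k)%C.
Proof.
  unfold cgen, gen. apply C_ext; simpl; rewrite ?Rmult_0_l, ?Rminus_0_r, ?Rplus_0_r;
    rewrite <- PSeries_incr_1; apply PSeries_ext; intros [|p]; unfold PS_incr_1, incr.
  - unfold zero; simpl. field.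
  - rewrite fact_simpl, mult_INR, re_scal_l. generalize (fact_pos p), (lt_0_INR (S p) (Nat.lt_0_succ p)); intros.
    field; lra.
  - unfold zero; simpl. field.
  - rewrite fact_simpl, mult_INR, im_scal_l. generalize (fact_pos p), (lt_0_INR (S p) (Nat.lt_0_succ p)); intros.
    field; lra.
Qed.

Lemma coef_cbounded n : cbounded (coef n).
Proof. apply (cgood_bounded 0), coef_good. Qed.

(** 1/(s)_p - 1/(s+1)_p = p / (s (s+1) (s+2)_(p-1)); the factor p cancels
    against p! and lowers the index, which produces the factor x in
    [hyp01_contig]. *)
Lemma coef_contig n p k :
  coef n p k = (coef (S n) p k + / (sn n k * sn (S n) k) * incr (coef (S (S n))) p k)%C.
Proof.
  destruct p as [|p]; unfold incr.
  - unfold coef; simpl rising. field.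
    repeat split; try apply sn_nz; apply C1_nz.
  - assert (E : coef (S n) (S p) k = (coef n (S p) k * sn n k / sn (n + S p) k)%C).
    { unfold coef. rewrite (rising_shift n k p).
      change (rising (sn (S n) k) (S p)) with (rising (sn (S n) k) p * (sn (S n) k + RtoC (INR p)))%C.
      rewrite sn_add. replace (S n + p)%nat with (n + S p)%nat by lia.
      field. repeat split; try apply sn_nz; apply rising_nz. }
    rewrite E, <- sn_add, (coef_shift n).
    assert (E' : coef (S (S n)) p k = (coef (S n) p k * sn (S n) k / (sn (S n) k + RtoC (INR p)))%C).
    { unfold coef. destruct p as [|p].
      - simpl. field. repeat split; try apply sn_nz; try (rewrite Cplus_0_r; apply sn_nz); apply C1_nz.
      - rewrite (rising_shift (S n) k p).
        change (rising (sn (S (S n)) k) (S p)) with (rising (sn (S (S n)) k) p * (sn (S (S n)) k + RtoC (INR p)))%C.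
        rewrite !sn_add. replace (S (S n) + p)%nat with (S n + S p)%nat by lia.
        field. repeat split; try apply sn_nz; apply rising_nz. }
    rewrite E', (sn_S n).
    replace (RtoC (INR (S p))) with (RtoC 1 + RtoC (INR p))%C by (rewrite <- RtoC_plus, S_INR; f_equal; ring).
    assert (Hs : (sn n k + (RtoC 1 + RtoC (INR p)) <> RtoC 0)%C).
    { replace (sn n k + (RtoC 1 + RtoC (INR p)))%C with (sn n k + RtoC (INR (S p)))%C
        by (rewrite S_INR, RtoC_plus; ring).
      rewrite sn_add. apply sn_nz. }
    assert (Hs1 := sn_nz (S n) k). rewrite sn_S in Hs1. assert (Hs0 := sn_nz n k).
    field. repeat split; auto. now rewrite <- Cplus_assoc.
Qed.

(** The three-term recurrence I_(nu) - I_(nu+2) = (2 (nu+1) / r) I_(nu+1). *)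
Lemma hyp01_contig n x k :
  hyp01 n x k = (hyp01 (S n) x k + RtoC x / (sn n k * sn (S n) k) * hyp01 (S (S n)) x k)%C.
Proof.
  unfold hyp01 at 1. rewrite (cgen_ext _ (fun p k' => coef (S n) p k' + / (sn n k * sn (S n) k) * incr (coef (S (S n))) p k')%C)
    by (intro; apply coef_contig).
  rewrite cgen_plus; [|apply coef_cbounded|].
  - rewrite cgen_scal by (apply cbounded_incr, coef_cbounded). rewrite cgen_incr.
    unfold hyp01. field. split; apply sn_nz.
  - apply (cbounded_mult (fun _ _ => / (sn n k * sn (S n) k))%C).
    + apply (cgood_bounded 0), cgood_const.
    + apply cbounded_incr, coef_cbounded.
Qed.

Lemma hyp01_0 n k : hyp01 n 0 k = RtoC 1.
Proof.
  unfold hyp01, cgen, gen. rewrite !PSeries_0. unfold coef; simpl.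
  apply C_ext; simpl; field.
Qed.

Lemma hyp01_bound n x k : Rabs (Re (hyp01 n x k)) <= exp (Rabs x) /\ Rabs (Im (hyp01 n x k)) <= exp (Rabs x).
Proof.
  assert (H : forall p, Cmod (coef n p k) <= 1 * 1 ^ p).
  { intro p. rewrite pow1, Rmult_1_l. eapply Rle_trans; [apply coef_bound|].
    rewrite <- (pow1 p) at 2. generalize (pos_INR n); intro.
    apply pow_incr. split; [left; apply Rinv_0_lt_compat; lra|].
    rewrite <- Rinv_1. apply Rinv_le_contravar; lra. }
  unfold hyp01, cgen, gen. unfold Re at 1, Im at 2. cbn [fst snd].
  replace (exp (Rabs x)) with (1 * exp (1 * Rabs x)) by (rewrite !Rmult_1_l; reflexivity).
  split; apply geo_bound_sum; intro p; (eapply Rle_trans; [|apply H]);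
    [apply Re_le_Cmod|apply Im_le_Cmod].
Qed.

Lemma Cmod_le_sum z : Cmod z <= Rabs (Re z) + Rabs (Im z).
Proof.
  destruct z as [a b]. simpl.
  replace (a, b) with (RtoC a + Ci * RtoC b)%C by (apply C_ext; simpl; ring).
  eapply Rle_trans; [apply Cmod_triangle|].
  rewrite Cmod_mult, Cmod_Ci, !Cmod_R, Rmult_1_l. lra.
Qed.

Lemma hyp01_near_1 n x k :
  Rabs (Re (hyp01 n x k) - 1) <= 2 * exp (Rabs x) * Rabs x / (INR n + 1) /\
  Rabs (Im (hyp01 n x k)) <= 2 * exp (Rabs x) * Rabs x / (INR n + 1).
Proof.
  assert (Hn := pos_INR n).
  assert (Hb : forall t, Rabs t <= Rabs x -> Cmod (hyp01 (S n) t k / sn n k) <= 2 * exp (Rabs x) / (INR n + 1)).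
  { intros t Ht. rewrite Cmod_div by apply sn_nz.
    apply Rmult_le_compat; [apply Cmod_ge_0| | |].
    - left. apply Rinv_0_lt_compat, Cmod_gt_0, sn_nz.
    - eapply Rle_trans; [apply Cmod_le_sum|]. destruct (hyp01_bound (S n) t k).
      assert (exp (Rabs t) <= exp (Rabs x)).
      { destruct Ht as [Ht|Ht]; [left; now apply exp_increasing|rewrite Ht; lra]. }
      lra.
    - apply Rinv_le_contravar; [lra|apply sn_mod]. }
  split.
  - destruct (MVT_R (fun t => Re (hyp01 n t k)) (fun t => Re (hyp01 (S n) t k / sn n k)%C) 0 x) as [c [Hc1 Hc2]].
    { intro t. exact (proj1 (hyp01_deriv_x n t k)). }
    rewrite hyp01_0 in Hc2. rewrite !Rminus_0_r in Hc1. rewrite Rminus_0_r in Hc2. change (Re (RtoC 1)) with 1 in Hc2. rewrite Hc2, Rabs_mult.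
    replace (2 * exp (Rabs x) * Rabs x / (INR n + 1)) with (2 * exp (Rabs x) / (INR n + 1) * Rabs x) by (field; lra).
    apply Rmult_le_compat_r; [apply Rabs_pos|]. eapply Rle_trans; [apply Re_le_Cmod|]. now apply Hb.
  - destruct (MVT_R (fun t => Im (hyp01 n t k)) (fun t => Im (hyp01 (S n) t k / sn n k)%C) 0 x) as [c [Hc1 Hc2]].
    { intro t. exact (proj2 (hyp01_deriv_x n t k)). }
    rewrite hyp01_0 in Hc2. rewrite !Rminus_0_r in Hc1. rewrite Rminus_0_r in Hc2. change (Im (RtoC 1)) with 0 in Hc2. rewrite ?Rminus_0_r in Hc2.
    rewrite Hc2, Rabs_mult.
    replace (2 * exp (Rabs x) * Rabs x / (INR n + 1)) with (2 * exp (Rabs x) / (INR n + 1) * Rabs x) by (field; lra).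
    apply Rmult_le_compat_r; [apply Rabs_pos|]. eapply Rle_trans; [apply Im_le_Cmod|]. now apply Hb.
Qed.

Lemma large_INR (X : R) : exists n0 : nat, forall n, (n0 <= n)%nat -> X < INR n.
Proof.
  destruct (INR_unbounded X) as [n0 H]. exists n0. intros n Hn. apply le_INR in Hn. lra.
Qed.

(** (r/2) I_nu / I_(nu+1) for nu = n - i k.  By [cfrac_rec] it is the
    continued fraction s_n + x / (s_(n+1) + x / (s_(n+2) + ...)), and for n = 0
    it is the inverse of the mean resultant. *)
Definition cfrac (n : nat) (x k : R) : C := (sn n k * hyp01 n x k / hyp01 (S n) x k)%C.

Lemma Re_div_pos (z w : C) : 0 < Re (z * Cconj w)%C -> w <> RtoC 0 /\ 0 < Re (z / w)%C.
Proof.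
  intro H. assert (Hw : w <> RtoC 0).
  { intros ->. simpl in H. lra. }
  split; [exact Hw|]. assert (Hn := norm2_pos _ Hw).
  destruct z as [a b], w as [c d]. simpl in *.
  replace (a * (c / (c * (c * 1) + d * (d * 1))) - b * (- d / (c * (c * 1) + d * (d * 1))))
    with ((a * c - b * - d) / (c * c + d * d)) by (field; nra).
  apply Rdiv_lt_0_compat; [exact H|exact Hn].
Qed.

Lemma Re_inv z : z <> RtoC 0 -> Re (/ z)%C = Re z / (Re z * Re z + Im z * Im z).
Proof. intro H. assert (Hn := norm2_pos _ H). destruct z; simpl in *. field; nra. Qed.

Lemma Im_inv z : z <> RtoC 0 -> Im (/ z)%C = - Im z / (Re z * Re z + Im z * Im z).
Proof. intro H. assert (Hn := norm2_pos _ H). destruct z; simpl in *. field; nra. Qed.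

Lemma cfrac_large x k : exists n0 : nat, forall n, (n0 <= n)%nat ->
  hyp01 (S n) x k <> RtoC 0 /\ 0 < Re (cfrac n x k).
Proof.
  set (L := 2 * exp (Rabs x) * Rabs x).
  destruct (large_INR (4 * L + 2 * Rabs k)) as [n0 H0]. exists n0. intros n Hn.
  assert (HL : 0 <= L) by (unfold L; generalize (exp_pos (Rabs x)), (Rabs_pos x); nra).
  assert (Hs : forall m, (n <= m)%nat -> L / (INR m + 1) <= / 4).
  { intros m Hm. assert (H1 := H0 m ltac:(lia)). generalize (Rabs_pos k), (pos_INR m); intros.
    apply Rmult_le_reg_r with (INR m + 1); [lra|]. unfold Rdiv. rewrite Rmult_assoc, Rinv_l; lra. }
  destruct (hyp01_near_1 n x k) as [A1 A2], (hyp01_near_1 (S n) x k) as [B1 B2].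
  fold L in A1, A2, B1, B2.
  assert (S1 := Hs n ltac:(lia)). assert (S2 := Hs (S n) ltac:(lia)).
  assert (K1 := H0 n Hn).
  assert (C1 : Rabs (Re (hyp01 n x k) - 1) <= / 4) by lra.
  assert (C2 : Rabs (Im (hyp01 n x k)) <= / 4) by lra.
  assert (C3 : Rabs (Re (hyp01 (S n) x k) - 1) <= / 4) by lra.
  assert (C4 : Rabs (Im (hyp01 (S n) x k)) <= / 4) by lra.
  apply Rabs_le_between in C1, C2, C3, C4.
  apply Re_div_pos.
  destruct (hyp01 n x k) as [a b], (hyp01 (S n) x k) as [c d]. simpl in *.
  assert (E1 : 1/2 <= a * c + b * d) by nra.
  assert (E2 : Rabs (b * c - a * d) <= 1) by (apply Rabs_le; nra).
  apply Rabs_le_between in E2.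
  assert (E3 : Rabs (k * (b * c - a * d)) <= Rabs k).
  { rewrite Rabs_mult. apply Rabs_le in E2. generalize (Rabs_pos k); nra. }
  apply Rabs_le_between in E3.
  assert (0 <= Rabs k) by apply Rabs_pos.
  assert (0 <= INR n) by apply pos_INR.
  replace (_ - _) with ((INR n + 1) * (a * c + b * d) + k * (b * c - a * d)) by ring.
  nra.
Qed.

Lemma cfrac_rec_aux n x k : hyp01 (S n) x k <> RtoC 0 -> hyp01 (S (S n)) x k <> RtoC 0 ->
  cfrac n x k = (sn n k + RtoC x / cfrac (S n) x k)%C.
Proof.
  intros H1 H2. unfold cfrac. rewrite (hyp01_contig n). field.
  repeat split; auto; apply sn_nz.
Qed.

(** Both series tend to 1 as n grows, so the real part is positive for large
    n; the recurrence carries positivity, and with it the absence of zeros of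
    the denominator, down to every n. *)
Lemma cfrac_basic n x k : 0 <= x -> hyp01 (S n) x k <> RtoC 0 /\ 0 < Re (cfrac n x k).
Proof.
  intro Hx. destruct (cfrac_large x k) as [n0 H0].
  assert (H : forall m n, (n + m >= n0)%nat -> hyp01 (S n) x k <> RtoC 0 /\ 0 < Re (cfrac n x k)).
  { clear n. induction m as [|m IH]; intros n Hn; [apply H0; lia|].
    destruct (IH (S n)) as [G1 G2]; [lia|].
    assert (HF : hyp01 (S n) x k <> RtoC 0).
    { intro E. unfold cfrac in G2. rewrite E in G2.
      replace (sn (S n) k * 0 / hyp01 (S (S n)) x k)%C with (RtoC 0) in G2 by (field; exact G1).
      simpl in G2; lra. }
    split; [exact HF|]. rewrite cfrac_rec_aux by assumption.
    assert (HN : cfrac (S n) x k <> RtoC 0) by (intro E; rewrite E in G2; simpl in G2; lra).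
    assert (Hn2 := norm2_pos _ HN).
    assert (Hi := Re_inv _ HN).
    unfold Cdiv. replace (Re (sn n k + RtoC x * / cfrac (S n) x k)%C) with (INR n + 1 + x * Re (/ cfrac (S n) x k)%C)
      by (rewrite <- re_scal_l; reflexivity).
    rewrite Hi. assert (0 <= x * (Re (cfrac (S n) x k) / (Re (cfrac (S n) x k) * Re (cfrac (S n) x k) + Im (cfrac (S n) x k) * Im (cfrac (S n) x k)))).
    { apply Rmult_le_pos; [exact Hx|]. left. apply Rdiv_lt_0_compat; lra. }
    generalize (pos_INR n); lra. }
  apply (H n0); lia.
Qed.

Lemma hyp01_nz n x k : 0 <= x -> hyp01 n x k <> RtoC 0.
Proof.
  intro Hx. destruct (cfrac_basic n x k Hx) as [H1 H2]. intro E.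
  unfold cfrac in H2. rewrite E in H2.
  replace (sn n k * 0 / hyp01 (S n) x k)%C with (RtoC 0) in H2 by (field; exact H1). simpl in H2; lra.
Qed.

Lemma cfrac_nz n x k : 0 <= x -> cfrac n x k <> RtoC 0.
Proof.
  intro Hx. destruct (cfrac_basic n x k Hx) as [H1 H2]. intro E. rewrite E in H2; simpl in H2; lra.
Qed.

Lemma cfrac_rec n x k : 0 <= x -> cfrac n x k = (sn n k + RtoC x / cfrac (S n) x k)%C.
Proof. intro Hx. apply cfrac_rec_aux; now apply hyp01_nz. Qed.

Lemma cfrac_mul n x k : 0 <= x ->
  (cfrac n x k * cfrac (S n) x k)%C = (sn n k * cfrac (S n) x k + RtoC x)%C.
Proof. intro Hx. rewrite (cfrac_rec n) by exact Hx. field. now apply cfrac_nz. Qed.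

Definition cfrac_x (n : nat) (x k : R) : C := (RtoC 1 - cfrac n x k / cfrac (S n) x k)%C.
(** i times the derivative in k, that is, the derivative in the order nu. *)
Definition cfrac_nu (n : nat) (x k : R) : C :=
  (Ci * ((- Ci * hyp01 n x k + sn n k * hyp01_k n x k) * hyp01 (S n) x k - sn n k * hyp01 n x k * hyp01_k (S n) x k)
   / (hyp01 (S n) x k * hyp01 (S n) x k))%C.

Lemma cfrac_deriv_x n x k : 0 <= x -> Cderiv (fun t => cfrac n t k) x (cfrac_x n x k).
Proof.
  intro Hx. assert (H1 := hyp01_nz (S n) x k Hx). assert (H2 := hyp01_nz (S (S n)) x k Hx).
  assert (H3 := cfrac_nz (S n) x k Hx).
  eapply Cderiv_eq.
  - unfold cfrac. apply Cderiv_div; [|apply hyp01_deriv_x|exact H1].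
    apply Cderiv_mult; [apply Cderiv_const|apply hyp01_deriv_x].
  - cbv beta. unfold cfrac_x, cfrac. field. repeat split; auto; apply sn_nz.
Qed.

Lemma cfrac_deriv_k n x k : 0 <= x -> Cderiv (fun t => cfrac n x t) k (- Ci * cfrac_nu n x k)%C.
Proof.
  intro Hx. assert (H1 := hyp01_nz (S n) x k Hx).
  eapply Cderiv_eq.
  - unfold cfrac. apply Cderiv_div; [|apply hyp01_deriv_k|exact H1].
    apply Cderiv_mult; [apply sn_deriv|apply hyp01_deriv_k].
  - unfold cfrac_nu.
    transitivity ((- (Ci * Ci)) * ((- Ci * hyp01 n x k + sn n k * hyp01_k n x k) * hyp01 (S n) x k - sn n k * hyp01 n x k * hyp01_k (S n) x k)
   / (hyp01 (S n) x k * hyp01 (S n) x k))%C; [|field; auto].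
    replace (- (Ci * Ci))%C with (RtoC 1) by (apply C_ext; simpl; ring). field; auto.
Qed.

Lemma cfrac_x_N1 n x k : 0 <= x -> (cfrac_x n x k * cfrac (S n) x k)%C = (cfrac (S n) x k - cfrac n x k)%C.
Proof. intro Hx. unfold cfrac_x. field. now apply cfrac_nz. Qed.

(** The Riccati equation equivalent to the Bessel equation. *)
Lemma cfrac_x_riccati n x k : 0 <= x ->
  (RtoC x * cfrac_x n x k)%C = (RtoC x + sn n k * cfrac n x k - cfrac n x k * cfrac n x k)%C.
Proof.
  intro Hx. unfold cfrac_x. assert (H := cfrac_mul n x k Hx). assert (Hz := cfrac_nz (S n) x k Hx).
  assert (E : RtoC x = (cfrac n x k * cfrac (S n) x k - sn n k * cfrac (S n) x k)%C) by (rewrite H; ring).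
  rewrite E. field. exact Hz.
Qed.

Lemma cfrac_x_rec n x k : 0 <= x ->
  (cfrac_x n x k * cfrac (S n) x k)%C = (RtoC 1 - RtoC x * cfrac_x (S n) x k / cfrac (S n) x k)%C.
Proof.
  intro Hx. rewrite cfrac_x_riccati, cfrac_x_N1 by exact Hx. rewrite (cfrac_rec n x k Hx), sn_S. field. now apply cfrac_nz.
Qed.

(** Derivative in nu of the recurrence [cfrac_rec]. *)
Lemma cfrac_nu_rec n x k : 0 <= x ->
  cfrac_nu n x k = (RtoC 1 - RtoC x * cfrac_nu (S n) x k / (cfrac (S n) x k * cfrac (S n) x k))%C.
Proof.
  intro Hx. assert (Hz := cfrac_nz (S n) x k Hx).
  assert (H : (- Ci * cfrac_nu n x k)%C = (- Ci - RtoC x * (- Ci * cfrac_nu (S n) x k) / (cfrac (S n) x k * cfrac (S n) x k))%C).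
  { apply (Cderiv_unique (fun t => cfrac n x t) k); [now apply cfrac_deriv_k|].
    apply (Cderiv_ext (fun t => sn n t + RtoC x / cfrac (S n) x t)%C); [intro; symmetry; now apply cfrac_rec|].
    eapply Cderiv_eq.
    - apply Cderiv_plus; [apply sn_deriv|].
      apply Cderiv_div; [apply Cderiv_const|now apply cfrac_deriv_k|exact Hz].
    - cbv beta. field. exact Hz. }
  transitivity (Ci * (- Ci * cfrac_nu n x k))%C.
  - replace (Ci * (- Ci * cfrac_nu n x k))%C with ((- (Ci * Ci)) * cfrac_nu n x k)%C by ring.
    replace (- (Ci * Ci))%C with (RtoC 1) by (apply C_ext; simpl; ring). ring.
  - rewrite H.
    transitivity ((- (Ci * Ci)) * (RtoC 1 - RtoC x * cfrac_nu (S n) x k / (cfrac (S n) x k * cfrac (S n) x k)))%C; [field; exact Hz|].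
    replace (- (Ci * Ci))%C with (RtoC 1) by (apply C_ext; simpl; ring). ring.
Qed.

Lemma cfrac_x_deriv n x k : 0 <= x ->
  Cderiv (fun t => cfrac_x n t k) x
    (- (cfrac_x n x k * cfrac (S n) x k - cfrac n x k * cfrac_x (S n) x k) / (cfrac (S n) x k * cfrac (S n) x k))%C.
Proof.
  intro Hx. eapply Cderiv_eq.
  - unfold cfrac_x at 1. apply Cderiv_minus; [apply Cderiv_const|].
    apply Cderiv_div; [now apply cfrac_deriv_x | now apply cfrac_deriv_x | now apply cfrac_nz].
  - cbv beta. field. now apply cfrac_nz.
Qed.

Local Opaque hyp01 hyp01_k.
Lemma cfrac_nu_deriv n x k : 0 <= x ->
  Cderiv (fun t => cfrac_nu n t k) x
    (- (cfrac_nu n x k * cfrac (S n) x k - cfrac n x k * cfrac_nu (S n) x k) / (cfrac (S n) x k * cfrac (S n) x k))%C.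
Proof.
  intro Hx. assert (H1 := hyp01_nz (S n) x k Hx). assert (H2 := hyp01_nz (S (S n)) x k Hx).
  assert (Hc : forall c t, Cderiv (fun _ => c) t (RtoC 0)) by (intros; apply Cderiv_const).
  eapply Cderiv_eq.
  - unfold cfrac_nu at 1. apply Cderiv_div.
    + apply Cderiv_mult; [apply Hc|]. apply Cderiv_minus; apply Cderiv_mult.
      * apply Cderiv_plus; apply Cderiv_mult; [apply Hc|apply hyp01_deriv_x|apply Hc|apply hyp01_k_deriv_x].
      * apply hyp01_deriv_x.
      * apply Cderiv_mult; [apply Hc|apply hyp01_deriv_x].
      * apply hyp01_k_deriv_x.
    + apply Cderiv_mult; apply hyp01_deriv_x.
    + now apply Cmult_neq_0.
  - cbv beta. unfold cfrac_nu, cfrac. field. repeat split; auto; apply sn_nz.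
Qed.
Local Transparent hyp01 hyp01_k.

(** * Gauss's product and the Bessel quotient *)

Lemma polar_mult r1 t1 r2 t2 : (polar r1 t1 * polar r2 t2)%C = polar (r1 * r2) (t1 + t2).
Proof. unfold polar. apply C_ext; simpl; rewrite ?cos_plus, ?sin_plus; ring. Qed.

Lemma polar_nz r t : 0 < r -> polar r t <> RtoC 0.
Proof. intros H E. generalize (Cmod_polar r t ltac:(lra)). rewrite E, Cmod_0. lra. Qed.

Lemma polar_0 : polar 1 0 = RtoC 1.
Proof. unfold polar. rewrite cos_0, sin_0. apply C_ext; simpl; ring. Qed.

Definition is_Clim (u : nat -> C) (l : C) : Prop :=
  is_lim_seq (fun n => Re (u n)) (Re l) /\ is_lim_seq (fun n => Im (u n)) (Im l).

Lemma is_Clim_unique u l : is_Clim u l -> Clim_seq u = l.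
Proof.
  intros [H1 H2]. unfold Clim_seq. rewrite (is_lim_seq_unique _ _ H1), (is_lim_seq_unique _ _ H2).
  apply C_ext; reflexivity.
Qed.

Lemma is_Clim_ext u v l : (forall n, u n = v n) -> is_Clim u l -> is_Clim v l.
Proof.
  intros H [H1 H2]; split; (eapply is_lim_seq_ext; [|eassumption]); intro n; simpl; now rewrite H.
Qed.

Lemma is_Clim_const c : is_Clim (fun _ => c) c.
Proof. split; apply is_lim_seq_const. Qed.

Lemma is_Clim_mult u v l m : is_Clim u l -> is_Clim v m -> is_Clim (fun n => u n * v n)%C (l * m)%C.
Proof.
  intros [H1 H2] [H3 H4]; split; simpl.
  - apply is_lim_seq_minus'; apply is_lim_seq_mult'; assumption.
  - apply is_lim_seq_plus'; apply is_lim_seq_mult'; assumption.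
Qed.

Lemma is_Clim_incr_1 u l : is_Clim (fun n => u (S n)) l -> is_Clim u l.
Proof. intros [H1 H2]; split; now apply is_lim_seq_incr_1. Qed.

Lemma is_Clim_Cmod u l b : (forall n, Cmod (u n - l)%C <= b n) -> is_lim_seq b 0 -> is_Clim u l.
Proof.
  intros H Hb.
  assert (K : forall w : nat -> R, forall y, (forall n, Rabs (w n - y) <= b n) -> is_lim_seq w y).
  { intros w y Hw.
    apply (is_lim_seq_ext (fun n => (w n - y) + y)); [intro; ring|].
    replace (Finite y) with (Finite (0 + y)) by (f_equal; ring).
    apply is_lim_seq_plus'; [|apply is_lim_seq_const].
    apply is_lim_seq_abs_0. apply (is_lim_seq_le_le (fun _ => 0) _ b); [|apply is_lim_seq_const|exact Hb].
    intro n; split; [apply Rabs_pos|apply Hw]. }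
  split; apply K; intro n; (eapply Rle_trans; [|apply H]).
  - apply (Re_le_Cmod (u n - l)%C).
  - apply (Im_le_Cmod (u n - l)%C).
Qed.

Lemma is_Clim_polar (a t : nat -> R) (A Th : R) : is_lim_seq a A -> is_lim_seq t Th ->
  is_Clim (fun n => polar (a n) (t n)) (polar A Th).
Proof.
  intros Ha Ht. split; simpl; apply is_lim_seq_mult'; auto.
  - apply (is_lim_seq_continuous cos t Th); [apply continuity_cos|exact Ht].
  - apply (is_lim_seq_continuous sin t Th); [apply continuity_sin|exact Ht].
Qed.

(** A convergent majorant that telescopes. *)
Definition telesc (n : nat) : R := / ((INR n + 1) * (INR n + 2)).

Lemma telesc_series : ex_series telesc.
Proof.
  exists 1. change (is_lim_seq (sum_n telesc) 1). apply (is_lim_seq_ext (fun n => 1 - / (INR n + 2))).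
  - induction n as [|n IH].
    + rewrite sum_O. unfold telesc. simpl. field.
    + rewrite sum_Sn, <- IH. unfold telesc, plus; simpl plus. rewrite S_INR.
      generalize (pos_INR n); intro. simpl. field. lra.
  - replace (Finite 1) with (Finite (1 - 0)) by (f_equal; ring).
    apply is_lim_seq_minus'; [apply is_lim_seq_const|].
    replace (Finite 0) with (Rbar_inv p_infty) by reflexivity.
    apply is_lim_seq_inv; [|discriminate].
    apply (is_lim_seq_plus _ _ p_infty 2); [apply is_lim_seq_INR|apply is_lim_seq_const|reflexivity].
Qed.

Lemma dominated_ex_series (a : nat -> R) c : (forall n, Rabs (a n) <= c * telesc n) -> ex_series a.
Proof.
  intro H. apply (ex_series_le (K := R_AbsRing) (V := R_CompleteNormedModule) a (fun n => c * telesc n)).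
  - exact H.
  - apply (ex_series_scal (K := R_AbsRing) (V := R_NormedModule) c). apply telesc_series.
Qed.

(** The partial products are exponentials of partial sums, so the limit is an
    exponential as well and in particular not 0. *)
Lemma polar_product_lim (u : nat -> C) (a th : nat -> R) :
  (forall n, u (S n) = (u n * polar (exp (a n)) (th n))%C) ->
  u O <> RtoC 0 -> ex_series a -> ex_series th ->
  exists l, l <> RtoC 0 /\ is_Clim u l.
Proof.
  intros Hu H0 [A HA] [Th HTh].
  exists (u O * polar (exp A) Th)%C. split.
  { apply Cmult_neq_0; [exact H0|]. apply polar_nz, exp_pos. }
  apply is_Clim_incr_1.
  apply (is_Clim_ext (fun n => u O * polar (exp (sum_n a n)) (sum_n th n))%C).
  - induction n as [|n IH]; [rewrite !sum_O; now rewrite Hu|].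
    rewrite Hu, <- IH, !sum_Sn. unfold plus; simpl. rewrite exp_plus, <- polar_mult. ring.
  - apply is_Clim_mult; [apply is_Clim_const|]. apply is_Clim_polar; [|exact HTh].
    apply (is_lim_seq_continuous exp _ A); [|exact HA].
    apply derivable_continuous_pt, derivable_pt_exp.
Qed.

Lemma ln_1p_le t : -1 < t -> ln (1 + t) <= t.
Proof.
  intro H. rewrite <- (ln_exp t) at 2. apply ln_le; [lra|]. apply exp_ineq1_le.
Qed.

Lemma ln_1p_ge t : 0 <= t -> t / (1 + t) <= ln (1 + t).
Proof.
  intro H. replace (1 + t) with (/ (1 + (- t / (1 + t)))) at 2 by (field; lra).
  assert (H1 : 0 < 1 + - t / (1 + t)) by (replace (1 + - t / (1 + t)) with (/ (1 + t)) by (field; lra); apply Rinv_0_lt_compat; lra).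
  rewrite ln_Rinv by exact H1.
  assert (H2 := ln_1p_le (- t / (1 + t)) ltac:(lra)).
  replace (t / (1 + t)) with (- (- t / (1 + t))) by (field; lra). lra.
Qed.

Lemma atan_near y : Rabs (atan y - y) <= y * y.
Proof.
  destruct (MVT_R atan (fun c => / (1 + c * c)) 0 y) as [c [Hc1 Hc2]].
  { intro t. apply is_derive_Reals. replace (/ (1 + t * t)) with (/ (1 + t ^ 2)) by (f_equal; ring).
    apply derivable_pt_lim_atan. }
  rewrite atan_0, !Rminus_0_r in *.
  assert (Hcc : 0 < 1 + c * c) by nra.
  rewrite Hc2. replace (/ (1 + c * c) * y - y) with (- (y * (c * c / (1 + c * c)))) by (field; lra).
  rewrite Rabs_Ropp, Rabs_mult.
  replace (y * y) with (Rabs y * Rabs y) by (rewrite <- Rabs_mult; apply Rabs_right; nra).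
  apply Rmult_le_compat_l; [apply Rabs_pos|].
  rewrite Rabs_right by (apply Rle_ge; apply Rdiv_le_0_compat; nra).
  apply Rle_trans with (Rabs c); [|exact Hc1].
  apply Rmult_le_reg_r with (1 + c * c); [lra|]. unfold Rdiv. rewrite Rmult_assoc, Rinv_l by lra.
  assert (c * c = Rabs c * Rabs c) by (rewrite <- Rabs_mult; symmetry; apply Rabs_right; nra).
  generalize (Rabs_pos c); intro. rewrite H. nra.
Qed.

Lemma polar_rect a b : 0 < a -> polar (sqrt (a * a + b * b)) (atan (b / a)) = (a, b).
Proof.
  intro Ha. unfold polar. rewrite cos_atan, sin_atan.
  assert (H : sqrt (a * a + b * b) = a * sqrt (1 + Rsqr (b / a))).
  { transitivity (sqrt (a * a) * sqrt (1 + Rsqr (b / a))); [|rewrite sqrt_square by lra; reflexivity].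
    rewrite <- sqrt_mult; [|nra|generalize (Rle_0_sqr (b / a)); lra].
    f_equal. unfold Rsqr. field. lra. }
  assert (Hs : 0 < sqrt (1 + Rsqr (b / a))) by (apply sqrt_lt_R0; generalize (Rle_0_sqr (b / a)); lra).
  rewrite H. f_equal; field; lra.
Qed.

Definition gauss (s : C) (n : nat) : C :=
  (RtoC (INR (fact n)) * Rcpow (INR n) s / rising s (S n))%C.

Lemma Rcpow_mult_pos x y s : 0 < x -> 0 < y -> Rcpow (x * y) s = (Rcpow x s * Rcpow y s)%C.
Proof.
  intros Hx Hy. unfold Rcpow. rewrite polar_mult, ln_mult by assumption.
  rewrite <- exp_plus. f_equal; [f_equal|]; ring.
Qed.

(** Successive terms have the quotient exp(a_n + i theta_n) with a_n and
    theta_n of order 1 / n^2.  That the limit is not 0 matters as much as its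
    existence: the factor 1 / Gamma(1 - ik) cancels in the Bessel quotient. *)
Lemma gauss_converges k : exists g, g <> RtoC 0 /\ is_Clim (gauss (sn 0 k)) g.
Proof.
  set (a := fun n => ln (1 + / ((INR n + 1) * (INR n + 3))) - / 2 * ln (1 + (k / (INR n + 3)) * (k / (INR n + 3)))).
  set (th := fun n => - k * ln (1 + / (INR n + 1)) + atan (k / (INR n + 3))).
  destruct (polar_product_lim (fun n => gauss (sn 0 k) (S n)) a th) as [g [Hg1 Hg2]].
  - intro n. assert (Hn := pos_INR n).
    unfold gauss.
    change (rising (sn 0 k) (S (S (S n)))) with (rising (sn 0 k) (S (S n)) * (sn 0 k + RtoC (INR (S (S n)))))%C.
    assert (R0 := rising_nz 0 k (S (S n))). assert (R1 := sn_nz (S (S n)) k).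
    rewrite sn_add. change (0 + S (S n))%nat with (S (S n)).
    replace (INR (S (S n))) with (INR (S n) * (1 + / (INR n + 1))) at 1 by (rewrite !S_INR; field; lra).
    assert (Hq : 0 < / (INR n + 1)) by (apply Rinv_0_lt_compat; lra).
    rewrite Rcpow_mult_pos by (rewrite ?S_INR; lra).
    rewrite (fact_simpl (S n)), mult_INR, RtoC_mult.
    assert (Hp : (RtoC (INR (S (S n))) * Rcpow (1 + / (INR n + 1)) (sn 0 k) / sn (S (S n)) k)%C = polar (exp (a n)) (th n)).
    { set (w := (INR n + 3) * (INR n + 3) + k * k).
      assert (Hw : 0 < w) by (unfold w; nra).
      assert (E1 : sn (S (S n)) k = polar (sqrt w) (- atan (k / (INR n + 3)))).
      { replace (- atan (k / (INR n + 3))) with (atan (- k / (INR n + 3))) by (rewrite <- atan_opp; f_equal; field; lra).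
        unfold w. replace (k * k) with (- k * - k) by ring. rewrite polar_rect by lra.
        unfold sn. rewrite !S_INR. f_equal; ring. }
      assert (E2 : polar (exp (a n)) (th n) = ((RtoC (INR (S (S n))) * Rcpow (1 + / (INR n + 1)) (sn 0 k)) * polar (/ sqrt w) (atan (k / (INR n + 3))))%C).
      { replace (RtoC (INR (S (S n)))) with (polar (INR (S (S n))) 0).
        2:{ unfold polar. rewrite cos_0, sin_0. apply C_ext; simpl Re; simpl Im; ring. }
        unfold Rcpow. rewrite !polar_mult. unfold sn, Re, Im; cbn [fst snd]. simpl (INR 0).
        assert (Hsw : 0 < sqrt w) by now apply sqrt_lt_R0.
        f_equal.
        - replace ((0 + 1) * ln (1 + / (INR n + 1))) with (ln (1 + / (INR n + 1))) by ring.
          rewrite exp_ln by lra. rewrite <- (exp_ln (INR (S (S n)) * _ * / sqrt w)).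
          2:{ rewrite !S_INR. apply Rmult_lt_0_compat; [nra|now apply Rinv_0_lt_compat]. }
          f_equal. unfold a.
          assert (Z1 : / 2 * ln (1 + k / (INR n + 3) * (k / (INR n + 3))) = ln (sqrt w) - ln (INR n + 3)).
          { replace (1 + k / (INR n + 3) * (k / (INR n + 3))) with ((sqrt w / (INR n + 3)) * (sqrt w / (INR n + 3))).
            2:{ replace (sqrt w / (INR n + 3) * (sqrt w / (INR n + 3))) with (sqrt w * sqrt w / ((INR n + 3) * (INR n + 3))) by (field; lra).
                rewrite sqrt_sqrt by lra. unfold w. field. lra. }
            assert (Hd : 0 < sqrt w / (INR n + 3)) by (apply Rdiv_lt_0_compat; lra).
            rewrite ln_mult by assumption. unfold Rdiv. rewrite ln_mult, ln_Rinv by (try apply Rinv_0_lt_compat; lra).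
            field. }
          rewrite Z1.
          replace (1 + / ((INR n + 1) * (INR n + 3))) with ((INR (S (S n)) * (1 + / (INR n + 1))) * / (INR n + 3))
            by (rewrite !S_INR; field; lra).
          assert (Hpos : 0 < INR (S (S n)) * (1 + / (INR n + 1))) by (rewrite !S_INR; nra).
          rewrite (ln_mult (INR (S (S n)) * (1 + / (INR n + 1))) (/ (INR n + 3))) by (try apply Rinv_0_lt_compat; lra).
          rewrite (ln_mult (INR (S (S n)) * (1 + / (INR n + 1))) (/ sqrt w)) by (try apply Rinv_0_lt_compat; lra).
          rewrite !ln_Rinv by lra. ring.
        - unfold th. ring. }
      rewrite E2. rewrite E1. assert (Hsw : 0 < sqrt w) by now apply sqrt_lt_R0.
      assert (E3 : (polar (/ sqrt w) (atan (k / (INR n + 3))) * polar (sqrt w) (- atan (k / (INR n + 3))))%C = RtoC 1).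
      { rewrite polar_mult. replace (/ sqrt w * sqrt w) with 1 by (field; lra).
        replace (_ + - _) with 0 by ring. apply polar_0. }
      assert (Hnz : polar (sqrt w) (- atan (k / (INR n + 3))) <> RtoC 0) by now apply polar_nz.
      replace (polar (/ sqrt w) (atan (k / (INR n + 3)))) with (RtoC 1 / polar (sqrt w) (- atan (k / (INR n + 3))))%C.
      2:{ rewrite <- E3. field. exact Hnz. }
      field. exact Hnz. }
    rewrite <- Hp. field. split; assumption.
  - unfold gauss. unfold Cdiv. apply Cmult_neq_0; [apply Cmult_neq_0|].
    + apply RtoC_nz. simpl. lra.
    + apply polar_nz, exp_pos.
    + intro E. apply (f_equal (fun z => (z * rising (sn 0 k) 2)%C)) in E.
      rewrite Cinv_l, Cmult_0_l in E by apply rising_nz. now apply C1_nz in E.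
  - apply (dominated_ex_series _ (1 + k * k)). intro n. assert (Hn := pos_INR n). unfold a, telesc.
    assert (Hi : 0 < / ((INR n + 1) * (INR n + 3))) by (apply Rinv_0_lt_compat; nra).
    set (y := k / (INR n + 3)).
    assert (Hy : 0 <= y * y) by nra.
    assert (A1 := ln_1p_le _ ltac:(apply Rlt_trans with 0; [lra|exact Hi])).
    assert (A2 := ln_1p_ge _ (Rlt_le _ _ Hi)).
    assert (A3 := ln_1p_le (y * y) ltac:(lra)). assert (A4 := ln_1p_ge (y * y) Hy).
    assert (A5 : 0 <= / ((INR n + 1) * (INR n + 3)) / (1 + / ((INR n + 1) * (INR n + 3)))) by (apply Rdiv_le_0_compat; lra).
    assert (A6 : 0 <= y * y / (1 + y * y)) by (apply Rdiv_le_0_compat; lra).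
    assert (B1 : / ((INR n + 1) * (INR n + 3)) <= / ((INR n + 1) * (INR n + 2))) by (apply Rinv_le_contravar; nra).
    assert (B2 : y * y <= k * k * / ((INR n + 1) * (INR n + 2))).
    { replace (y * y) with (k * k * / ((INR n + 3) * (INR n + 3))) by (unfold y; field; lra).
      apply Rmult_le_compat_l; [nra|]. apply Rinv_le_contravar; nra. }
    apply Rabs_le. split; nra.
  - apply (dominated_ex_series _ (2 * Rabs k + k * k)). intro n. assert (Hn := pos_INR n). unfold th, telesc.
    set (y := k / (INR n + 3)).
    assert (Hi : 0 < / (INR n + 1)) by (apply Rinv_0_lt_compat; lra).
    assert (A1 := ln_1p_le (/ (INR n + 1)) ltac:(lra)). assert (A2 := ln_1p_ge _ (Rlt_le _ _ Hi)).
    replace (/ (INR n + 1) / (1 + / (INR n + 1))) with (/ (INR n + 2)) in A2 by (field; lra).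
    assert (A3 : / (INR n + 3) <= / (INR n + 2)) by (apply Rinv_le_contravar; lra).
    set (l := ln (1 + / (INR n + 1))) in *.
    assert (A4 : / (INR n + 1) - / (INR n + 3) <= 2 * / ((INR n + 1) * (INR n + 2))).
    { replace (/ (INR n + 1) - / (INR n + 3)) with (2 * / ((INR n + 1) * (INR n + 3))) by (field; lra).
      apply Rmult_le_compat_l; [lra|]. apply Rinv_le_contravar; nra. }
    assert (A5 := atan_near y).
    assert (B2 : y * y <= k * k * / ((INR n + 1) * (INR n + 2))).
    { replace (y * y) with (k * k * / ((INR n + 3) * (INR n + 3))) by (unfold y; field; lra).
      apply Rmult_le_compat_l; [nra|]. apply Rinv_le_contravar; nra. }
    replace (- k * l + atan y) with (- k * (l - / (INR n + 3)) + (atan y - y)) by (unfold y; field; lra).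
    eapply Rle_trans; [apply Rabs_triang|]. rewrite Rabs_mult, Rabs_Ropp, (Rabs_right (l - _)) by lra.
    assert (Rabs k * (l - / (INR n + 3)) <= Rabs k * (2 * / ((INR n + 1) * (INR n + 2))))
      by (apply Rmult_le_compat_l; [apply Rabs_pos|lra]).
    lra.
  - exists g. split; [exact Hg1|]. now apply is_Clim_incr_1.
Qed.

Lemma gauss_shift m k n : gauss (sn (S m) k) (S n) =
  (gauss (sn m k) (S n) * (sn m k * (RtoC (INR (S n)) / sn (m + S (S n)) k)))%C.
Proof.
  unfold gauss.
  assert (HR : Rcpow (INR (S n)) (sn (S m) k) = (Rcpow (INR (S n)) (sn m k) * RtoC (INR (S n)))%C).
  { assert (Hp : 0 < INR (S n)) by (apply lt_0_INR; lia).
    replace (RtoC (INR (S n))) with (polar (exp (ln (INR (S n)))) 0).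
    2:{ rewrite exp_ln by exact Hp. unfold polar. rewrite cos_0, sin_0. apply C_ext; simpl Re; simpl Im; ring. }
    unfold Rcpow. rewrite polar_mult, <- exp_plus. rewrite sn_S.
    f_equal; [f_equal|]; simpl Re; simpl Im; ring. }
  rewrite HR.
  assert (H1 : rising (sn (S m) k) (S (S n)) = (rising (sn m k) (S (S n)) * sn (m + S (S n)) k / sn m k)%C).
  { assert (E := rising_shift m k (S (S n))).
    change (rising (sn m k) (S (S (S n)))) with (rising (sn m k) (S (S n)) * (sn m k + RtoC (INR (S (S n)))))%C in E.
    rewrite sn_add in E. rewrite E. field. apply sn_nz. }
  rewrite H1. field. repeat split; first [apply rising_nz | apply sn_nz].
Qed.

(** The factor by which Gauss's products at s + 1 and at s differ, apart from
    s itself; its limit 1 gives the functional equation of Gamma. *)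
Lemma ratio_to_1 m k : is_Clim (fun n => RtoC (INR (S n)) / sn (m + S (S n)) k)%C (RtoC 1).
Proof.
  apply (is_Clim_Cmod _ _ (fun n => Cmod (sn (S m) k) * / INR (S n))).
  - intro n. assert (Hz := sn_nz (m + S (S n)) k).
    replace (RtoC (INR (S n)) / sn (m + S (S n)) k - 1)%C with (- sn (S m) k / sn (m + S (S n)) k)%C.
    + rewrite Cmod_div, Cmod_opp by exact Hz.
      apply Rmult_le_compat_l; [apply Cmod_ge_0|]. apply Rinv_le_contravar; [apply lt_0_INR; lia|].
      eapply Rle_trans; [|apply sn_mod]. rewrite plus_INR, !S_INR. generalize (pos_INR m), (pos_INR n); lra.
    + replace (sn (m + S (S n)) k) with (sn (S m) k + RtoC (INR (S n)))%C in *
        by (rewrite sn_add; f_equal; lia).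
      field. exact Hz.
  - replace (Finite 0) with (Rbar_mult (Cmod (sn (S m) k)) 0) by (simpl; f_equal; ring).
    apply is_lim_seq_scal_l. replace (Finite 0) with (Rbar_inv p_infty) by reflexivity.
    apply is_lim_seq_inv; [|discriminate]. apply -> is_lim_seq_incr_1. apply is_lim_seq_INR.
Qed.

Lemma gauss_lim k g : is_Clim (gauss (sn 0 k)) g -> forall n,
  is_Clim (gauss (sn n k)) (rising (sn 0 k) n * g)%C.
Proof.
  intros Hg. induction n as [|n IH].
  - simpl rising. now rewrite Cmult_1_l.
  - apply is_Clim_incr_1.
    apply (is_Clim_ext (fun j => gauss (sn n k) (S j) * (sn n k * (RtoC (INR (S j)) / sn (n + S (S j)) k)))%C);
      [intro j; symmetry; apply gauss_shift|].
    simpl rising. rewrite sn_add. change (0 + n)%nat with n.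
    replace (rising (sn 0 k) n * sn n k * g)%C with (rising (sn 0 k) n * g * (sn n k * RtoC 1))%C by ring.
    apply is_Clim_mult.
    + destruct IH as [H1 H2]. split.
      * exact (proj1 (is_lim_seq_incr_1 (fun j => Re (gauss (sn n k) j)) _) H1).
      * exact (proj1 (is_lim_seq_incr_1 (fun j => Im (gauss (sn n k) j)) _) H2).
    + apply is_Clim_mult; [apply is_Clim_const|]. apply ratio_to_1.
Qed.

Lemma Gamma_values k : exists g, g <> RtoC 0 /\
  forall n, Gamma (sn n k) = (rising (sn 0 k) n * g)%C.
Proof.
  destruct (gauss_converges k) as [g [Hg1 Hg2]]. exists g; split; [exact Hg1|].
  intro n. apply is_Clim_unique. exact (gauss_lim k g Hg2 n).
Qed.

Lemma CSeries_cgen a (c : C) x k u : cbounded a ->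
  (forall p, u p = (c * a p k * RtoC (x ^ p / INR (fact p)))%C) ->
  CSeries u = (c * cgen a x k)%C.
Proof.
  intros Ha Hu. rewrite <- cgen_scal by exact Ha.
  unfold CSeries, cgen, gen, PSeries. f_equal; apply Series_ext; intro p; rewrite Hu.
  - rewrite re_scal_r. unfold Rdiv. ring.
  - rewrite im_scal_r. unfold Rdiv. ring.
Qed.

Lemma Rcpow_add_R x nu y : 0 < x -> Rcpow x (nu + RtoC y)%C = (Rcpow x nu * RtoC (exp (y * ln x)))%C.
Proof.
  intro Hx. replace (RtoC (exp (y * ln x))) with (polar (exp (y * ln x)) 0).
  2:{ unfold polar. rewrite cos_0, sin_0. apply C_ext; simpl Re; simpl Im; ring. }
  unfold Rcpow. rewrite polar_mult, <- exp_plus. f_equal; [f_equal|]; unfold Re, Im; cbn [fst snd Cplus RtoC]; ring.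
Qed.

Lemma Rcpow_even x nu p : 0 < x -> Rcpow x (nu + RtoC (2 * INR p))%C = (Rcpow x nu * RtoC ((x * x) ^ p))%C.
Proof.
  intro Hx. rewrite Rcpow_add_R by exact Hx. f_equal. f_equal.
  rewrite <- (exp_ln ((x * x) ^ p)) by (apply pow_lt; nra). f_equal.
  rewrite ln_pow, ln_mult by nra. ring.
Qed.

(** Gamma(nu + p + 1) is the rising factorial times Gamma(1 - ik), and the
    latter cancels, as does the power (r/2)^nu. *)
Lemma mean_resultant_cfrac k r : 0 < r -> mean_resultant k r = (/ cfrac 0 (r * r / 4) k)%C.
Proof.
  intro Hr. destruct (Gamma_values k) as [g [Hg HG]].
  set (x := r * r / 4). assert (Hx : 0 <= x) by (unfold x; nra).
  assert (Hf : forall p, RtoC (INR (fact p)) <> RtoC 0).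
  { intro p. apply RtoC_nz. generalize (fact_pos p); lra. }
  assert (H0 : BesselI (- (Ci * RtoC k))%C r = (Rcpow (r / 2) (- (Ci * RtoC k))%C / g * hyp01 0 x k)%C).
  { unfold BesselI, hyp01. apply (CSeries_cgen (coef 0) _ x k); [apply coef_cbounded|]. intro p.
    replace (- (Ci * RtoC k) + RtoC (INR p) + RtoC 1)%C with (sn p k) by (apply C_ext; unfold sn; simpl; ring).
    rewrite HG, Rcpow_even by lra. replace (r / 2 * (r / 2)) with x by (unfold x; field).
    rewrite (RtoC_div (x ^ p)) by (generalize (fact_pos p); lra). unfold coef. field.
    repeat split; auto. apply rising_nz. }
  assert (H1 : BesselI (RtoC 1 - Ci * RtoC k)%C r = (Rcpow (r / 2) (- (Ci * RtoC k))%C * RtoC (r / 2) / (sn 0 k * g) * hyp01 1 x k)%C).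
  { unfold BesselI, hyp01. apply (CSeries_cgen (coef 1) _ x k); [apply coef_cbounded|]. intro p.
    replace (RtoC 1 - Ci * RtoC k + RtoC (INR p) + RtoC 1)%C with (sn (S p) k)
      by (apply C_ext; unfold sn; rewrite ?S_INR; simpl; ring).
    rewrite HG, rising_shift, Rcpow_even by lra. replace (r / 2 * (r / 2)) with x by (unfold x; field).
    replace (RtoC 1 - Ci * RtoC k)%C with (- (Ci * RtoC k) + RtoC 1)%C by ring.
    rewrite Rcpow_add_R by lra. rewrite Rmult_1_l, exp_ln by lra.
    rewrite (RtoC_div (x ^ p)) by (generalize (fact_pos p); lra). unfold coef. field.
    repeat split; auto; first [apply rising_nz | apply sn_nz]. }
  unfold mean_resultant. rewrite H0, H1. unfold cfrac.
  assert (Hr0 : RtoC r <> RtoC 0) by (apply RtoC_nz; lra).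
  assert (F0 := hyp01_nz 0 x k Hx). assert (F1 := hyp01_nz 1 x k Hx).
  assert (HRc : Rcpow (r / 2) (- (Ci * RtoC k))%C <> RtoC 0) by apply polar_nz, exp_pos.
  rewrite RtoC_div by lra. field.
  assert (H2 : RtoC 2 <> RtoC 0) by (apply RtoC_nz; lra).
  repeat split; auto; apply sn_nz.
Qed.
(** * Sign analysis of the continued fraction *)

Local Opaque hyp01 hyp01_k cfrac cfrac_x cfrac_nu.

Lemma Re_divR z x : x <> 0 -> Re (z / RtoC x)%C = Re z / x.
Proof. intro H. destruct z; simpl. field. exact H. Qed.

Lemma Im_divR z x : x <> 0 -> Im (z / RtoC x)%C = Im z / x.
Proof. intro H. destruct z; simpl. field. exact H. Qed.

(** The equation x f' = g is singular at x = 0; differentiability is required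
    there too, because initial signs are read off at that point. *)
Definition flow (f g : R -> C) : Prop :=
  (forall x, 0 <= x -> exists l, Cderiv f x l) /\
  (forall x, 0 < x -> Cderiv f x (g x / RtoC x)%C).

Lemma flow_cont f g x : flow f g -> 0 <= x ->
  continuous (fun t => Re (f t)) x /\ continuous (fun t => Im (f t)) x.
Proof.
  intros [H _] Hx. destruct (H x Hx) as [l [H1 H2]].
  split; eapply is_derive_continuous; eassumption.
Qed.

Lemma cross_Im f g X : flow f g -> 0 < Im (f 0) ->
  (forall x, 0 < x <= X -> Im (f x) = 0 -> 0 < Im (g x)) ->
  forall x, 0 <= x <= X -> 0 < Im (f x).
Proof.
  intros Hf H0 Hc. apply (stays_positive (fun t => Im (f t))); [| |exact H0].
  - intros x Hx. apply (flow_cont f g); [exact Hf|lra].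
  - intros x Hx Hz. exists (Im (g x / RtoC x)%C). split; [apply Hf; lra|].
    rewrite Im_divR by lra. apply Rdiv_lt_0_compat; [now apply Hc|lra].
Qed.

Lemma cross_Re f g X : flow f g -> 0 < Re (f 0) ->
  (forall x, 0 < x <= X -> Re (f x) = 0 -> 0 < Re (g x)) ->
  forall x, 0 <= x <= X -> 0 < Re (f x).
Proof.
  intros Hf H0 Hc. apply (stays_positive (fun t => Re (f t))); [| |exact H0].
  - intros x Hx. apply (flow_cont f g); [exact Hf|lra].
  - intros x Hx Hz. exists (Re (g x / RtoC x)%C). split; [apply Hf; lra|].
    rewrite Re_divR by lra. apply Rdiv_lt_0_compat; [now apply Hc|lra].
Qed.

Definition nsq (z : C) : R := Re z * Re z + Im z * Im z.

Lemma nsq_Cmod z : nsq z = Cmod z * Cmod z.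
Proof. unfold nsq. generalize (Cmod2_alt z). simpl. lra. Qed.

Lemma nsq_deriv f x l : Cderiv f x l ->
  is_derive (fun t => nsq (f t)) x (2 * (Re (f x) * Re l + Im (f x) * Im l)).
Proof.
  intros [H1 H2]. unfold nsq.
  eapply is_derive_eq; [apply is_derive_Rplus; apply is_derive_Rmult; eassumption|]. cbv beta. ring.
Qed.

(** On the circle |f| = 1/m the radial derivative is
    Re f - Re G |f|^2 <= |f| (1 - Re G / m) < 0, so the disk is invariant. *)
Lemma decay_bound f G m : flow f (fun x => 1 - G x * f x)%C -> 0 < m ->
  (forall x, 0 < x -> m < Re (G x)) -> Cmod (f 0) < / m ->
  forall x, 0 <= x -> Cmod (f x) < / m.
Proof.
  intros Hf Hm HG H0 x Hx.
  assert (Him : 0 < / m) by now apply Rinv_0_lt_compat.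
  assert (H : 0 < / m * / m - nsq (f x)).
  { apply (stays_positive (fun t => / m * / m - nsq (f t)) x); [| | |lra].
    - intros t Ht. destruct (proj1 Hf t) as [l Hl]; [lra|].
      eapply is_derive_continuous. apply is_derive_Rminus; [apply @is_derive_const|].
      apply nsq_deriv, Hl.
    - intros t Ht Hz. eexists. split.
      + apply is_derive_Rminus; [apply @is_derive_const|]. apply nsq_deriv, Hf; lra.
      + unfold zero; simpl. change (0 < 0 - 2 * (Re (f t) * Re ((1 - G t * f t) / RtoC t)%C + Im (f t) * Im ((1 - G t * f t) / RtoC t)%C)).
        rewrite Re_divR, Im_divR by lra.
        assert (Hmod : Cmod (f t) = / m).
        { apply Rsqr_inj; [apply Cmod_ge_0|lra|]. unfold Rsqr. rewrite <- nsq_Cmod. lra. }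
        assert (Hr := Rle_trans _ _ _ (Rle_abs _) (Re_le_Cmod (f t))). rewrite Hmod in Hr.
        specialize (HG t ltac:(lra)).
        assert (Hn : nsq (f t) = / m * / m) by lra.
        replace (0 - 2 * (Re (f t) * (Re (1 - G t * f t)%C / t) + Im (f t) * (Im (1 - G t * f t)%C / t)))
          with (2 * (Re (G t) * nsq (f t) - Re (f t)) / t).
        2:{ unfold nsq. destruct (f t), (G t); simpl. field. lra. }
        apply Rdiv_lt_0_compat; [|lra]. rewrite Hn.
        assert (m * (/ m * / m) = / m) by (field; lra).
        assert (0 < / m * / m) by nra. nra.
    - rewrite nsq_Cmod. generalize (Cmod_ge_0 (f 0)); nra. }
  rewrite nsq_Cmod in H. generalize (Cmod_ge_0 (f x)); nra.
Qed.

(** By [decay_bound], |Im G Im f| < 1, so Re(1 - G f) > 0 when Re f = 0 and f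
    cannot leave the right half-plane.  On the positive axis
    Im(1 - G f) = - Im G Re f > 0, so it cannot leave the quadrant either. *)
Lemma sector_base f G m : flow f (fun x => 1 - G x * f x)%C -> 0 < m ->
  (forall x, 0 < x -> m < Re (G x) /\ - m < Im (G x) < 0) -> Cmod (f 0) < / m ->
  0 < Re (f 0) -> 0 < Im (f 0) ->
  forall x, 0 <= x -> 0 < Re (f x) /\ 0 < Im (f x).
Proof.
  intros Hf Hm HG H0 Hr Hi.
  assert (Hb := decay_bound f G m Hf Hm (fun x Hx => proj1 (HG x Hx)) H0).
  assert (HR : forall x, 0 <= x -> 0 < Re (f x)).
  { intros x Hx. apply (cross_Re f _ x Hf Hr); [|lra].
    intros t Ht Hz. specialize (HG t ltac:(lra)).
    assert (Hbt := Hb t ltac:(lra)).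
    assert (Hbi := Rle_lt_trans _ _ _ (Im_le_Cmod (f t)) Hbt).
    replace (Re (1 - G t * f t)%C) with (1 - Re (G t) * Re (f t) + Im (G t) * Im (f t))
      by (destruct (f t), (G t); simpl; ring).
    rewrite Hz. apply Rabs_def2 in Hbi.
    assert (m * / m = 1) by (field; lra). assert (0 < / m) by now apply Rinv_0_lt_compat. nra. }
  intros x Hx. split; [now apply HR|].
  apply (cross_Im f _ x Hf Hi); [|lra].
  intros t Ht Hz. specialize (HG t ltac:(lra)). specialize (HR t ltac:(lra)).
  replace (Im (1 - G t * f t)%C) with (- Re (G t) * Im (f t) - Im (G t) * Re (f t))
    by (destruct (f t), (G t); simpl; ring).
  rewrite Hz. nra.
Qed.

(** The same conclusion without any size restriction on G.  On the real axis
    the condition Im(f w) < 0, with w in the fourth quadrant, forces f > 0, and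
    there Im(1 - G f) = - Im G Re f > 0. *)
Lemma sector_step f G w : flow f (fun x => 1 - G x * f x)%C ->
  (forall x, 0 < x -> Im (G x) < 0) ->
  (forall x, 0 < x -> 0 < Re (w x) /\ Im (w x) < 0 /\ Im (f x * w x)%C < 0) ->
  0 < Im (f 0) ->
  forall x, 0 < x -> 0 < Re (f x) /\ 0 < Im (f x).
Proof.
  intros Hf HG Hw Hi.
  assert (HI : forall x, 0 < x -> 0 < Im (f x)).
  { intros x Hx. apply (cross_Im f _ x Hf Hi); [|lra].
    intros t Ht Hz. specialize (HG t ltac:(lra)). destruct (Hw t ltac:(lra)) as [W1 [W2 W3]].
    replace (Im (f t * w t)%C) with (Re (f t) * Im (w t) + Im (f t) * Re (w t)) in W3
      by (destruct (f t), (w t); simpl; ring).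
    replace (Im (1 - G t * f t)%C) with (- Re (G t) * Im (f t) - Im (G t) * Re (f t))
      by (destruct (f t), (G t); simpl; ring).
    rewrite Hz in *. nra. }
  intros x Hx. specialize (HI x Hx). split; [|exact HI].
  destruct (Hw x Hx) as [W1 [W2 W3]].
  replace (Im (f x * w x)%C) with (Re (f x) * Im (w x) + Im (f x) * Re (w x)) in W3
    by (destruct (f x), (w x); simpl; ring).
  nra.
Qed.

Lemma cfrac_0 n k : cfrac n 0 k = sn n k.
Proof. rewrite cfrac_rec by lra. field. apply cfrac_nz; lra. Qed.

Lemma cfrac_x_0 n k : cfrac_x n 0 k = (/ sn (S n) k)%C.
Proof.
  assert (H := cfrac_x_N1 n 0 k (Rle_refl 0)). rewrite !cfrac_0 in H.
  assert (Hz := sn_nz (S n) k).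
  replace (cfrac_x n 0 k) with ((cfrac_x n 0 k * sn (S n) k) / sn (S n) k)%C by (field; exact Hz).
  rewrite H, sn_S. rewrite sn_S in Hz. field. exact Hz.
Qed.

Lemma cfrac_nu_0 n k : cfrac_nu n 0 k = RtoC 1.
Proof. rewrite cfrac_nu_rec by lra. field. apply cfrac_nz; lra. Qed.

(** The derivative in nu of log [cfrac]; its real part is the derivative in k
    of the argument of the mean resultant. *)
Definition dlog_nu (n : nat) (x k : R) : C := (cfrac_nu n x k / cfrac n x k)%C.

Lemma cfrac_flow n k : flow (fun x => cfrac n x k)
  (fun x => RtoC x + sn n k * cfrac n x k - cfrac n x k * cfrac n x k)%C.
Proof.
  split.
  - intros x Hx; eexists; now apply cfrac_deriv_x.
  - intros x Hx. eapply Cderiv_eq; [apply cfrac_deriv_x; lra|].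
    rewrite <- cfrac_x_riccati by lra. field. apply RtoC_nz; lra.
Qed.

Lemma cfrac_x_flow n k : flow (fun x => cfrac_x n x k)
  (fun x => 1 - (2 * cfrac n x k - sn n k + 1) * cfrac_x n x k)%C.
Proof.
  split.
  - intros x Hx; eexists; now apply cfrac_x_deriv.
  - intros x Hx. eapply Cderiv_eq; [apply cfrac_x_deriv; lra|].
    assert (Hz := cfrac_nz (S n) x k ltac:(lra)). assert (Hx0 := RtoC_nz x ltac:(lra)).
    assert (H1 := cfrac_x_N1 n x k ltac:(lra)). assert (H2 := cfrac_x_riccati (S n) x k ltac:(lra)).
    assert (H3 := cfrac_rec n x k ltac:(lra)).
    assert (HT1 : cfrac_x (S n) x k = ((RtoC x + sn (S n) k * cfrac (S n) x k - cfrac (S n) x k * cfrac (S n) x k) / RtoC x)%C).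
    { rewrite <- H2. field. exact Hx0. }
    assert (HT0 : cfrac_x n x k = ((cfrac (S n) x k - cfrac n x k) / cfrac (S n) x k)%C).
    { rewrite <- H1. field. exact Hz. }
    rewrite HT1, HT0, H3, sn_S. field. split; assumption.
Qed.

Lemma cfrac_nu_flow n k : flow (fun x => cfrac_nu n x k)
  (fun x => cfrac n x k + (sn n k - 2 * cfrac n x k) * cfrac_nu n x k)%C.
Proof.
  split.
  - intros x Hx; eexists; now apply cfrac_nu_deriv.
  - intros x Hx. eapply Cderiv_eq; [apply cfrac_nu_deriv; lra|].
    assert (Hz := cfrac_nz (S n) x k ltac:(lra)). assert (Hx0 := RtoC_nz x ltac:(lra)).
    assert (H2 := cfrac_nu_rec n x k ltac:(lra)).
    assert (H3 := cfrac_rec n x k ltac:(lra)).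
    assert (HD1 : cfrac_nu (S n) x k = ((1 - cfrac_nu n x k) * (cfrac (S n) x k * cfrac (S n) x k) / RtoC x)%C).
    { rewrite H2. field. split; assumption. }
    rewrite HD1, H3. field. split; assumption.
Qed.

Lemma dlog_nu_flow n k : flow (fun x => dlog_nu n x k)
  (fun x => 1 - (cfrac n x k + RtoC x / cfrac n x k) * dlog_nu n x k)%C.
Proof.
  split.
  - intros x Hx. destruct (proj1 (cfrac_nu_flow n k) x Hx) as [l Hl].
    eexists. apply Cderiv_div; [exact Hl|now apply cfrac_deriv_x|now apply cfrac_nz].
  - intros x Hx. assert (Hz := cfrac_nz n x k ltac:(lra)). assert (Hx0 := RtoC_nz x ltac:(lra)).
    eapply Cderiv_eq; [apply Cderiv_div; [apply cfrac_nu_flow; lra|apply cfrac_flow; lra|exact Hz]|].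
    cbv beta. unfold dlog_nu. field. split; assumption.
Qed.

Lemma cfrac_Re n x k : 0 <= x ->
  exists p, 0 < p /\ Re (cfrac n x k) = INR n + 1 + x * p.
Proof.
  intro Hx. exists (Re (/ cfrac (S n) x k)%C).
  assert (Hz := cfrac_nz (S n) x k Hx). split.
  - rewrite Re_inv by exact Hz. apply Rdiv_lt_0_compat; [now apply cfrac_basic|now apply norm2_pos].
  - rewrite cfrac_rec, <- re_scal_l by exact Hx. reflexivity.
Qed.

Lemma cfrac_Re_ge n x k : 0 <= x -> INR n + 1 <= Re (cfrac n x k).
Proof. intro Hx. destruct (cfrac_Re n x k Hx) as [p [Hp ->]]. nra. Qed.

Lemma cfrac_Re_gt n x k : 0 < x -> INR n + 1 < Re (cfrac n x k).
Proof. intro Hx. destruct (cfrac_Re n x k ltac:(lra)) as [p [Hp ->]]. nra. Qed.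

Lemma Im_mult z w : Im (z * w)%C = Re z * Im w + Im z * Re w.
Proof. destruct z, w; simpl; ring. Qed.

Lemma Re_mult z w : Re (z * w)%C = Re z * Re w - Im z * Im w.
Proof. destruct z, w; simpl; ring. Qed.

Lemma nsq_pos z : z <> RtoC 0 -> 0 < nsq z.
Proof. apply norm2_pos. Qed.

Lemma Im_div z w : w <> RtoC 0 -> Im (z / w)%C = (Im z * Re w - Re z * Im w) / nsq w.
Proof.
  intro H. assert (Hn := norm2_pos _ H). unfold Cdiv. rewrite Im_mult, Re_inv, Im_inv by exact H.
  unfold nsq. field. lra.
Qed.

Lemma Re_div z w : w <> RtoC 0 -> Re (z / w)%C = (Re z * Re w + Im z * Im w) / nsq w.
Proof.
  intro H. assert (Hn := norm2_pos _ H). unfold Cdiv. rewrite Re_mult, Re_inv, Im_inv by exact H.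
  unfold nsq. field. lra.
Qed.

Lemma Im_div_quadrants z w : 0 < Re z -> 0 < Im z -> 0 < Re w -> Im w < 0 -> 0 < Im (z / w)%C.
Proof.
  intros. assert (w <> RtoC 0) by (intros ->; simpl in *; lra).
  rewrite Im_div by assumption. apply Rdiv_lt_0_compat; [nra|now apply nsq_pos].
Qed.

Lemma Cmod_near_1 z r : Cmod (z - 1)%C <= r -> 1 - r <= Re z <= 1 + r /\ - r <= Im z <= r.
Proof.
  intro H. assert (H1 := Re_le_Cmod (z - 1)%C). assert (H2 := Im_le_Cmod (z - 1)%C).
  assert (H3 : Rabs (Re (z - 1)%C) <= r) by lra. assert (H4 : Rabs (Im (z - 1)%C) <= r) by lra.
  apply Rabs_le_between in H3, H4. destruct z; simpl in *. lra.
Qed.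

(** Serves for statements about level n of the continued fraction: they follow
    from level n + 1, and hold for large n by crude estimates. *)
Lemma descent (P : nat -> Prop) :
  (exists n0, forall n, (n0 <= n)%nat -> P n) -> (forall n, P (S n) -> P n) -> forall n, P n.
Proof.
  intros [n0 H0] Hs.
  assert (H : forall m n, (n0 <= n + m)%nat -> P n).
  { induction m as [|m IH]; intros n Hn; [apply H0; lia|]. apply Hs, IH; lia. }
  intro n; apply (H n0); lia.
Qed.

(** When |N|^2 = x, the derivative of log(|N|^2 / x) in log x equals
    2 n + 1 > 0. *)
Lemma cfrac_nsq_gt n x k : 0 <= x -> x < nsq (cfrac n x k).
Proof.
  intro Hx. assert (H : 0 < nsq (cfrac n x k) - x); [|lra].
  assert (Hp := pos_INR n).
  apply (stays_positive (fun t => nsq (cfrac n t k) - t) x); [| | |lra].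
  - intros t Ht. eapply is_derive_continuous.
    apply is_derive_Rminus; [apply nsq_deriv, cfrac_deriv_x; lra|apply @is_derive_id].
  - intros t Ht Hz. eexists. split.
    + apply is_derive_Rminus; [apply nsq_deriv, cfrac_flow; lra|apply @is_derive_id].
    + cbv beta. change one with 1. rewrite Re_divR, Im_divR by lra.
      assert (Hn : nsq (cfrac n t k) = t) by lra. unfold nsq in Hn.
      destruct (cfrac n t k) as [a b]. simpl in *.
      match goal with |- 0 < 2 * (?a * (?u / t) + ?b * (?v / t)) - 1 =>
        replace (2 * (a * (u / t) + b * (v / t)) - 1) with ((2 * (a * u + b * v) - t) / t) by (field; lra) end.
      apply Rdiv_lt_0_compat; [|lra].
      match goal with |- 0 < ?e => replace e with
        (2 * t * a + (2 * (INR n + 1) - 2 * a) * (a * a + b * b) - t) by ring end.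
      rewrite Hn. nra.
    - rewrite cfrac_0. unfold nsq. simpl. nra.
Qed.

Section PositiveK.
Context (k : R) (Hk : 0 < k).

(** At Im N = - k/2 the Riccati equation gives
    x (- Im N)' = (n + 1) k / 2 > 0. *)
Lemma cfrac_Im_lt n x : 0 <= x -> Im (cfrac n x k) < - (k / 2).
Proof.
  intro Hx. assert (Hp := pos_INR n).
  assert (H : 0 < Im (- cfrac n x k - Ci * RtoC (k / 2))%C); [|unfold Im in *; simpl in H; lra].
  apply (cross_Im (fun x => - cfrac n x k - Ci * RtoC (k / 2))%C
    (fun x => - (RtoC x + sn n k * cfrac n x k - cfrac n x k * cfrac n x k))%C x); [| | |lra].
  - destruct (cfrac_flow n k) as [H1 H2]. split.
    + intros t Ht. destruct (H1 t Ht) as [l Hl]. eexists.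
      apply Cderiv_minus; [apply Cderiv_opp, Hl|apply Cderiv_const].
    + intros t Ht. eapply Cderiv_eq.
      * apply Cderiv_minus; [apply Cderiv_opp, H2, Ht|apply Cderiv_const].
      * cbv beta. field. apply RtoC_nz; lra.
  - rewrite cfrac_0. simpl. lra.
  - intros t Ht Hz. assert (Hr := cfrac_Re_ge n t k ltac:(lra)).
    destruct (cfrac n t k) as [a b]. simpl in *.
    assert (Hb : b = - (k / 2)) by lra. rewrite Hb in *.
    match goal with |- 0 < ?e => replace e with ((INR n + 1) * k / 2) by field end.
    assert (0 < (INR n + 1) * k) by nra. lra.
Qed.

Lemma cfrac_Im_gt n x : 0 < x -> - k < Im (cfrac n x k).
Proof.
  intro Hx. rewrite cfrac_rec by lra.
  replace (Im (sn n k + RtoC x / cfrac (S n) x k)%C) with (- k + x * Im (/ cfrac (S n) x k)%C)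
    by (rewrite <- im_scal_l; reflexivity).
  assert (Hz := cfrac_nz (S n) x k ltac:(lra)).
  rewrite Im_inv by exact Hz. assert (Hn := norm2_pos _ Hz).
  assert (Hi := cfrac_Im_lt (S n) x ltac:(lra)).
  assert (0 < x * (- Im (cfrac (S n) x k) / (Re (cfrac (S n) x k) * Re (cfrac (S n) x k) + Im (cfrac (S n) x k) * Im (cfrac (S n) x k)))).
  { apply Rmult_lt_0_compat; [exact Hx|]. apply Rdiv_lt_0_compat; lra. }
  lra.
Qed.

(** Im(N + x/N) = Im N (1 - x/|N|^2), which is negative by [cfrac_nsq_gt]. *)
Lemma dlog_nu_coeff_bounds n x : 0 < x ->
  INR n + 1 < Re (cfrac n x k + RtoC x / cfrac n x k)%C /\ - k < Im (cfrac n x k + RtoC x / cfrac n x k)%C < 0.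
Proof.
  intro Hx. assert (H1 := cfrac_Re_gt n x k Hx). assert (H2 := cfrac_Im_lt n x ltac:(lra)).
  assert (H3 := cfrac_Im_gt n x Hx). assert (H4 := cfrac_nsq_gt n x k ltac:(lra)).
  assert (Hz := cfrac_nz n x k ltac:(lra)). assert (Hp := pos_INR n).
  replace (Re (cfrac n x k + RtoC x / cfrac n x k)%C) with (Re (cfrac n x k) + x * Re (/ cfrac n x k)%C)
    by (rewrite <- re_scal_l; reflexivity).
  replace (Im (cfrac n x k + RtoC x / cfrac n x k)%C) with (Im (cfrac n x k) + x * Im (/ cfrac n x k)%C)
    by (rewrite <- im_scal_l; reflexivity).
  rewrite Re_inv, Im_inv by exact Hz. fold (nsq (cfrac n x k)).
  set (q := nsq (cfrac n x k)) in *. set (a := Re (cfrac n x k)) in *. set (b := Im (cfrac n x k)) in *.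
  assert (Hxq : 0 < x / q < 1).
  { split; [apply Rdiv_lt_0_compat; lra|]. apply Rmult_lt_reg_r with q; [lra|].
    unfold Rdiv. rewrite Rmult_assoc, Rinv_l; lra. }
  replace (x * (a / q)) with (x / q * a) by (field; lra).
  replace (x * (- b / q)) with (x / q * - b) by (field; lra).
  split; [nra|]. split; nra.
Qed.

Lemma cfrac_x_coeff_bounds n x : 0 < x ->
  INR n + 2 < Re (2 * cfrac n x k - sn n k + 1)%C /\ - k < Im (2 * cfrac n x k - sn n k + 1)%C < 0.
Proof.
  intro Hx. assert (H1 := cfrac_Re_gt n x k Hx). assert (H2 := cfrac_Im_lt n x ltac:(lra)).
  assert (H3 := cfrac_Im_gt n x Hx).
  destruct (cfrac n x k) as [a b]. simpl in *. lra.
Qed.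

Lemma inv_sn_quadrant n : 0 < Re (/ sn n k)%C /\ 0 < Im (/ sn n k)%C.
Proof.
  assert (Hz := sn_nz n k). rewrite Re_inv, Im_inv by exact Hz. assert (Hn := norm2_pos _ Hz).
  assert (Hp := pos_INR n).
  split; apply Rdiv_lt_0_compat; try lra; simpl; lra.
Qed.

Lemma inv_sn_mod n : Cmod (/ sn n k) < / (INR n + 1).
Proof.
  assert (Hp := pos_INR n). rewrite Cmod_inv by apply sn_nz.
  apply Rinv_lt_contravar.
  - apply Rmult_lt_0_compat; [lra|]. apply Cmod_gt_0, sn_nz.
  - apply Rsqr_incrst_0; [|lra|apply Cmod_ge_0]. unfold Rsqr. rewrite <- nsq_Cmod.
    unfold nsq; simpl. nra.
Qed.

Lemma dlog_nu_0 n : dlog_nu n 0 k = (/ sn n k)%C.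
Proof. unfold dlog_nu. rewrite cfrac_nu_0, cfrac_0. field. apply sn_nz. Qed.

Lemma dlog_nu_mod n x : 0 <= x -> Cmod (dlog_nu n x k) < / (INR n + 1).
Proof.
  assert (Hp := pos_INR n).
  apply (decay_bound (fun x => dlog_nu n x k) (fun x => cfrac n x k + RtoC x / cfrac n x k)%C); [apply dlog_nu_flow|lra| |].
  - intros t Ht. now apply dlog_nu_coeff_bounds.
  - rewrite dlog_nu_0. apply inv_sn_mod.
Qed.

Lemma cfrac_x_mod n x : 0 <= x -> Cmod (cfrac_x n x k) < / (INR n + 2).
Proof.
  assert (Hp := pos_INR n).
  apply (decay_bound (fun x => cfrac_x n x k) (fun x => 2 * cfrac n x k - sn n k + 1)%C); [apply cfrac_x_flow|lra| |].
  - intros t Ht. now apply cfrac_x_coeff_bounds.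
  - rewrite cfrac_x_0. replace (INR n + 2) with (INR (S n) + 1) by (rewrite S_INR; ring). apply inv_sn_mod.
Qed.

(** With E = D/N, the recurrence gives D_n = 1 - x E_(n+1) / N_(n+1).  If
    E_(n+1) is in the first quadrant then its quotient by N_(n+1) is in the
    upper half-plane; hence Im(E_n N_n) = Im D_n < 0 and [sector_step] applies.
    For n > k [sector_base] applies. *)
Lemma dlog_nu_quadrant n : forall x, 0 < x -> 0 < Re (dlog_nu n x k) /\ 0 < Im (dlog_nu n x k).
Proof.
  revert n. apply (descent (fun n => forall x, 0 < x ->
    0 < Re (dlog_nu n x k) /\ 0 < Im (dlog_nu n x k))).
  - destruct (large_INR k) as [n0 H0]. exists n0. intros n Hn x Hx.
    specialize (H0 n Hn). assert (Hp := pos_INR n).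
    apply (sector_base (fun x => dlog_nu n x k) (fun x => cfrac n x k + RtoC x / cfrac n x k)%C (INR n + 1));
      [apply dlog_nu_flow|lra| | | | |lra].
    + intros t Ht. destruct (dlog_nu_coeff_bounds n t Ht); lra.
    + rewrite dlog_nu_0. apply inv_sn_mod.
    + rewrite dlog_nu_0. apply inv_sn_quadrant.
    + rewrite dlog_nu_0. apply inv_sn_quadrant.
  - intros n IH.
    apply (sector_step (fun x => dlog_nu n x k) (fun x => cfrac n x k + RtoC x / cfrac n x k)%C (fun x => cfrac n x k)).
    + apply dlog_nu_flow.
    + intros t Ht. now apply dlog_nu_coeff_bounds.
    + intros t Ht. assert (H1 := cfrac_Re_gt n t k Ht). assert (H2 := cfrac_Im_lt n t ltac:(lra)).
      assert (Hp := pos_INR n). split; [lra|]. split; [lra|].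
      assert (Hz := cfrac_nz n t k ltac:(lra)). assert (Hz1 := cfrac_nz (S n) t k ltac:(lra)).
      replace (dlog_nu n t k * cfrac n t k)%C with (RtoC 1 - RtoC t * (dlog_nu (S n) t k / cfrac (S n) t k))%C.
      2:{ unfold dlog_nu at 2. rewrite (cfrac_nu_rec n t k) by lra. unfold dlog_nu. field. split; assumption. }
      destruct (IH t Ht) as [I1 I2].
      assert (J1 := cfrac_Re_gt (S n) t k Ht). assert (J2 := cfrac_Im_lt (S n) t ltac:(lra)).
      assert (Hp1 := pos_INR (S n)).
      assert (Q := Im_div_quadrants _ (cfrac (S n) t k) I1 I2 ltac:(lra) ltac:(lra)).
      replace (Im (1 - RtoC t * (dlog_nu (S n) t k / cfrac (S n) t k))%C) with (- (t * Im (dlog_nu (S n) t k / cfrac (S n) t k)%C))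
        by (rewrite <- im_scal_l; simpl; ring).
      nra.
    + rewrite dlog_nu_0. apply inv_sn_quadrant.
Qed.

(** As for [dlog_nu_quadrant], now with
    T_n N_(n+1) = 1 - x T_(n+1) / N_(n+1). *)
Lemma cfrac_x_quadrant n : forall x, 0 < x -> 0 < Re (cfrac_x n x k) /\ 0 < Im (cfrac_x n x k).
Proof.
  revert n. apply (descent (fun n => forall x, 0 < x ->
    0 < Re (cfrac_x n x k) /\ 0 < Im (cfrac_x n x k))).
  - destruct (large_INR k) as [n0 H0]. exists n0. intros n Hn x Hx.
    specialize (H0 n Hn). assert (Hp := pos_INR n).
    apply (sector_base (fun x => cfrac_x n x k) (fun x => 2 * cfrac n x k - sn n k + 1)%C (INR n + 2));
      [apply cfrac_x_flow|lra| | | | |lra].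
    + intros t Ht. destruct (cfrac_x_coeff_bounds n t Ht); lra.
    + rewrite cfrac_x_0. replace (INR n + 2) with (INR (S n) + 1) by (rewrite S_INR; ring). apply inv_sn_mod.
    + rewrite cfrac_x_0. apply inv_sn_quadrant.
    + rewrite cfrac_x_0. apply inv_sn_quadrant.
  - intros n IH.
    apply (sector_step (fun x => cfrac_x n x k) (fun x => 2 * cfrac n x k - sn n k + 1)%C (fun x => cfrac (S n) x k)).
    + apply cfrac_x_flow.
    + intros t Ht. now apply cfrac_x_coeff_bounds.
    + intros t Ht.
      assert (J1 := cfrac_Re_gt (S n) t k Ht). assert (J2 := cfrac_Im_lt (S n) t ltac:(lra)).
      assert (Hp1 := pos_INR (S n)). split; [lra|]. split; [lra|].
      rewrite cfrac_x_rec by lra.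
      destruct (IH t Ht) as [I1 I2].
      assert (Q := Im_div_quadrants _ (cfrac (S n) t k) I1 I2 ltac:(lra) ltac:(lra)).
      replace (Im (1 - RtoC t * cfrac_x (S n) t k / cfrac (S n) t k)%C) with (- (t * Im (cfrac_x (S n) t k / cfrac (S n) t k)%C))
        by (rewrite <- im_scal_l; unfold Cdiv; rewrite Cmult_assoc; simpl; ring).
      nra.
    + rewrite cfrac_x_0. apply inv_sn_quadrant.
Qed.

Lemma cfrac_x_nz n x : 0 <= x -> cfrac_x n x k <> RtoC 0.
Proof.
  intros [Hx|<-].
  - intro H. destruct (cfrac_x_quadrant n x Hx) as [h _]. rewrite H in h. simpl in h; lra.
  - rewrite cfrac_x_0. intro H. destruct (inv_sn_quadrant (S n)) as [h _]. rewrite H in h. simpl in h; lra.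
Qed.

(** The correction term in D/T = N + N_(n+1) T - x Phi, see [jacq_Phi].  It is
    singled out because it satisfies a linear equation again ([Phi_flow]), so
    that the sign of its imaginary part can be found by the same descent. *)
Definition Phi (n : nat) (x : R) : C :=
  ((dlog_nu (S n) x k - cfrac_x (S n) x k) / (cfrac (S n) x k * cfrac_x n x k))%C.
(** Its real part is positive exactly when Re(T conj D) is, which is the
    Jacobian of (x, k) |-> (Re N, - Im N). *)
Definition jacq (n : nat) (x : R) : C := (cfrac_nu n x k / cfrac_x n x k)%C.

Lemma jacq_Phi n x : 0 <= x ->
  (jacq n x - cfrac n x k)%C = (cfrac (S n) x k * cfrac_x n x k - RtoC x * Phi n x)%C.
Proof.
  intro Hx. assert (H1 := cfrac_x_nz n x Hx). assert (H2 := cfrac_nz (S n) x k Hx).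
  assert (H3 := cfrac_nu_rec n x k Hx). assert (H4 := cfrac_x_rec n x k Hx). assert (H5 := cfrac_x_N1 n x k Hx).
  unfold jacq, Phi, dlog_nu. rewrite H3.
  assert (HN : cfrac n x k = (cfrac (S n) x k - cfrac_x n x k * cfrac (S n) x k)%C) by (rewrite H5; ring).
  assert (HT : (RtoC x * cfrac_x (S n) x k)%C = ((1 - cfrac_x n x k * cfrac (S n) x k) * cfrac (S n) x k)%C).
  { rewrite H4. field. exact H2. }
  rewrite HN.
  transitivity ((1 - RtoC x * cfrac_nu (S n) x k / (cfrac (S n) x k * cfrac (S n) x k)) / cfrac_x n x k
     - cfrac (S n) x k + cfrac_x n x k * cfrac (S n) x k)%C; [ring|].
  transitivity (cfrac (S n) x k * cfrac_x n x k - (RtoC x * cfrac_nu (S n) x k / cfrac (S n) x k - RtoC x * cfrac_x (S n) x k) / (cfrac (S n) x k * cfrac_x n x k))%C;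
    [rewrite HT|]; field; split; assumption.
Qed.

Lemma jacq_flow n : flow (jacq n) (fun x => jacq n x + (cfrac n x k - jacq n x) / cfrac_x n x k)%C.
Proof.
  split.
  - intros x Hx. destruct (proj1 (cfrac_nu_flow n k) x Hx) as [l Hl], (proj1 (cfrac_x_flow n k) x Hx) as [l' Hl'].
    eexists. apply Cderiv_div; [exact Hl|exact Hl'|now apply cfrac_x_nz].
  - intros x Hx. assert (H1 := cfrac_x_nz n x ltac:(lra)). assert (Hx0 := RtoC_nz x ltac:(lra)).
    eapply Cderiv_eq; [apply Cderiv_div; [apply cfrac_nu_flow; lra|apply cfrac_x_flow; lra|exact H1]|].
    cbv beta. unfold jacq. field. split; assumption.
Qed.

Lemma Phi_flow n : flow (Phi n) (fun x => cfrac_x (S n) x k - Phi n x / cfrac_x n x k)%C.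
Proof.
  assert (HZ : forall x, 0 <= x -> (cfrac (S n) x k * cfrac_x n x k)%C <> RtoC 0).
  { intros x Hx. apply Cmult_neq_0; [now apply cfrac_nz|now apply cfrac_x_nz]. }
  split.
  - intros x Hx. destruct (proj1 (dlog_nu_flow (S n) k) x Hx) as [l Hl], (proj1 (cfrac_x_flow (S n) k) x Hx) as [l' Hl'].
    destruct (proj1 (cfrac_x_flow n k) x Hx) as [l0 Hl0].
    eexists. apply Cderiv_div; [apply Cderiv_minus; [exact Hl|exact Hl'] | | now apply HZ].
    apply Cderiv_mult; [now apply cfrac_deriv_x|exact Hl0].
  - intros x Hx. assert (H1 := cfrac_x_nz n x ltac:(lra)). assert (Hx0 := RtoC_nz x ltac:(lra)).
    assert (Hz := cfrac_nz (S n) x k ltac:(lra)).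
    eapply Cderiv_eq.
    + apply Cderiv_div; [apply Cderiv_minus; [apply dlog_nu_flow; lra|apply cfrac_x_flow; lra] | | apply HZ; lra].
      apply Cderiv_mult; [apply cfrac_flow; lra|apply cfrac_x_flow; lra].
    + cbv beta. unfold Phi.
      assert (H5 := cfrac_x_N1 n x k ltac:(lra)). assert (H6 := cfrac_rec n x k ltac:(lra)).
      assert (HT : cfrac_x n x k = ((cfrac (S n) x k - sn n k - RtoC x / cfrac (S n) x k) / cfrac (S n) x k)%C).
      { replace (cfrac (S n) x k - sn n k - RtoC x / cfrac (S n) x k)%C with (cfrac_x n x k * cfrac (S n) x k)%C
          by (rewrite H5, H6; ring). field. exact Hz. }
      assert (HN : cfrac n x k = (sn n k + RtoC x / cfrac (S n) x k)%C) by exact H6.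
      assert (Hnz : (cfrac (S n) x k * cfrac (S n) x k - sn n k * cfrac (S n) x k - RtoC x)%C <> RtoC 0).
      { intro E0. apply H1. rewrite HT.
        replace (cfrac (S n) x k - sn n k - RtoC x / cfrac (S n) x k)%C with
          ((cfrac (S n) x k * cfrac (S n) x k - sn n k * cfrac (S n) x k - RtoC x) / cfrac (S n) x k)%C by (field; exact Hz).
        rewrite E0. field. exact Hz. }
      assert (Hnz' : ((cfrac (S n) x k - sn n k) * cfrac (S n) x k - RtoC x)%C <> RtoC 0).
      { intro E0. apply Hnz. rewrite <- E0. ring. }
      rewrite HT, HN, sn_S. field. repeat split; auto.
Qed.

Lemma Phi_0 n : Phi n 0 = (/ (sn (S n) k * sn (S (S n)) k))%C.
Proof.
  unfold Phi. rewrite dlog_nu_0, !cfrac_x_0, cfrac_0.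
  assert (H1 := sn_nz (S n) k). assert (H2 := sn_nz (S (S n)) k).
  rewrite (sn_S (S n)) in *. field. split; assumption.
Qed.

Lemma Phi_0_Im n : 0 < Im (Phi n 0).
Proof.
  rewrite Phi_0.
  assert (Hz : (sn (S n) k * sn (S (S n)) k)%C <> RtoC 0) by (apply Cmult_neq_0; apply sn_nz).
  rewrite Im_inv by exact Hz. apply Rdiv_lt_0_compat; [|now apply norm2_pos].
  assert (H1 := pos_INR (S n)). assert (H2 := pos_INR (S (S n))).
  rewrite Im_mult. unfold sn, Re, Im; cbn [fst snd]. nra.
Qed.

(** N_(n+1) T_n = 1 - x T_(n+1)/N_(n+1) has negative imaginary part by the
    quadrants of T and N. *)
Lemma jacq_Im_lt n x : 0 < x -> 0 < Im (Phi n x) -> Im (jacq n x - cfrac n x k)%C < 0.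
Proof.
  intros Hx H. rewrite jacq_Phi by lra.
  rewrite Cmult_comm, cfrac_x_rec by lra.
  destruct (cfrac_x_quadrant (S n) x Hx) as [I1 I2].
  assert (J1 := cfrac_Re_gt (S n) x k Hx). assert (J2 := cfrac_Im_lt (S n) x ltac:(lra)).
  assert (Hp1 := pos_INR (S n)).
  assert (Q := Im_div_quadrants _ (cfrac (S n) x k) I1 I2 ltac:(lra) ltac:(lra)).
  replace (Im (1 - RtoC x * cfrac_x (S n) x k / cfrac (S n) x k - RtoC x * Phi n x)%C)
    with (- (x * Im (cfrac_x (S n) x k / cfrac (S n) x k)%C) - x * Im (Phi n x)).
  2:{ rewrite <- !im_scal_l. unfold Cdiv. rewrite Cmult_assoc. unfold Cminus.
      unfold Im; simpl. ring. }
  nra.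
Qed.

(** On the positive axis Im(T_(n+1) - Phi / T_n) > 0, since T_n and T_(n+1) are
    in the first quadrant; only the negative axis remains to be excluded. *)
Lemma Phi_cross n X :
  (forall x, 0 < x <= X -> Im (Phi n x) = 0 -> 0 < Re (Phi n x)) ->
  forall x, 0 < x <= X -> 0 < Im (Phi n x).
Proof.
  intros H x Hx. apply (cross_Im (Phi n) _ X (Phi_flow n)); [apply Phi_0_Im| |lra].
  intros t Ht Hz. specialize (H t Ht Hz).
  destruct (cfrac_x_quadrant n t ltac:(lra)) as [I1 I2].
  destruct (cfrac_x_quadrant (S n) t ltac:(lra)) as [I3 I4].
  assert (Hn := cfrac_x_nz n t ltac:(lra)).
  replace (Im (cfrac_x (S n) t k - Phi n t / cfrac_x n t k)%C)
    with (Im (cfrac_x (S n) t k) - Im (Phi n t / cfrac_x n t k)%C) by (unfold Im; simpl; ring).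
  rewrite Im_div, Hz by exact Hn.
  assert (Hq := nsq_pos _ Hn).
  assert (0 < Re (Phi n t) * Im (cfrac_x n t k) / nsq (cfrac_x n t k)).
  { apply Rdiv_lt_0_compat; [nra|exact Hq]. }
  replace ((0 * Re (cfrac_x n t k) - Re (Phi n t) * Im (cfrac_x n t k)) / nsq (cfrac_x n t k))
    with (- (Re (Phi n t) * Im (cfrac_x n t k) / nsq (cfrac_x n t k))) by (field; lra).
  lra.
Qed.

Lemma Phi_jacq n x : 0 <= x ->
  (Phi n x * (cfrac (S n) x k / cfrac_x (S n) x k - RtoC x))%C = (jacq (S n) x - cfrac (S n) x k)%C.
Proof.
  intro Hx. unfold Phi, jacq, dlog_nu.
  assert (H1 := cfrac_x_nz n x Hx). assert (H1' := cfrac_x_nz (S n) x Hx). assert (H2 := cfrac_nz (S n) x k Hx).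
  assert (H4 := cfrac_x_rec n x k Hx).
  replace (cfrac (S n) x k * cfrac_x n x k)%C with (1 - RtoC x * cfrac_x (S n) x k / cfrac (S n) x k)%C
    by (rewrite <- H4; ring).
  field. repeat split; auto.
  intro E0. assert (E1 : (cfrac_x n x k * cfrac (S n) x k)%C = RtoC 0).
  { rewrite H4. transitivity ((cfrac (S n) x k - RtoC x * cfrac_x (S n) x k) / cfrac (S n) x k)%C; [field; exact H2|].
    rewrite E0. field. exact H2. }
  revert E1. now apply Cmult_neq_0.
Qed.

(** Phi_n (N_(n+1)/T_(n+1) - x) = D_(n+1)/T_(n+1) - N_(n+1) has negative
    imaginary part by the level above, and so has N_(n+1)/T_(n+1).  Hence a
    real value of Phi_n is positive. *)
Lemma Phi_step n X :
  (forall x, 0 < x <= X -> 0 < Im (Phi (S n) x)) -> forall x, 0 < x <= X -> 0 < Im (Phi n x).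
Proof.
  intro H. apply Phi_cross. intros x Hx Hz.
  assert (HK := jacq_Im_lt (S n) x ltac:(lra) (H x Hx)).
  rewrite <- Phi_jacq in HK by lra.
  destruct (cfrac_x_quadrant (S n) x ltac:(lra)) as [I1 I2].
  assert (J1 := cfrac_Re_gt (S n) x k ltac:(lra)). assert (J2 := cfrac_Im_lt (S n) x ltac:(lra)).
  assert (Hp1 := pos_INR (S n)). assert (Hn := cfrac_x_nz (S n) x ltac:(lra)).
  rewrite Im_mult, Hz in HK.
  replace (Im (cfrac (S n) x k / cfrac_x (S n) x k - RtoC x)%C) with (Im (cfrac (S n) x k / cfrac_x (S n) x k)%C) in HK
    by (unfold Im; simpl; ring).
  rewrite Im_div in HK by exact Hn.
  assert (Hq := nsq_pos _ Hn).
  assert (HI : (Im (cfrac (S n) x k) * Re (cfrac_x (S n) x k) - Re (cfrac (S n) x k) * Im (cfrac_x (S n) x k)) / nsq (cfrac_x (S n) x k) < 0).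
  { apply Rmult_neg_pos; [nra|]. now apply Rinv_0_lt_compat. }
  nra.
Qed.

(** For x <= X and n large, T_n N_(n+1) and D_n/T_n - N_n are close to 1 and
    N_n N_(n+1) is close to n^2, so that Phi_n is close to 1/n^2 and a real
    value of it is positive. *)
Lemma Phi_base X : 0 < X -> exists n0, forall n, (n0 <= n)%nat ->
  forall x, 0 < x <= X -> 0 < Im (Phi n x).
Proof.
  intro HX. destruct (large_INR (k + 16 * X + 2)) as [n0 H0]. exists n0. intros n Hn.
  assert (HnX := H0 n Hn). apply Phi_cross. intros x Hx Hz.
  assert (HQ : forall m, (n <= m)%nat -> Cmod (RtoC x * cfrac_x m x k / cfrac m x k)%C <= / 8).
  { intros m Hm. assert (Hmi := H0 m ltac:(lia)).
    assert (Hz' := cfrac_nz m x k ltac:(lra)).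
    rewrite Cmod_div by exact Hz'. rewrite Cmod_mult, Cmod_R, Rabs_right by lra.
    assert (H1 := cfrac_x_mod m x ltac:(lra)). assert (H2 := cfrac_Re_gt m x k ltac:(lra)).
    assert (H3 : INR m + 1 <= Cmod (cfrac m x k)) by (apply Cmod_ge_Re; lra).
    assert (H4 : Cmod (cfrac_x m x k) <= 1).
    { left. eapply Rlt_trans; [exact H1|]. rewrite <- Rinv_1. apply Rinv_lt_contravar; lra. }
    assert (H5 := Cmod_ge_0 (cfrac_x m x k)).
    apply Rmult_le_reg_r with (Cmod (cfrac m x k)); [lra|].
    unfold Rdiv. rewrite Rmult_assoc, Rinv_l by lra.
    apply Rle_trans with (X * 1); [|lra]. rewrite Rmult_1_r.
    apply Rmult_le_compat; lra. }
  set (h := (1 - RtoC x * cfrac_x (S (S n)) x k / cfrac (S (S n)) x k)%C).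
  assert (Hh : Cmod (h - 1)%C <= / 8).
  { unfold h. replace (1 - RtoC x * cfrac_x (S (S n)) x k / cfrac (S (S n)) x k - 1)%C
      with (- (RtoC x * cfrac_x (S (S n)) x k / cfrac (S (S n)) x k))%C by (unfold Cdiv; ring).
    rewrite Cmod_opp. apply HQ; lia. }
  assert (HP : Cmod (RtoC x * Phi (S n) x)%C <= / 4).
  { assert (HnX1 := H0 (S n) ltac:(lia)).
    assert (E1 := Hh). unfold h in E1.
    rewrite <- (cfrac_x_rec (S n)) in E1 by lra.
    destruct (Cmod_near_1 _ _ E1) as [E2 _].
    assert (E3 := Cmod_ge_Re _ _ (proj1 E2)).
    rewrite Cmult_comm in E3.
    assert (E4 : (cfrac (S (S n)) x k * cfrac_x (S n) x k)%C <> RtoC 0).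
    { intro E0. rewrite E0, Cmod_0 in E3. lra. }
    unfold Phi. rewrite Cmod_mult, Cmod_div, Cmod_R, Rabs_right by (auto; lra).
    assert (E5 : Cmod (dlog_nu (S (S n)) x k - cfrac_x (S (S n)) x k)%C <= 2 * / (INR (S n) + 1)).
    { unfold Cminus. eapply Rle_trans; [apply Cmod_triangle|]. rewrite Cmod_opp.
      assert (B1 := dlog_nu_mod (S (S n)) x ltac:(lra)). assert (B2 := cfrac_x_mod (S (S n)) x ltac:(lra)).
      assert (/ (INR (S (S n)) + 1) <= / (INR (S n) + 1)) by (apply Rinv_le_contravar; rewrite ?(S_INR (S n)); lra).
      assert (/ (INR (S (S n)) + 2) <= / (INR (S n) + 1)) by (apply Rinv_le_contravar; rewrite ?(S_INR (S n)); lra).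
      lra. }
    assert (E6 := Cmod_ge_0 (dlog_nu (S (S n)) x k - cfrac_x (S (S n)) x k)%C).
    assert (E7 : X * / (INR (S n) + 1) <= / 16).
    { apply Rmult_le_reg_r with (INR (S n) + 1); [lra|]. rewrite Rmult_assoc, Rinv_l; lra. }
    apply Rmult_le_reg_r with (Cmod (cfrac (S (S n)) x k * cfrac_x (S n) x k)%C); [lra|].
    unfold Rdiv. rewrite <- Rmult_assoc, Rmult_assoc, Rinv_l by lra.
    assert (x * Cmod (dlog_nu (S (S n)) x k - cfrac_x (S (S n)) x k)%C <= X * (2 * / (INR (S n) + 1)))
      by (apply Rmult_le_compat; lra).
    nra. }
  assert (HC : (jacq (S n) x - cfrac (S n) x k)%C = (h - RtoC x * Phi (S n) x)%C).
  { rewrite jacq_Phi by lra. unfold h. rewrite <- (cfrac_x_rec (S n)) by lra. ring. }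
  assert (HC1 : Cmod (h - RtoC x * Phi (S n) x - 1)%C <= / 8 + / 4).
  { replace (h - RtoC x * Phi (S n) x - 1)%C with ((h - 1) + - (RtoC x * Phi (S n) x))%C by ring.
    eapply Rle_trans; [apply Cmod_triangle|]. rewrite Cmod_opp. lra. }
  assert (HT : cfrac_x (S n) x k = (h / cfrac (S (S n)) x k)%C).
  { unfold h. rewrite <- (cfrac_x_rec (S n)) by lra. field. apply cfrac_nz; lra. }
  assert (HTn := cfrac_x_nz (S n) x ltac:(lra)). assert (HNn := cfrac_nz (S (S n)) x k ltac:(lra)).
  assert (Main : (Phi n x * (cfrac (S n) x k * cfrac (S (S n)) x k - RtoC x * h))%C = (h * (h - RtoC x * Phi (S n) x))%C).
  { rewrite <- HC, <- Phi_jacq by lra.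
    assert (Hh0 : h <> RtoC 0).
    { intro E0. rewrite E0 in Hh. replace (RtoC 0 - 1)%C with (- (1))%C in Hh by ring.
      rewrite Cmod_opp, Cmod_1 in Hh. lra. }
    rewrite HT. field. split; assumption. }
  destruct (Cmod_near_1 _ _ Hh) as [h1 h2]. destruct (Cmod_near_1 _ _ HC1) as [c1 c2].
  apply (f_equal Re) in Main. rewrite !Re_mult, Hz in Main.
  assert (J1 := cfrac_Re_gt (S n) x k ltac:(lra)). assert (J2 := cfrac_Im_lt (S n) x ltac:(lra)).
  assert (J3 := cfrac_Im_gt (S n) x ltac:(lra)).
  assert (J4 := cfrac_Re_gt (S (S n)) x k ltac:(lra)). assert (J5 := cfrac_Im_lt (S (S n)) x ltac:(lra)).
  assert (J6 := cfrac_Im_gt (S (S n)) x ltac:(lra)).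
  rewrite !S_INR in *.
  replace (Re (cfrac (S n) x k * cfrac (S (S n)) x k - RtoC x * h)%C) with
    (Re (cfrac (S n) x k) * Re (cfrac (S (S n)) x k) - Im (cfrac (S n) x k) * Im (cfrac (S (S n)) x k) - x * Re h) in Main
    by (rewrite <- (re_scal_l x h), <- Re_mult; unfold Re; simpl; ring).
  set (a := Re (cfrac (S n) x k)) in *. set (a1 := Re (cfrac (S (S n)) x k)) in *.
  set (b := Im (cfrac (S n) x k)) in *. set (b1 := Im (cfrac (S (S n)) x k)) in *.
  assert (G1 : b * b1 <= k * k) by nra.
  assert (G2 : (k + 16 * X) * (k + 16 * X) <= a * a1) by (apply Rmult_le_compat; lra).
  assert (G3 : x * Re h <= 2 * X) by nra.
  assert (G4 : 0 < a * a1 - b * b1 - x * Re h) by nra.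
  set (g := Re (h - RtoC x * Phi (S n) x)%C) in *. set (g' := Im (h - RtoC x * Phi (S n) x)%C) in *.
  assert (G5 : 0 < Re h * g - Im h * g') by nra.
  nra.
Qed.

Lemma Phi_Im n x : 0 < x -> 0 < Im (Phi n x).
Proof.
  intro Hx. apply (descent (fun n => forall t, 0 < t <= x -> 0 < Im (Phi n t))); [| |lra].
  - now apply Phi_base.
  - intros m. apply Phi_step.
Qed.

(** If Re(D/T) = 0 then Im(N - D/T) > 0 by [jacq_Im_lt]; as Re N > 0 and 1/T is
    in the fourth quadrant, x (Re(D/T))' = Re((N - D/T)/T) > 0. *)
Lemma jacq_Re n x : 0 <= x -> 0 < Re (jacq n x).
Proof.
  intro Hx. apply (cross_Re (jacq n) _ x (jacq_flow n)); [| |lra].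
  - unfold jacq. rewrite cfrac_nu_0, cfrac_x_0. replace (1 / / sn (S n) k)%C with (sn (S n) k) by (field; apply sn_nz).
    unfold sn, Re; cbn [fst]. generalize (pos_INR (S n)); lra.
  - intros t Ht Hz.
    assert (HC := jacq_Im_lt n t ltac:(lra) (Phi_Im n t ltac:(lra))).
    destruct (cfrac_x_quadrant n t ltac:(lra)) as [I1 I2].
    assert (J1 := cfrac_Re_gt n t k ltac:(lra)). assert (J2 := cfrac_Im_lt n t ltac:(lra)).
    assert (Hp := pos_INR n). assert (Hn := cfrac_x_nz n t ltac:(lra)).
    replace (Re (jacq n t + (cfrac n t k - jacq n t) / cfrac_x n t k)%C)
      with (Re (jacq n t) + Re ((cfrac n t k - jacq n t) / cfrac_x n t k)%C) by reflexivity.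
    rewrite Hz, Re_div by exact Hn.
    replace (Re (cfrac n t k - jacq n t)%C) with (Re (cfrac n t k) - Re (jacq n t)) by reflexivity.
    assert (HI : 0 < Im (cfrac n t k - jacq n t)%C).
    { replace (Im (cfrac n t k - jacq n t)%C) with (- Im (jacq n t - cfrac n t k)%C) by (unfold Im; simpl; ring). lra. }
    rewrite Hz. rewrite Rplus_0_l. apply Rdiv_lt_0_compat; [nra|now apply nsq_pos].
Qed.
End PositiveK.
(** * The two monotonicity facts for all real k *)

Lemma sn_conj n k : sn n (- k) = Cconj (sn n k).
Proof. apply C_ext; reflexivity. Qed.

Lemma Cconj_RtoC r : Cconj (RtoC r) = RtoC r.
Proof. apply C_ext; simpl; ring. Qed.

Lemma coef_conj n p k : coef n p (- k) = Cconj (coef n p k).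
Proof.
  unfold coef. rewrite Cinv_conj by apply rising_nz. f_equal.
  induction p as [|p IH]; simpl; [now rewrite Cconj_RtoC|].
  rewrite IH, Cmult_conj, Cplus_conj, Cconj_RtoC, sn_conj. reflexivity.
Qed.

Lemma hyp01_conj n x k : hyp01 n x (- k) = Cconj (hyp01 n x k).
Proof.
  Local Transparent hyp01. unfold hyp01, cgen, gen, Cconj. cbn [fst snd]. f_equal.
  - apply PSeries_ext; intro p. now rewrite coef_conj.
  - rewrite <- PSeries_opp. apply PSeries_ext; intro p. rewrite coef_conj.
    unfold PS_opp, opp; simpl. unfold Rdiv; ring.
Qed.
Local Opaque hyp01.

Lemma cfrac_conj n x k : 0 <= x -> cfrac n x (- k) = Cconj (cfrac n x k).
Proof.
  intro Hx. Local Transparent cfrac. unfold cfrac.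
  now rewrite !hyp01_conj, Cdiv_conj, Cmult_conj, sn_conj by now apply hyp01_nz.
Qed.
Local Opaque cfrac.

Lemma cfrac_x_conj n x k : 0 <= x -> cfrac_x n x (- k) = Cconj (cfrac_x n x k).
Proof.
  intro Hx. Local Transparent cfrac_x. unfold cfrac_x.
  rewrite !cfrac_conj, Cminus_conj, Cdiv_conj, Cconj_RtoC by (try apply cfrac_nz; assumption). reflexivity.
Qed.
Local Opaque cfrac_x.

Lemma cfrac_nu_conj n x k : 0 <= x -> cfrac_nu n x (- k) = Cconj (cfrac_nu n x k).
Proof.
  intro Hx.
  assert (H : (- Ci * cfrac_nu n x (- k))%C = Cconj (- (- Ci * cfrac_nu n x k))%C).
  { apply (Cderiv_unique (fun t => cfrac n x t) (- k)); [now apply cfrac_deriv_k|].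
    apply (Cderiv_ext (fun t => Cconj (cfrac n x (- t)))).
    - intro t. rewrite cfrac_conj by exact Hx. now rewrite Cconj_conj.
    - assert (Hd := cfrac_deriv_k n x k Hx). rewrite <- (Ropp_involutive k) in Hd at 1.
      destruct Hd as [H1 H2].
      assert (Hn : is_derive (fun t : R => - t) (- k) (-1)).
      { eapply is_derive_eq; [apply is_derive_Ropp, @is_derive_id|]. reflexivity. }
      split.
      + eapply is_derive_eq; [exact (is_derive_comp (fun t => Re (cfrac n x t)) Ropp _ _ _ H1 Hn)|].
        unfold scal; simpl; unfold mult; simpl. ring.
      + unfold Cconj; cbn [fst snd].
        eapply is_derive_eq; [apply is_derive_Ropp; exact (is_derive_comp (fun t => Im (cfrac n x t)) Ropp _ _ _ H2 Hn)|].
        unfold scal; simpl; unfold mult; simpl. ring. }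
  destruct (cfrac_nu n x (- k)) as [a b], (cfrac_nu n x k) as [c d].
  assert (H1 := f_equal Re H). assert (H2 := f_equal Im H). simpl in H1, H2.
  apply C_ext; simpl; lra.
Qed.

Lemma real_of_conj z : z = Cconj z -> Im z = 0.
Proof. intro H. apply (f_equal Im) in H. destruct z; simpl in *. lra. Qed.

(** For k = 0 everything is real, and at a zero of T or D the differential
    equation has the right-hand side 1 or N. *)
Lemma real_order_positive x : 0 < x -> 0 < Re (cfrac_x 0 x 0) /\ 0 < Re (cfrac_nu 0 x 0) /\
  Im (cfrac_x 0 x 0) = 0 /\ Im (cfrac_nu 0 x 0) = 0 /\ Im (cfrac 0 x 0) = 0.
Proof.
  intro Hx.
  assert (HT : forall t, 0 <= t -> Im (cfrac_x 0 t 0) = 0).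
  { intros t Ht. apply real_of_conj. rewrite <- cfrac_x_conj, Ropp_0 by exact Ht. reflexivity. }
  assert (HD : forall t, 0 <= t -> Im (cfrac_nu 0 t 0) = 0).
  { intros t Ht. apply real_of_conj. rewrite <- cfrac_nu_conj, Ropp_0 by exact Ht. reflexivity. }
  assert (HN : forall t, 0 <= t -> Im (cfrac 0 t 0) = 0).
  { intros t Ht. apply real_of_conj. rewrite <- cfrac_conj, Ropp_0 by exact Ht. reflexivity. }
  split; [|split; [|split; [apply HT; lra | split; [apply HD; lra | apply HN; lra]]]].
  - apply (cross_Re (fun x => cfrac_x 0 x 0) _ x (cfrac_x_flow 0 0)); [| |lra].
    + rewrite cfrac_x_0. rewrite Re_inv by apply sn_nz. simpl.
      apply Rdiv_lt_0_compat; lra.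
    + intros t Ht Hz. assert (Ez : cfrac_x 0 t 0 = RtoC 0) by (apply C_ext; [exact Hz|apply HT; lra]).
      rewrite Ez, Cmult_0_r. simpl. lra.
  - apply (cross_Re (fun x => cfrac_nu 0 x 0) _ x (cfrac_nu_flow 0 0)); [| |lra].
    + rewrite cfrac_nu_0. simpl; lra.
    + intros t Ht Hz. assert (Ez : cfrac_nu 0 t 0 = RtoC 0) by (apply C_ext; [exact Hz|apply HD; lra]).
      rewrite Ez, Cmult_0_r, Cplus_0_r.
      generalize (cfrac_Re_ge 0 t 0 ltac:(lra)). simpl. lra.
Qed.

Lemma angle_increasing_pos k x : 0 < k -> 0 < x ->
  0 < Re (cfrac_nu 0 x k) * Re (cfrac 0 x k) + Im (cfrac_nu 0 x k) * Im (cfrac 0 x k).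
Proof.
  intros Hk Hx. destruct (dlog_nu_quadrant k Hk 0 x Hx) as [H _]. unfold dlog_nu in H.
  assert (Hz := cfrac_nz 0 x k ltac:(lra)). assert (Hn := nsq_pos _ Hz).
  rewrite Re_div in H by exact Hz.
  set (u := Re (cfrac_nu 0 x k) * Re (cfrac 0 x k) + Im (cfrac_nu 0 x k) * Im (cfrac 0 x k)) in *.
  replace u with (u / nsq (cfrac 0 x k) * nsq (cfrac 0 x k)) by (field; lra). nra.
Qed.

Lemma jacobian_pos k x : 0 < k -> 0 < x ->
  0 < Re (cfrac_x 0 x k) * Re (cfrac_nu 0 x k) + Im (cfrac_x 0 x k) * Im (cfrac_nu 0 x k).
Proof.
  intros Hk Hx. assert (H := jacq_Re k Hk 0 x ltac:(lra)). unfold jacq in H.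
  assert (Hz := cfrac_x_nz k Hk 0 x ltac:(lra)). assert (Hn := nsq_pos _ Hz).
  rewrite Re_div in H by exact Hz.
  set (u := Re (cfrac_nu 0 x k) * Re (cfrac_x 0 x k) + Im (cfrac_nu 0 x k) * Im (cfrac_x 0 x k)) in *.
  replace (Re (cfrac_x 0 x k) * Re (cfrac_nu 0 x k) + Im (cfrac_x 0 x k) * Im (cfrac_nu 0 x k)) with u by (unfold u; ring).
  replace u with (u / nsq (cfrac_x 0 x k) * nsq (cfrac_x 0 x k)) by (field; lra). nra.
Qed.

(** For k > 0 this is Re(D/N) > 0; conjugation k |-> - k covers k < 0. *)
Lemma angle_increasing k x : 0 < x ->
  0 < Re (cfrac_nu 0 x k) * Re (cfrac 0 x k) + Im (cfrac_nu 0 x k) * Im (cfrac 0 x k).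
Proof.
  intro Hx. destruct (Rtotal_order k 0) as [H|[->|H]].
  - assert (Hp := angle_increasing_pos (- k) x ltac:(lra) Hx).
    rewrite cfrac_nu_conj, cfrac_conj in Hp by lra. simpl in Hp. unfold Re, Im. lra.
  - destruct (real_order_positive x Hx) as [_ [H1 [_ [H2 H3]]]]. rewrite H2, H3.
    generalize (cfrac_Re_ge 0 x 0 ltac:(lra)). simpl INR. nra.
  - now apply angle_increasing_pos.
Qed.

Lemma jacobian k x : 0 < x ->
  0 < Re (cfrac_x 0 x k) * Re (cfrac_nu 0 x k) + Im (cfrac_x 0 x k) * Im (cfrac_nu 0 x k).
Proof.
  intro Hx. destruct (Rtotal_order k 0) as [H|[->|H]].
  - assert (Hp := jacobian_pos (- k) x ltac:(lra) Hx).
    rewrite cfrac_nu_conj, cfrac_x_conj in Hp by lra. simpl in Hp. unfold Re, Im. lra.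
  - destruct (real_order_positive x Hx) as [H0 [H1 [H4 [H2 H3]]]]. rewrite H2, H4. nra.
  - now apply jacobian_pos.
Qed.

(** N_0 - s_0 = x / N_1 and |N_1| >= 2. *)
Lemma cfrac_near_s x k : 0 <= x -> Cmod (cfrac 0 x k - sn 0 k)%C <= x / 2.
Proof.
  intro Hx. rewrite cfrac_rec by exact Hx.
  assert (Hz := cfrac_nz 1 x k Hx).
  replace (sn 0 k + RtoC x / cfrac 1 x k - sn 0 k)%C with (RtoC x / cfrac 1 x k)%C by (field; exact Hz).
  rewrite Cmod_div, Cmod_R, Rabs_right by (auto; lra).
  apply Rmult_le_compat_l; [exact Hx|]. apply Rinv_le_contravar; [lra|].
  apply Cmod_ge_Re. generalize (cfrac_Re_ge 1 x k Hx). simpl. lra.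
Qed.
(** * Calculus of functions of class C^n in the plane *)

Lemma class_C_cont n U f z : class_C n U f -> U z -> continuous f z.
Proof. destruct n; intros [H _]; apply H. Qed.

Lemma class_C_S n U : forall f, class_C (S n) U f -> class_C n U f.
Proof.
  induction n as [|n IH]; intros f [Hc [fx [fy [Hd [Hx Hy]]]]]; (split; [exact Hc|]); [exact I|].
  exists fx, fy; auto.
Qed.

Lemma class_C_sub n (U V : C -> Prop) : (forall z, V z -> U z) ->
  forall f, class_C n U f -> class_C n V f.
Proof.
  intro HUV. induction n as [|n IH]; intros f [Hc Hf]; (split; [auto|]); [exact I|].
  destruct Hf as [fx [fy [Hd [Hx Hy]]]]. exists fx, fy. split; [intros; now apply Hd, HUV | split; auto].
Qed.

Lemma open_line_x (U : C -> Prop) z : open U -> U z -> locally (Re z) (fun t => U (t, Im z)).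
Proof.
  intros HU Hz. destruct (HU z Hz) as [e He]. exists e. intros t Ht.
  apply He. split; [exact Ht|apply ball_center].
Qed.

Lemma open_line_y (U : C -> Prop) z : open U -> U z -> locally (Im z) (fun t => U (Re z, t)).
Proof.
  intros HU Hz. destruct (HU z Hz) as [e He]. exists e. intros t Ht.
  apply He. split; [apply ball_center|exact Ht].
Qed.

Lemma C_eta (z : C) : (Re z, Im z) = z.
Proof. now destruct z. Qed.

Lemma class_C_ext n (U : C -> Prop) f g : open U -> (forall z, U z -> f z = g z) ->
  class_C n U f -> class_C n U g.
Proof.
  intros HU Hfg Hf.
  assert (Hc : forall z, U z -> continuous g z).
  { intros z Hz. apply (continuous_ext_loc g f z); [|eapply class_C_cont; eassumption].
    destruct (HU z Hz) as [e He]. exists e. intros w Hw. apply Hfg, He, Hw. }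
  destruct n as [|n]; (split; [exact Hc|]); [exact I|].
  destruct Hf as [_ [fx [fy [Hd Hf]]]].
  exists fx, fy. split; [|exact Hf]. intros z Hz. destruct (Hd z Hz) as [H1 H2]. split.
  - apply (is_derive_ext_loc (fun x => f (x, Im z))); [|exact H1].
    generalize (open_line_x U z HU Hz). apply filter_imp. intros t Ht. now apply Hfg.
  - apply (is_derive_ext_loc (fun y => f (Re z, y))); [|exact H2].
    generalize (open_line_y U z HU Hz). apply filter_imp. intros t Ht. now apply Hfg.
Qed.

Lemma class_C_const n U c : class_C n U (fun _ => c).
Proof.
  revert c; induction n as [|n IH]; intro c; (split; [intros; apply continuous_const|]); [exact I|].
  exists (fun _ => 0), (fun _ => 0).
  split; [intros z _; split; [exact (is_derive_Rconst c (Re z)) | exact (is_derive_Rconst c (Im z))] | split; apply IH].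
Qed.

Lemma class_C_Re n U : class_C n U Re.
Proof.
  destruct n; (split; [intros [a b] _; apply continuous_fst|]); [exact I|].
  exists (fun _ => 1), (fun _ => 0). split; [intros z _; split | split; apply class_C_const].
  - exact (is_derive_Rid (Re z)).
  - exact (is_derive_Rconst (Re z) (Im z)).
Qed.

Lemma class_C_Im n U : class_C n U Im.
Proof.
  destruct n; (split; [intros [a b] _; apply continuous_snd|]); [exact I|].
  exists (fun _ => 0), (fun _ => 1). split; [intros z _; split | split; apply class_C_const].
  - exact (is_derive_Rconst (Im z) (Re z)).
  - exact (is_derive_Rid (Im z)).
Qed.

Lemma class_C_plus n U : forall f g, class_C n U f -> class_C n U g -> class_C n U (fun z => f z + g z).
Proof.
  induction n as [|n IH]; intros f g [Hc Hf] [Hc' Hg].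
  - split; [|exact I]. intros z Hz. apply @continuous_plus; auto.
  - split; [intros z Hz; apply @continuous_plus; auto|].
    destruct Hf as [fx [fy [Hd [Hfx Hfy]]]], Hg as [gx [gy [Hd' [Hgx Hgy]]]].
    exists (fun z => fx z + gx z), (fun z => fy z + gy z). split; [|split; auto].
    intros z Hz. destruct (Hd z Hz), (Hd' z Hz). split; now apply is_derive_Rplus.
Qed.

Lemma class_C_mult n U : forall f g, class_C n U f -> class_C n U g -> class_C n U (fun z => f z * g z).
Proof.
  induction n as [|n IH]; intros f g Hf Hg.
  - destruct Hf as [Hc _], Hg as [Hc' _]. split; [|exact I]. intros z Hz. apply (continuous_mult f g); auto.
  - assert (Hf0 := class_C_S _ _ _ Hf). assert (Hg0 := class_C_S _ _ _ Hg).
    split; [intros z Hz; apply (continuous_mult f g); eapply class_C_cont; eassumption|].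
    destruct Hf as [_ [fx [fy [Hd [Hfx Hfy]]]]], Hg as [_ [gx [gy [Hd' [Hgx Hgy]]]]].
    exists (fun z => fx z * g z + f z * gx z), (fun z => fy z * g z + f z * gy z).
    split; [|split; apply class_C_plus; apply IH; auto].
    intros z Hz. destruct (Hd z Hz) as [D1 D2], (Hd' z Hz) as [D3 D4].
    split; [unfold is_partial_x|unfold is_partial_y].
    + eapply is_derive_eq; [exact (is_derive_Rmult _ _ _ _ _ D1 D3)|]. cbv beta. now rewrite C_eta.
    + eapply is_derive_eq; [exact (is_derive_Rmult _ _ _ _ _ D2 D4)|]. cbv beta. now rewrite C_eta.
Qed.

Lemma class_C_opp n U f : class_C n U f -> class_C n U (fun z => - f z).
Proof.
  intro H. assert (H' := class_C_mult n U (fun _ => -1) f (class_C_const n U (-1)) H).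
  destruct n as [|n].
  - destruct H as [H _]. split; [|exact I]. intros z Hz. apply @continuous_opp; auto.
  - destruct H as [Hc [fx [fy [Hd _]]]], H' as [_ [gx [gy [Hd' Hg]]]].
    split; [intros z Hz; apply @continuous_opp; auto|]. exists gx, gy; split; [|exact Hg].
    intros z Hz. destruct (Hd' z Hz) as [D1 D2]. split.
    + eapply is_derive_Rext; [|exact D1]. intro t; simpl; ring.
    + eapply is_derive_Rext; [|exact D2]. intro t; simpl; ring.
Qed.

Lemma class_C_minus n U f g : class_C n U f -> class_C n U g -> class_C n U (fun z => f z - g z).
Proof. intros Hf Hg. apply (class_C_plus n U f); [exact Hf|now apply class_C_opp]. Qed.

Lemma continuous_comp_R (f : C -> R) (h : R -> R) z :
  continuous f z -> continuous h (f z) -> continuous (fun w => h (f w)) z.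
Proof. intros H1 H2. exact (continuous_comp f h z H1 H2). Qed.

Lemma class_C_inv n U : forall f, (forall z, U z -> f z <> 0) -> class_C n U f ->
  class_C n U (fun z => / f z).
Proof.
  induction n as [|n IH]; intros f Hnz Hf.
  - split; [|exact I]. intros z Hz. apply continuous_comp_R; [eapply class_C_cont; eassumption|].
    apply (continuous_Rinv (f z)); auto.
  - split.
    { intros z Hz. apply continuous_comp_R; [eapply class_C_cont; eassumption|].
      apply (continuous_Rinv (f z)); auto. }
    assert (Hi := IH f Hnz (class_C_S _ _ _ Hf)).
    destruct Hf as [_ [fx [fy [Hd [Hfx Hfy]]]]].
    exists (fun z => - (fx z * (/ f z * / f z))), (fun z => - (fy z * (/ f z * / f z))).
    split; [|split; apply class_C_opp; repeat apply class_C_mult; auto].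
    intros z Hz. destruct (Hd z Hz) as [D1 D2]. assert (Hz' := Hnz z Hz).
    split; [unfold is_partial_x|unfold is_partial_y].
    + eapply is_derive_eq; [apply (is_derive_inv _ _ _ D1); now rewrite C_eta|]. cbv beta. rewrite C_eta. field; auto.
    + eapply is_derive_eq; [apply (is_derive_inv _ _ _ D2); now rewrite C_eta|]. cbv beta. rewrite C_eta. field; auto.
Qed.

Lemma class_C_div n U f g : (forall z, U z -> g z <> 0) -> class_C n U f -> class_C n U g ->
  class_C n U (fun z => f z / g z).
Proof. intros. apply class_C_mult; [assumption|now apply class_C_inv]. Qed.

Lemma class_C_sqrt n U : forall f, (forall z, U z -> 0 < f z) -> class_C n U f ->
  class_C n U (fun z => sqrt (f z)).
Proof.
  induction n as [|n IH]; intros f Hnz Hf.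
  - split; [|exact I]. intros z Hz. apply continuous_comp_R; [eapply class_C_cont; eassumption|].
    apply continuous_sqrt.
  - split.
    { intros z Hz. apply continuous_comp_R; [eapply class_C_cont; eassumption|]. apply continuous_sqrt. }
    assert (Hi := IH f Hnz (class_C_S _ _ _ Hf)).
    destruct Hf as [_ [fx [fy [Hd [Hfx Hfy]]]]].
    assert (Hs : forall z, U z -> 2 * sqrt (f z) <> 0).
    { intros z Hz. generalize (sqrt_lt_R0 _ (Hnz z Hz)); lra. }
    assert (Hden : class_C n U (fun z => 2 * sqrt (f z)))
      by (apply (class_C_mult n U (fun _ => 2)); [apply class_C_const|exact Hi]).
    exists (fun z => fx z / (2 * sqrt (f z))), (fun z => fy z / (2 * sqrt (f z))).
    split; [|split; apply class_C_div; auto].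
    intros z Hz. destruct (Hd z Hz) as [D1 D2]. assert (Hz' := Hnz z Hz).
    split; [unfold is_partial_x|unfold is_partial_y].
    + eapply is_derive_eq; [apply (is_derive_sqrt _ _ _ D1); now rewrite C_eta|]. now rewrite C_eta.
    + eapply is_derive_eq; [apply (is_derive_sqrt _ _ _ D2); now rewrite C_eta|]. now rewrite C_eta.
Qed.

(** Continuous partial derivatives give total differentiability, which the
    chain rule needs. *)
Lemma class_C_differentiable (U : C -> Prop) f fx fy z : open U -> U z ->
  (forall w, U w -> is_partial_x f w (fx w) /\ is_partial_y f w (fy w)) ->
  continuous fx z ->
  differentiable_pt_lim (fun u v => f (u, v)) (Re z) (Im z) (fx z) (fy z).
Proof.
  intros HU Hz Hd Hc. apply filterdiff_differentiable_pt_lim.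
  assert (H := is_derive_filterdiff (fun u v => f (u, v)) (Re z) (Im z) (fun u v => fx (u, v)) (fy z)).
  eapply filterdiff_ext_lin.
  - apply H.
    + destruct (HU z Hz) as [e He]. exists e. intros [a b] Hw. simpl.
      apply (Hd (a, b)). apply He. exact Hw.
    + apply Hd, Hz.
    + destruct z as [a b]. simpl. apply (continuous_ext fx); [intros [? ?]; reflexivity|exact Hc].
  - intros [a b]. simpl. now rewrite C_eta.
Qed.

Lemma class_C_comp n (U V : C -> Prop) : open U -> forall f g h,
  (forall z, V z -> U (g z, h z)) ->
  class_C n U f -> class_C n V g -> class_C n V h -> class_C n V (fun z => f (g z, h z)).
Proof.
  intro HU.
  assert (Hcont : forall (f g h : C -> R) (z : C), continuous f (g z, h z) -> continuous g z -> continuous h z ->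
    continuous (fun z : C => f (g z, h z) : R) z).
  { intros f g h z H1 H2 H3.
    apply (continuous_comp_2 g h (fun u v => f (u, v)) z H2 H3).
    apply (continuous_ext f); [intros [? ?]; reflexivity|exact H1]. }
  induction n as [|n IH]; intros f g h HV Hf Hg Hh.
  - split; [|exact I]. intros z Hz. apply Hcont; [eapply class_C_cont; [exact Hf|auto] | eapply class_C_cont; eassumption..].
  - split.
    { intros z Hz. apply Hcont; [eapply class_C_cont; [exact Hf|auto] | eapply class_C_cont; eassumption..]. }
    assert (Hg0 := class_C_S _ _ _ Hg). assert (Hh0 := class_C_S _ _ _ Hh).
    destruct Hf as [_ [fx [fy [Hd [Hfx Hfy]]]]], Hg as [_ [gx [gy [Hdg [Hgx Hgy]]]]],
      Hh as [_ [hx [hy [Hdh [Hhx Hhy]]]]].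
    exists (fun z => fx (g z, h z) * gx z + fy (g z, h z) * hx z),
      (fun z => fx (g z, h z) * gy z + fy (g z, h z) * hy z).
    split.
    + intros z Hz.
      assert (D0 := class_C_differentiable U f fx fy (g z, h z) HU (HV z Hz) Hd
        (class_C_cont _ _ _ _ Hfx (HV z Hz))). simpl Re in D0; simpl Im in D0.
      destruct (Hdg z Hz) as [G1 G2], (Hdh z Hz) as [H1 H2]. split.
      * apply is_derive_Reals.
        apply (derivable_pt_lim_comp_2d (fun u v => f (u, v)) (fun t => g (t, Im z)) (fun t => h (t, Im z)));
          [rewrite C_eta; exact D0| now apply is_derive_Reals ..].
      * apply is_derive_Reals.
        apply (derivable_pt_lim_comp_2d (fun u v => f (u, v)) (fun t => g (Re z, t)) (fun t => h (Re z, t)));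
          [rewrite C_eta; exact D0| now apply is_derive_Reals ..].
    + split; apply class_C_plus; apply class_C_mult; auto; apply IH; auto.
Qed.
(** * Inversion along fibres *)

Lemma continuous_C_pair (f g h : C -> R) (z : C) :
  continuous f (g z, h z) -> continuous g z -> continuous h z ->
  continuous (fun z : C => f (g z, h z) : R) z.
Proof.
  intros H1 H2 H3. apply (continuous_comp_2 g h (fun u v => f (u, v)) z H2 H3).
  apply (continuous_ext f); [intros [? ?]; reflexivity|exact H1].
Qed.

Lemma continuous_Re (z : C) : continuous (Re : C -> R) z.
Proof. apply (class_C_cont 0 (fun _ => True)); [apply class_C_Re|exact I]. Qed.

Lemma continuous_Im (z : C) : continuous (Im : C -> R) z.
Proof. apply (class_C_cont 0 (fun _ => True)); [apply class_C_Im|exact I]. Qed.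

Lemma locally_lt (f g : C -> R) (z : C) : continuous f z -> continuous g z -> f z < g z ->
  locally z (fun w => f w < g w).
Proof.
  intros Hf Hg H.
  assert (Hc : continuous (fun w => g w - f w) z).
  { apply (continuous_minus (U := C_UniformSpace) (V := R_NormedModule) g f); assumption. }
  assert (Hp : 0 < (g z - f z)) by lra.
  destruct (proj1 (filterlim_locally _ _) Hc (mkposreal _ Hp)) as [e He].
  exists e. intros w Hw. specialize (He w Hw).
  change (Rabs ((g w - f w) - (g z - f z)) < g z - f z) in He.
  apply Rabs_def2 in He. lra.
Qed.

Lemma locally_shift (U : C -> Prop) (z : C) c : open U -> U (Re z, c) ->
  locally z (fun w => U (Re w, c)).
Proof.
  intros HU Hz. destruct (HU _ Hz) as [e He]. exists e. intros w [Hw _].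
  apply He. split; [exact Hw|apply ball_center].
Qed.

Section FibreInverse.
Context (U V : C -> Prop) (f psi : C -> R).
Context (HU : open U) (HV : open V) (Hf : forall n, class_C n U f).
Context (Hconv : forall u v1 v2 v, U (u, v1) -> U (u, v2) -> v1 <= v <= v2 -> U (u, v)).
Context (Hpos : forall z, U z -> exists l, is_partial_y f z l /\ 0 < l).
Context (Hpsi : forall w, V w -> U (Re w, psi w) /\ f (Re w, psi w) = Im w).

Lemma fibre_increasing u v1 v2 : U (u, v1) -> U (u, v2) -> v1 < v2 -> f (u, v1) < f (u, v2).
Proof.
  intros H1 H2 H.
  assert (HUv : forall v, v1 <= v <= v2 -> U (u, v)) by (intros v Hv; exact (Hconv u v1 v2 v H1 H2 Hv)).
  assert (Hd : forall v, v1 <= v <= v2 -> is_derive (fun y => f (u, y)) v (Derive (fun y => f (u, y)) v)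
     /\ 0 < Derive (fun y => f (u, y)) v).
  { intros v Hv. destruct (Hpos _ (HUv v Hv)) as [l [Hl Hl0]].
    unfold is_partial_y in Hl; simpl in Hl.
    rewrite (is_derive_unique _ _ _ Hl). now split. }
  destruct (MVT_gen (fun y => f (u, y)) v1 v2 (Derive (fun y => f (u, y)))) as [c [Hc1 Hc2]].
  - intros x Hx. rewrite Rmin_left, Rmax_right in Hx by lra. apply Hd; lra.
  - intros x Hx. rewrite Rmin_left, Rmax_right in Hx by lra.
    apply continuity_pt_filterlim. eapply is_derive_continuous. apply Hd; lra.
  - rewrite Rmin_left, Rmax_right in Hc1 by lra. destruct (Hd c Hc1) as [_ H0].
    nra.
Qed.

(** By monotonicity along the fibre it is enough that f separates the values
    at psi w - d and psi w + d, and this persists for nearby fibres. *)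
Lemma fibre_inverse_near w eps : V w -> 0 < eps -> locally w (fun w' => Rabs (psi w' - psi w) < eps).
Proof.
  intros Hw He. destruct (Hpsi w Hw) as [H1 H2].
  destruct (HU _ H1) as [e Hb]. generalize (cond_pos e); intro Hep.
  set (d := Rmin eps (e / 2) / 2).
  assert (D0 := Rmin_l eps (e / 2)). assert (D1 := Rmin_r eps (e / 2)).
  assert (Hd : 0 < d) by (unfold d; assert (0 < Rmin eps (e / 2)) by (apply Rmin_glb_lt; lra); lra).
  assert (Hd' : d < eps /\ d < e) by (unfold d; lra).
  assert (B1 : U (Re w, psi w - d)).
  { apply Hb. split; [apply ball_center|]. change (Rabs (psi w - d - psi w) < e).
    rewrite Rabs_left; lra. }
  assert (B2 : U (Re w, psi w + d)).
  { apply Hb. split; [apply ball_center|]. change (Rabs (psi w + d - psi w) < e).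
    rewrite Rabs_right; lra. }
  assert (M1 := fibre_increasing _ _ _ B1 H1 ltac:(lra)).
  assert (M2 := fibre_increasing _ _ _ H1 B2 ltac:(lra)).
  rewrite H2 in M1, M2.
  assert (Hc : forall c, U (Re w, c) -> continuous (fun w' : C => f (Re w', c)) w).
  { intros c Hc. apply (continuous_C_pair f Re (fun _ => c)).
    - exact (class_C_cont 0 U f _ (Hf 0) Hc).
    - apply continuous_Re.
    - apply continuous_const. }
  assert (L1 := locally_lt _ _ w (Hc _ B1) (continuous_Im w) M1).
  assert (L2 := locally_lt _ _ w (continuous_Im w) (Hc _ B2) M2).
  assert (L3 := locally_shift U w _ HU B1). assert (L4 := locally_shift U w _ HU B2).
  generalize (filter_and _ _ (filter_and _ _ L1 L2) (filter_and _ _ (filter_and _ _ L3 L4) (HV w Hw))).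
  apply filter_imp. intros w' [[A1 A2] [[A3 A4] A5]].
  destruct (Hpsi w' A5) as [C1 C2].
  assert (psi w - d < psi w').
  { destruct (Rlt_le_dec (psi w - d) (psi w')) as [h|[h|h]]; [exact h| |].
    - generalize (fibre_increasing _ _ _ C1 A3 h); lra.
    - rewrite <- h in A1. lra. }
  assert (psi w' < psi w + d).
  { destruct (Rlt_le_dec (psi w') (psi w + d)) as [h|[h|h]]; [exact h| |].
    - generalize (fibre_increasing _ _ _ A4 C1 h); lra.
    - rewrite h in A2. lra. }
  apply Rabs_def1; lra.
Qed.

Lemma fibre_inverse_continuous w : V w -> continuous psi w.
Proof.
  intro Hw. apply filterlim_locally. intro eps.
  exact (fibre_inverse_near w eps Hw (cond_pos eps)).
Qed.

(** Implicit differentiation of f(u, psi(u, c)) = c.  The first-order expansion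
    of f bounds the increment of psi linearly in those of u and c; inserting
    that bound in the expansion again gives differentiability. *)
Lemma fibre_inverse_diff fx fy w :
  (forall z, U z -> is_partial_x f z (fx z) /\ is_partial_y f z (fy z)) ->
  continuous fx (Re w, psi w) -> V w ->
  is_partial_x psi w (- fx (Re w, psi w) / fy (Re w, psi w)) /\
  is_partial_y psi w (/ fy (Re w, psi w)).
Proof.
  intros Hd Hcx Hw. destruct (Hpsi w Hw) as [H1 H2].
  assert (D0 := class_C_differentiable U f fx fy _ HU H1 Hd Hcx).
  set (p := fx (Re w, psi w)) in *. set (q := fy (Re w, psi w)) in *.
  assert (Hq : 0 < q).
  { destruct (Hpos _ H1) as [l [Hl Hl0]]. destruct (Hd _ H1) as [_ Hy].
    unfold is_partial_y in *. fold q in Hy.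
    rewrite <- (is_derive_unique _ _ _ Hy). now rewrite (is_derive_unique _ _ _ Hl). }
  assert (DD : differentiable_pt_lim (fun u c => psi (u, c)) (Re w) (Im w) (- p / q) (/ q)).
  { intro eps. generalize (cond_pos eps); intro He.
    set (L := 2 * (1 + Rabs p + q) / q).
    assert (Hp := Rabs_pos p).
    assert (HL : 0 < L) by (unfold L; apply Rdiv_lt_0_compat; lra).
    set (e1 := Rmin (q / 2) (eps * q / (1 + L))).
    assert (He1 : 0 < e1).
    { unfold e1. apply Rmin_glb_lt; [lra|]. apply Rdiv_lt_0_compat; nra. }
    assert (He2 : e1 <= q / 2) by apply Rmin_l.
    assert (He3 : e1 * (1 + L) <= eps * q).
    { apply Rle_trans with (eps * q / (1 + L) * (1 + L)).
      - apply Rmult_le_compat_r; [lra|apply Rmin_r].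
      - right; field; lra. }
    destruct (D0 (mkposreal _ He1)) as [d Hd0]. generalize (cond_pos d); intro Hdp.
    simpl in Hd0.
    apply locally_2d_locally.
    generalize (filter_and _ _ (filter_and _ _ (fibre_inverse_near w d Hw Hdp) (HV w Hw)) (locally_ball w d)).
    rewrite <- (C_eta w) at 1. apply filter_imp.
    intros [u c] [[A1 A2] [A3 _]]. simpl fst; simpl snd.
    change (Rabs (u - Re w) < d) in A3.
    destruct (Hpsi _ A2) as [C1 C2]. simpl in C1, C2.
    specialize (Hd0 u (psi (u, c)) A3 A1). rewrite C2, H2 in Hd0. rewrite C_eta.
    change (fst w) with (Re w) in *. change (snd w) with (Im w) in *.
    set (h := u - Re w) in *. set (k := c - Im w) in *. set (dl := psi (u, c) - psi w) in *.
    set (m := Rmax (Rabs h) (Rabs k)).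
    assert (Mh : Rabs h <= m) by apply Rmax_l. assert (Mk : Rabs k <= m) by apply Rmax_r.
    assert (Hm : Rmax (Rabs h) (Rabs dl) <= m + Rabs dl).
    { apply Rmax_lub; generalize (Rabs_pos h), (Rabs_pos dl); lra. }
    assert (K1 : Rabs (k - (p * h + q * dl)) <= e1 * (m + Rabs dl)).
    { eapply Rle_trans; [exact Hd0|]. apply Rmult_le_compat_l; lra. }
    assert (K2 : q * Rabs dl <= (1 + Rabs p) * m + e1 * (m + Rabs dl)).
    { replace (q * Rabs dl) with (Rabs (q * dl)) by (rewrite Rabs_mult, (Rabs_right q); lra).
      replace (q * dl) with (k + - (p * h) + - (k - (p * h + q * dl))) by ring.
      eapply Rle_trans; [apply Rabs_triang|]. rewrite Rabs_Ropp.
      apply Rplus_le_compat; [|exact K1].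
      eapply Rle_trans; [apply Rabs_triang|]. rewrite Rabs_Ropp, Rabs_mult.
      assert (Rabs p * Rabs h <= Rabs p * m) by (apply Rmult_le_compat_l; lra). lra. }
    assert (M0 : 0 <= m) by (generalize (Rabs_pos h); lra).
    assert (K3 : Rabs dl <= L * m).
    { generalize (Rabs_pos dl); intro.
      assert (q / 2 * Rabs dl <= (1 + Rabs p + q) * m) by nra.
      apply Rmult_le_reg_l with (q / 2); [lra|].
      replace (q / 2 * (L * m)) with ((1 + Rabs p + q) * m) by (unfold L; field; lra). assumption. }
    replace (dl - (- p / q * h + / q * k)) with (- ((k - (p * h + q * dl)) / q)) by (field; lra).
    rewrite Rabs_Ropp. unfold Rdiv. rewrite Rabs_mult, (Rabs_right (/ q)) by (apply Rle_ge; left; now apply Rinv_0_lt_compat).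
    apply Rmult_le_reg_r with q; [exact Hq|]. rewrite Rmult_assoc, Rinv_l by lra. rewrite Rmult_1_r.
    eapply Rle_trans; [exact K1|].
    apply Rle_trans with (e1 * (1 + L) * m); [nra|].
    replace (eps * m * q) with (eps * q * m) by ring.
    apply Rmult_le_compat_r; [exact M0|exact He3]. }
  split.
  - apply is_derive_Reals.
    replace (- p / q) with (- p / q * 1 + / q * 0) by ring.
    apply (derivable_pt_lim_comp_2d (fun u c => psi (u, c)) (fun t => t) (fun _ => Im w)); [exact DD| |].
    + apply derivable_pt_lim_id.
    + apply derivable_pt_lim_const.
  - apply is_derive_Reals.
    replace (/ q) with (- p / q * 0 + / q * 1) by ring.
    apply (derivable_pt_lim_comp_2d (fun u c => psi (u, c)) (fun _ => Re w) (fun t => t)); [exact DD| |].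
    + apply derivable_pt_lim_const.
    + apply derivable_pt_lim_id.
Qed.

(** The partial derivatives of psi are rational expressions in those of f at
    (u, psi(u, c)), so each order of smoothness gives the next. *)
Lemma fibre_inverse_class_C n : class_C n V psi.
Proof.
  induction n as [|n IH].
  - split; [exact fibre_inverse_continuous|exact I].
  - split; [exact fibre_inverse_continuous|].
    destruct (Hf (S n)) as [_ [fx [fy [Hd [Hx Hy]]]]].
    assert (HUp : forall w, V w -> U (Re w, psi w)) by (intros w Hw; apply Hpsi, Hw).
    assert (Hnz : forall w, V w -> fy (Re w, psi w) <> 0).
    { intros w Hw. destruct (Hpos _ (HUp w Hw)) as [l [Hl Hl0]]. destruct (Hd _ (HUp w Hw)) as [_ Hy'].
      unfold is_partial_y in *.
      rewrite <- (is_derive_unique _ _ _ Hy'), (is_derive_unique _ _ _ Hl). lra. }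
    assert (Hx' : class_C n V (fun w => fx (Re w, psi w)))
      by (apply (class_C_comp n U V HU); auto using class_C_Re).
    assert (Hy' : class_C n V (fun w => fy (Re w, psi w)))
      by (apply (class_C_comp n U V HU); auto using class_C_Re).
    exists (fun w => - fx (Re w, psi w) / fy (Re w, psi w)), (fun w => / fy (Re w, psi w)).
    split; [|split].
    + intros w Hw. apply fibre_inverse_diff; auto. eapply class_C_cont; [exact Hx|auto].
    + apply class_C_div; auto. now apply class_C_opp.
    + now apply class_C_inv.
Qed.
End FibreInverse.
(** * Slope and radial coordinates *)

Definition right_half (z : C) : Prop := 0 < Re z.

Lemma open_right_half : open right_half.
Proof.
  intros z Hz. apply (locally_lt (fun _ => 0) Re z); [apply continuous_const|apply continuous_Re|exact Hz].
Qed.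

Definition cfracR (z : C) : R := Re (cfrac 0 (Re z) (Im z)).
Definition cfracI (z : C) : R := Im (cfrac 0 (Re z) (Im z)).

Lemma hyp01_class_C m n U : class_C n U (fun z => Re (hyp01 m (Re z) (Im z))) /\
  class_C n U (fun z => Im (hyp01 m (Re z) (Im z))).
Proof.
  destruct (cgood_rgood _ _ (coef_good m (n + 2))) as [H1 H2].
  split; [exact (gen_class_C n U _ H1)|exact (gen_class_C n U _ H2)].
Qed.

Lemma cfrac_class_C n : class_C n right_half cfracR /\ class_C n right_half cfracI.
Proof.
  destruct (hyp01_class_C 0 n right_half) as [P1 P2], (hyp01_class_C 1 n right_half) as [Q1 Q2].
  set (p1 := fun z : C => Re (hyp01 0 (Re z) (Im z))) in *. set (p2 := fun z : C => Im (hyp01 0 (Re z) (Im z))) in *.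
  set (q1 := fun z : C => Re (hyp01 1 (Re z) (Im z))) in *. set (q2 := fun z : C => Im (hyp01 1 (Re z) (Im z))) in *.
  assert (Hq : forall z, right_half z -> q1 z * q1 z + q2 z * q2 z <> 0).
  { intros z Hz. unfold right_half in Hz. assert (Hn := norm2_pos _ (hyp01_nz 1 (Re z) (Im z) ltac:(lra))).
    unfold q1, q2. lra. }
  assert (Hk : class_C n right_half Im) by apply class_C_Im.
  assert (U1 : class_C n right_half (fun z => p1 z + Im z * p2 z)) by (apply class_C_plus; [|apply class_C_mult]; auto).
  assert (U2 : class_C n right_half (fun z => p2 z - Im z * p1 z)) by (apply class_C_minus; [|apply class_C_mult]; auto).
  assert (Hd : class_C n right_half (fun z => q1 z * q1 z + q2 z * q2 z)) by (apply class_C_plus; apply class_C_mult; auto).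
  assert (Hval : forall z, right_half z -> cfrac 0 (Re z) (Im z) =
    (((p1 z + Im z * p2 z) * q1 z + (p2 z - Im z * p1 z) * q2 z) / (q1 z * q1 z + q2 z * q2 z),
     ((p2 z - Im z * p1 z) * q1 z - (p1 z + Im z * p2 z) * q2 z) / (q1 z * q1 z + q2 z * q2 z))).
  { intros z Hz. specialize (Hq z Hz).
    Local Transparent cfrac. unfold cfrac. Local Opaque cfrac.
    unfold p1, p2, q1, q2 in *. destruct (hyp01 0 (Re z) (Im z)) as [a b], (hyp01 1 (Re z) (Im z)) as [c d].
    unfold sn. cbn [Re Im fst snd] in Hq. apply C_ext; simpl; field; simpl in Hq; nra. }
  split.
  - apply (class_C_ext n right_half (fun z => ((p1 z + Im z * p2 z) * q1 z + (p2 z - Im z * p1 z) * q2 z) / (q1 z * q1 z + q2 z * q2 z)));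
      [apply open_right_half| |].
    + intros z Hz. unfold cfracR. now rewrite Hval.
    + apply class_C_div; auto. apply class_C_plus; apply class_C_mult; auto.
  - apply (class_C_ext n right_half (fun z => ((p2 z - Im z * p1 z) * q1 z - (p1 z + Im z * p2 z) * q2 z) / (q1 z * q1 z + q2 z * q2 z)));
      [apply open_right_half| |].
    + intros z Hz. unfold cfracI. now rewrite Hval.
    + apply class_C_div; auto. apply class_C_minus; apply class_C_mult; auto.
Qed.

Lemma cfracR_gt z : right_half z -> 1 < cfracR z.
Proof. intro H. generalize (cfrac_Re_gt 0 _ (Im z) H). unfold cfracR. simpl INR. lra. Qed.

Lemma cfracR_partial z : right_half z ->
  is_partial_x cfracR z (Re (cfrac_x 0 (Re z) (Im z))) /\ is_partial_y cfracR z (Im (cfrac_nu 0 (Re z) (Im z))).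
Proof.
  intro H. unfold right_half in H. split.
  - exact (proj1 (cfrac_deriv_x 0 (Re z) (Im z) ltac:(lra))).
  - eapply is_derive_eq; [exact (proj1 (cfrac_deriv_k 0 (Re z) (Im z) ltac:(lra)))|]. simpl; unfold Im; ring.
Qed.

Lemma cfracI_partial z : right_half z ->
  is_partial_x cfracI z (Im (cfrac_x 0 (Re z) (Im z))) /\ is_partial_y cfracI z (- Re (cfrac_nu 0 (Re z) (Im z))).
Proof.
  intro H. unfold right_half in H. split.
  - exact (proj2 (cfrac_deriv_x 0 (Re z) (Im z) ltac:(lra))).
  - eapply is_derive_eq; [exact (proj2 (cfrac_deriv_k 0 (Re z) (Im z) ltac:(lra)))|]. simpl; unfold Re; ring.
Qed.

(** The tangent of the argument of the mean resultant 1 / N. *)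
Definition slope (z : C) : R := - cfracI z / cfracR z.

Lemma slope_class_C n : class_C n right_half slope.
Proof.
  destruct (cfrac_class_C n) as [H1 H2]. apply class_C_div; [|now apply class_C_opp|exact H1].
  intros z Hz. generalize (cfracR_gt z Hz); lra.
Qed.

Lemma is_derive_Rdiv (f g : R -> R) (x l m : R) : is_derive f x l -> is_derive g x m -> g x <> 0 ->
  is_derive (fun t => f t / g t) x ((l * g x - f x * m) / (g x * g x)).
Proof.
  intros Hf Hg H. eapply is_derive_eq; [apply (is_derive_Rmult _ _ _ _ _ Hf (is_derive_inv _ _ _ Hg H))|].
  field. exact H.
Qed.

Definition slope_x (z : C) : R :=
  (cfracI z * Re (cfrac_x 0 (Re z) (Im z)) - Im (cfrac_x 0 (Re z) (Im z)) * cfracR z) / (cfracR z * cfracR z).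
Definition slope_k (z : C) : R :=
  (Re (cfrac_nu 0 (Re z) (Im z)) * cfracR z + Im (cfrac_nu 0 (Re z) (Im z)) * cfracI z) / (cfracR z * cfracR z).

Lemma slope_partial z : right_half z ->
  is_partial_x slope z (slope_x z) /\ is_partial_y slope z (slope_k z).
Proof.
  intro H. destruct (cfracR_partial z H) as [A1 A2], (cfracI_partial z H) as [B1 B2].
  assert (Hg := cfracR_gt z H). split; unfold is_partial_x, is_partial_y in *.
  - eapply is_derive_eq; [apply (is_derive_Rdiv _ _ _ _ _ (is_derive_Ropp _ _ _ B1) A1)|].
    + rewrite C_eta. lra.
    + cbv beta. rewrite C_eta. unfold slope_x. field. lra.
  - eapply is_derive_eq; [apply (is_derive_Rdiv _ _ _ _ _ (is_derive_Ropp _ _ _ B2) A2)|].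
    + rewrite C_eta. lra.
    + cbv beta. rewrite C_eta. unfold slope_k. field. lra.
Qed.

Lemma slope_k_pos z : right_half z -> 0 < slope_k z.
Proof.
  intro H. assert (Hg := cfracR_gt z H). apply Rdiv_lt_0_compat; [|nra].
  exact (angle_increasing (Im z) (Re z) H).
Qed.

Lemma right_half_fibre u v1 v2 v : right_half (u, v1) -> right_half (u, v2) -> v1 <= v <= v2 -> right_half (u, v).
Proof. auto. Qed.

Lemma slope_pos z : right_half z -> exists l, is_partial_y slope z l /\ 0 < l.
Proof. intro H. exists (slope_k z). split; [now apply slope_partial|now apply slope_k_pos]. Qed.

(** Since |N - 1 + ik| <= x/2, the slope is unbounded in both directions as k
    varies; the intermediate value theorem does the rest. *)
Lemma slope_onto x t : 0 < x -> exists k, slope (x, k) = t.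
Proof.
  intro Hx.
  assert (HB : forall k, Rabs (cfracR (x, k) - 1) <= x / 2 /\ Rabs (cfracI (x, k) + k) <= x / 2).
  { intro k. assert (H := cfrac_near_s x k ltac:(lra)). unfold cfracR, cfracI.
    cbn [Re Im fst snd]. split; (eapply Rle_trans; [|exact H]).
    - eapply Rle_trans; [|apply Re_le_Cmod]. right. f_equal. unfold sn. simpl. unfold Re. ring.
    - eapply Rle_trans; [|apply Im_le_Cmod]. right. f_equal. unfold sn. simpl. unfold Im. ring. }
  set (K := (Rabs t + 1) * (1 + x / 2) + x / 2).
  assert (Ht := Rabs_pos t).
  assert (EK : K = (Rabs t + 1) * (1 + x / 2) + x / 2) by reflexivity. clearbody K.
  assert (HK : 0 < K) by nra.
  assert (Htt := Rle_abs t). assert (Htt' := Rle_abs (- t)). rewrite Rabs_Ropp in Htt'.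
  assert (Hhi : t < slope (x, K)).
  { destruct (HB K) as [H1 H2]. apply Rabs_le_between in H1, H2.
    assert (Hg := cfracR_gt (x, K) Hx). unfold slope.
    apply Rlt_le_trans with (Rabs t + 1); [lra|].
    apply Rmult_le_reg_r with (cfracR (x, K)); [lra|]. unfold Rdiv. rewrite Rmult_assoc, Rinv_l by lra.
    apply Rle_trans with ((Rabs t + 1) * (1 + x / 2)); [nra|]. lra. }
  assert (Hlo : slope (x, - K) < t).
  { destruct (HB (- K)) as [H1 H2]. apply Rabs_le_between in H1, H2.
    assert (Hg := cfracR_gt (x, - K) Hx). unfold slope.
    apply Rle_lt_trans with (- (Rabs t + 1)); [|lra].
    apply Rmult_le_reg_r with (cfracR (x, - K)); [lra|]. unfold Rdiv. rewrite Rmult_assoc, Rinv_l by lra.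
    apply Rle_trans with (- ((Rabs t + 1) * (1 + x / 2))); [lra|]. nra. }
  destruct (IVT_interv (fun k => slope (x, k) - t) (- K) K) as [k [_ Hk]]; [|lra|lra|lra|].
  - intros k _. apply continuity_pt_filterlim.
    destruct (slope_partial (x, k) Hx) as [_ Hd].
    apply (is_derive_continuous (fun k => slope (x, k) - t) k (slope_k (x, k) - 0)).
    apply is_derive_Rminus; [exact Hd|exact (is_derive_Rconst t k)].
  - exists k. lra.
Qed.

(** For fixed slope t, the curve x |-> (x, kappa (x, t)) is the isogone. *)
Definition kappa (w : C) : R := epsilon (inhabits 0) (fun k => slope (Re w, k) = Im w).

Lemma kappa_spec w : right_half w -> right_half (Re w, kappa w) /\ slope (Re w, kappa w) = Im w.
Proof.
  intro H. split; [exact H|]. unfold kappa. apply epsilon_spec. now apply slope_onto.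
Qed.

Lemma kappa_class_C n : class_C n right_half kappa.
Proof.
  exact (fibre_inverse_class_C right_half right_half slope kappa open_right_half open_right_half
    slope_class_C right_half_fibre slope_pos kappa_spec n).
Qed.

Lemma kappa_slope x k : 0 < x -> kappa (x, slope (x, k)) = k.
Proof.
  intro Hx. destruct (kappa_spec (x, slope (x, k)) Hx) as [_ H]. simpl Re in H; simpl Im in H.
  assert (Hm := fibre_increasing right_half slope right_half_fibre slope_pos x).
  set (k' := kappa (x, slope (x, k))) in *.
  destruct (Rtotal_order k' k) as [h|[h|h]]; [exfalso|exact h|exfalso].
  - generalize (Hm k' k Hx Hx h); lra.
  - generalize (Hm k k' Hx Hx h); lra.
Qed.

Definition upper_half (z : C) : Prop := 0 < Im z.
Definition above_one (z : C) : Prop := 1 < Im z.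

Lemma open_upper_half : open upper_half.
Proof.
  intros z Hz. apply (locally_lt (fun _ => 0) Im z); [apply continuous_const|apply continuous_Im|exact Hz].
Qed.
Lemma open_above_one : open above_one.
Proof.
  intros z Hz. apply (locally_lt (fun _ => 1) Im z); [apply continuous_const|apply continuous_Im|exact Hz].
Qed.

Definition swap_kappa (z : C) : R := kappa (Im z, Re z).
(** The real part of 1 / M along the isogone of slope Re z, as a function of
    x = Im z.  On the isogone with argument a it equals cos a / |M|. *)
Definition radial (z : C) : R := cfracR (Im z, swap_kappa z).

Lemma swap_kappa_class_C n : class_C n upper_half swap_kappa.
Proof.
  apply (class_C_comp n right_half upper_half open_right_half kappa Im Re);
    auto using kappa_class_C, class_C_Re, class_C_Im.
Qed.

Lemma radial_class_C n : class_C n upper_half radial.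
Proof.
  apply (class_C_comp n right_half upper_half open_right_half cfracR Im swap_kappa);
    auto using swap_kappa_class_C, class_C_Im. apply cfrac_class_C.
Qed.

(** Along the isogone dk/dx = - slope_x / slope_k, so the derivative is the
    Jacobian Re(T conj D) times a positive factor. *)
Lemma radial_pos z : upper_half z -> exists l, is_partial_y radial z l /\ 0 < l.
Proof.
  intro Hz. unfold upper_half in Hz. set (x := Im z) in *. set (t := Re z).
  set (p := (x, kappa (x, t))).
  assert (Hp : right_half p) by exact Hz.
  assert (Hc : forall f, class_C 0 right_half f -> continuous f p) by (intros f Hf; eapply class_C_cont; [exact Hf|exact Hp]).
  assert (Hsx : is_partial_x kappa (x, t) (- slope_x p / slope_k p)).
  { destruct (slope_class_C 1) as [_ [fx [fy [Hd [Hx Hy]]]]].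
    assert (E1 : fx p = slope_x p).
    { destruct (slope_partial p Hp) as [D1 _]. destruct (Hd p Hp) as [D2 _]. unfold is_partial_x in *.
      rewrite <- (is_derive_unique _ _ _ D1). symmetry. now apply is_derive_unique. }
    assert (E2 : fy p = slope_k p).
    { destruct (slope_partial p Hp) as [_ D1]. destruct (Hd p Hp) as [_ D2]. unfold is_partial_y in *.
      rewrite <- (is_derive_unique _ _ _ D1). symmetry. now apply is_derive_unique. }
    rewrite <- E1, <- E2.
    apply (fibre_inverse_diff right_half right_half slope kappa open_right_half open_right_half
      slope_class_C right_half_fibre slope_pos kappa_spec fx fy (x, t)); [exact Hd|now apply Hc|exact Hz]. }
  assert (DA : differentiable_pt_lim (fun u v => cfracR (u, v)) x (kappa (x, t))
    (Re (cfrac_x 0 x (kappa (x, t)))) (Im (cfrac_nu 0 x (kappa (x, t))))).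
  { destruct (proj1 (cfrac_class_C 1)) as [_ [fx [fy [Hd [Hx Hy]]]]].
    assert (E1 : fx p = Re (cfrac_x 0 x (kappa (x, t)))).
    { destruct (cfracR_partial p Hp) as [D1 _]. destruct (Hd p Hp) as [D2 _]. unfold is_partial_x in *.
      rewrite <- (is_derive_unique _ _ _ D2). exact (is_derive_unique _ _ _ D1). }
    assert (E2 : fy p = Im (cfrac_nu 0 x (kappa (x, t)))).
    { destruct (cfracR_partial p Hp) as [_ D1]. destruct (Hd p Hp) as [_ D2]. unfold is_partial_y in *.
      rewrite <- (is_derive_unique _ _ _ D2). exact (is_derive_unique _ _ _ D1). }
    rewrite <- E1, <- E2.
    apply (class_C_differentiable right_half cfracR fx fy p open_right_half Hp Hd). now apply Hc. }
  exists (Re (cfrac_x 0 x (kappa (x, t))) * 1 + Im (cfrac_nu 0 x (kappa (x, t))) * (- slope_x p / slope_k p)).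
  split.
  - unfold is_partial_y. apply is_derive_Reals.
    apply (derivable_pt_lim_comp_2d (fun u v => cfracR (u, v)) (fun y => y) (fun y => kappa (y, t))).
    + exact DA.
    + apply derivable_pt_lim_id.
    + apply is_derive_Reals. exact Hsx.
  - assert (Hg := cfracR_gt p Hp). assert (Hk := slope_k_pos p Hp).
    assert (J := jacobian (kappa (x, t)) x Hz).
    unfold slope_k in Hk. unfold slope_x, slope_k.
    change (Re p) with x in *. change (Im p) with (kappa (x, t)) in *.
    set (T1 := Re (cfrac_x 0 x (kappa (x, t)))) in *. set (T2 := Im (cfrac_x 0 x (kappa (x, t)))) in *.
    set (D1 := Re (cfrac_nu 0 x (kappa (x, t)))) in *. set (D2 := Im (cfrac_nu 0 x (kappa (x, t)))) in *.
    set (a := cfracR p) in *. set (b := cfracI p) in *.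
    assert (Hn : 0 < D1 * a + D2 * b).
    { replace (D1 * a + D2 * b) with ((D1 * a + D2 * b) / (a * a) * (a * a)) by (field; lra). apply Rmult_lt_0_compat; [exact Hk|nra]. }
    replace (T1 * 1 + D2 * (- ((b * T1 - T2 * a) / (a * a)) / ((D1 * a + D2 * b) / (a * a))))
      with (a * (T1 * D1 + T2 * D2) / (D1 * a + D2 * b)) by (field; lra).
    apply Rdiv_lt_0_compat; [nra|exact Hn].
Qed.

Lemma upper_half_fibre u v1 v2 v : upper_half (u, v1) -> upper_half (u, v2) -> v1 <= v <= v2 -> upper_half (u, v).
Proof. unfold upper_half; simpl; lra. Qed.

Lemma radial_increasing t x1 x2 : 0 < x1 -> x1 < x2 -> radial (t, x1) < radial (t, x2).
Proof.
  intros H1 H2. apply (fibre_increasing upper_half radial upper_half_fibre radial_pos);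
    unfold upper_half; simpl; lra.
Qed.

(** The first bound gives the limit 1 for x -> 0, the second, a rewriting of
    x < |N|^2, the limit infinity for x -> infinity. *)
Lemma radial_bounds t x : 0 < x -> radial (t, x) <= 1 + x / 2 /\
  x < radial (t, x) * radial (t, x) * (1 + t * t).
Proof.
  intro Hx. unfold radial, swap_kappa. simpl Re; simpl Im.
  destruct (kappa_spec (x, t) Hx) as [_ Hs]. simpl Re in Hs; simpl Im in Hs.
  set (k := kappa (x, t)) in *. split.
  - assert (H := cfrac_near_s x k ltac:(lra)).
    assert (H' := Rle_trans _ _ _ (Rle_trans _ _ _ (Rle_abs _) (Re_le_Cmod _)) H).
    replace (Re (cfrac 0 x k - sn 0 k)%C) with (cfracR (x, k) - 1) in H'
      by (unfold cfracR, sn; simpl; unfold Re; ring).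
    lra.
  - assert (H := cfrac_nsq_gt 0 x k ltac:(lra)). unfold nsq in H.
    assert (Hg := cfracR_gt (x, k) Hx).
    change (Re (cfrac 0 x k)) with (cfracR (x, k)) in H. change (Im (cfrac 0 x k)) with (cfracI (x, k)) in H.
    unfold slope in Hs.
    assert (HI : cfracI (x, k) = - t * cfracR (x, k)) by (rewrite <- Hs; field; lra).
    rewrite HI in H. nra.
Qed.

Lemma radial_onto t a : 1 < a -> exists x, 0 < x /\ radial (t, x) = a.
Proof.
  intro Ha. set (x2 := a * a * (1 + t * t)).
  assert (Hx2 : a - 1 < x2) by (unfold x2; nra).
  destruct (IVT_interv (fun x => radial (t, x) - a) (a - 1) x2) as [x [Hx1 Hx]]; [|exact Hx2| | |].
  - intros x Hx. apply continuity_pt_filterlim.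
    destruct (radial_pos (t, x)) as [l [Hl _]]; [unfold upper_half; simpl; lra|].
    apply (is_derive_continuous (fun x => radial (t, x) - a) x (l - 0)).
    apply is_derive_Rminus; [exact Hl|exact (is_derive_Rconst a x)].
  - destruct (radial_bounds t (a - 1) ltac:(lra)) as [H _]. lra.
  - destruct (radial_bounds t x2 ltac:(lra)) as [_ H].
    assert (Hr : 1 < radial (t, x2)) by (apply cfracR_gt; unfold right_half; simpl; lra).
    unfold x2 at 1 in H. assert (Htt : 0 < 1 + t * t) by nra.
    destruct (Rlt_dec 0 (radial (t, x2) - a)) as [h|h]; [exact h|exfalso].
    assert (radial (t, x2) * radial (t, x2) <= a * a) by nra. nra.
  - exists x. split; lra.
Qed.

Definition xi (w : C) : R := epsilon (inhabits 0) (fun x => 0 < x /\ radial (Re w, x) = Im w).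

Lemma xi_spec w : above_one w -> upper_half (Re w, xi w) /\ radial (Re w, xi w) = Im w.
Proof. intro H. unfold xi. apply (epsilon_spec (inhabits 0) (fun x => 0 < x /\ radial (Re w, x) = Im w)). now apply radial_onto. Qed.

Lemma xi_class_C n : class_C n above_one xi.
Proof.
  exact (fibre_inverse_class_C upper_half above_one radial xi open_upper_half open_above_one
    radial_class_C upper_half_fibre radial_pos xi_spec n).
Qed.

Lemma xi_radial t x : 0 < x -> xi (t, radial (t, x)) = x.
Proof.
  intro Hx. assert (Ha : above_one (t, radial (t, x))) by (apply cfracR_gt; exact Hx).
  destruct (xi_spec _ Ha) as [H1 H2]. unfold upper_half in H1. simpl Re in *; simpl Im in *.
  set (x' := xi (t, radial (t, x))) in *.
  destruct (Rtotal_order x' x) as [h|[h|h]]; [exfalso|exact h|exfalso].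
  - generalize (radial_increasing t x' x H1 h); lra.
  - generalize (radial_increasing t x x' Hx h); lra.
Qed.

Lemma xi_increasing t a1 a2 : 1 < a1 -> a1 < a2 -> xi (t, a1) < xi (t, a2).
Proof.
  intros H1 H2. destruct (xi_spec (t, a1) H1) as [A1 A2], (xi_spec (t, a2)) as [B1 B2].
  { unfold above_one; simpl; lra. }
  unfold upper_half in *. simpl Re in *; simpl Im in *.
  destruct (Rlt_le_dec (xi (t, a1)) (xi (t, a2))) as [h|[h|h]]; [exact h|exfalso|exfalso].
  - generalize (radial_increasing t _ _ B1 h); lra.
  - rewrite h in B2. lra.
Qed.
(** * The mean map and its inverse *)

Lemma Cmod_sqrt (z : C) : Cmod z = sqrt (Re z * Re z + Im z * Im z).
Proof. unfold Cmod. f_equal. unfold Re, Im; ring. Qed.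

Lemma polar_Cmod_atan (z : C) : 0 < Re z -> z = polar (Cmod z) (atan (Im z / Re z)).
Proof. intro H. rewrite Cmod_sqrt, polar_rect by exact H. now destruct z. Qed.

Lemma atan_half_pi x : half_pi_range (atan x).
Proof. unfold half_pi_range. generalize (atan_bound x). lra. Qed.

Lemma cos_half_pi a : half_pi_range a -> 0 < cos a.
Proof. intros [H1 H2]. apply cos_gt_0; lra. Qed.

Lemma Arg_half_pi r a : 0 < r -> half_pi_range a -> Arg (polar r a) = a.
Proof. intros Hr [H1 H2]. generalize PI_RGT_0; intro. apply Arg_polar; lra. Qed.

Lemma Cmod_pos_Re (z : C) : 0 < Re z -> 0 < Cmod z.
Proof. intro H. apply Cmod_gt_0. intros ->. simpl in H; lra. Qed.

Lemma nsq_polar r a : nsq (polar r a) = r * r.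
Proof.
  unfold nsq, polar, Re, Im; cbn [fst snd]. generalize (sin2_cos2 a). unfold Rsqr. intro H.
  replace (r * cos a * (r * cos a) + r * sin a * (r * sin a)) with (r * r * (sin a * sin a + cos a * cos a)) by ring.
  rewrite H. ring.
Qed.

Lemma calV_iff z : calV z <-> 0 < Re z.
Proof.
  split.
  - intros [r [b [Hr [Hb ->]]]]. unfold polar; simpl. apply Rmult_lt_0_compat; [exact Hr|now apply cos_half_pi].
  - intro H. exists (Cmod z), (atan (Im z / Re z)). split; [now apply Cmod_pos_Re|].
    split; [apply atan_half_pi|now apply polar_Cmod_atan].
Qed.

(** |w|^2 < Re w is the common form of the three descriptions of the disk. *)
Lemma calW_iff w : calW w <-> nsq w < Re w.
Proof.
  split.
  - intros [rho [a [Ha [Hr ->]]]]. rewrite nsq_polar. unfold polar, Re; cbn [fst]. nra.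
  - intro H. assert (Hn : 0 <= nsq w) by (unfold nsq; nra).
    assert (Hw : 0 < Re w) by lra. assert (Hm := Cmod_pos_Re w Hw).
    exists (Cmod w), (atan (Im w / Re w)). split; [apply atan_half_pi|].
    split; [|now apply polar_Cmod_atan]. split; [exact Hm|].
    assert (E := f_equal Re (polar_Cmod_atan w Hw)). unfold polar at 1, Re at 2 in E; cbn [fst] in E.
    rewrite nsq_Cmod in H. apply Rmult_lt_reg_l with (Cmod w); [exact Hm|]. lra.
Qed.

Lemma disk_iff w : nsq w < Re w <-> Cmod (w - RtoC (1 / 2))%C < 1 / 2.
Proof.
  assert (H := nsq_Cmod (w - RtoC (1 / 2))%C). assert (Hp := Cmod_ge_0 (w - RtoC (1 / 2))%C).
  assert (E : nsq (w - RtoC (1 / 2))%C = nsq w - Re w + / 4).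
  { unfold nsq. destruct w; simpl. field. }
  rewrite E in H. split; intro; nra.
Qed.

Lemma half_plane_iff w : nsq w < Re w <-> 1 < Re (/ w)%C.
Proof.
  assert (D : w = RtoC 0 \/ w <> RtoC 0) by (destruct (Ceq_dec w (RtoC 0)); auto).
  destruct D as [->|Hw].
  - unfold nsq. simpl. replace (0 / (0 * (0 * 1) + 0 * (0 * 1))) with 0 by (unfold Rdiv; ring). split; lra.
  - rewrite Re_inv by exact Hw. assert (Hn := nsq_pos _ Hw). fold (nsq w). split; intro H.
    + apply Rmult_lt_reg_r with (nsq w); [exact Hn|]. unfold Rdiv. rewrite Rmult_assoc, Rinv_l; lra.
    + apply Rmult_lt_compat_r with (r := nsq w) in H; [|exact Hn].
      unfold Rdiv in H. rewrite Rmult_assoc, Rinv_l in H; lra.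
Qed.

Definition xcoord (z : C) : R := (Re z * Re z + Im z * Im z) / 4.
Definition kcoord (z : C) : R := Im z / Re z.

Lemma xcoord_pos z : 0 < Re z -> 0 < xcoord z.
Proof. intro H. unfold xcoord. nra. Qed.

Lemma mean_map_cfrac z : 0 < Re z -> mean_map z = (/ cfrac 0 (xcoord z) (kcoord z))%C.
Proof.
  intro H. rewrite (polar_Cmod_atan z H) at 1.
  rewrite mean_map_polar; [|now apply Cmod_pos_Re|apply atan_half_pi].
  rewrite tan_atan, mean_resultant_cfrac by now apply Cmod_pos_Re.
  rewrite <- nsq_Cmod. reflexivity.
Qed.

(** The slope tan(arg w) and the real part of 1/w are coordinates on the disk;
    they correspond to [slope] and [radial] under w = 1 / N. *)
Definition wslope (w : C) : R := Im w / Re w.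
Definition wrad (w : C) : R := Re w / nsq w.

Lemma mean_map_coords z : 0 < Re z ->
  calW (mean_map z) /\ wslope (mean_map z) = slope (xcoord z, kcoord z) /\
  wrad (mean_map z) = cfracR (xcoord z, kcoord z).
Proof.
  intro H. assert (Hx := xcoord_pos z H). rewrite calW_iff, mean_map_cfrac by exact H.
  assert (Hg := cfracR_gt (xcoord z, kcoord z) Hx).
  assert (Hz := cfrac_nz 0 (xcoord z) (kcoord z) ltac:(lra)).
  assert (Hn := nsq_pos _ Hz).
  unfold wslope, wrad, slope, cfracR, cfracI in *. cbn [Re Im fst snd] in *.
  fold (Re (cfrac 0 (xcoord z) (kcoord z))) in *. fold (Im (cfrac 0 (xcoord z) (kcoord z))) in *.
  set (N := cfrac 0 (xcoord z) (kcoord z)) in *.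
  assert (E : nsq (/ N)%C = / nsq N).
  { unfold nsq at 1. rewrite Re_inv, Im_inv by exact Hz. fold (nsq N).
    transitivity ((Re N * Re N + Im N * Im N) / (nsq N * nsq N)); [field; lra|].
    fold (nsq N). field. lra. }
  rewrite E, Re_inv, Im_inv by exact Hz. fold (nsq N). split; [|split].
  - rewrite <- (Rmult_1_l (/ nsq N)). apply Rmult_lt_compat_r; [now apply Rinv_0_lt_compat|exact Hg].
  - field. lra.
  - field. lra.
Qed.

Lemma wcoords_inj w w' : calW w -> calW w' -> wslope w = wslope w' -> wrad w = wrad w' -> w = w'.
Proof.
  rewrite !calW_iff. unfold wslope, wrad. intros H H' Hs Hr.
  assert (P : 0 <= nsq w) by (unfold nsq; nra). assert (P' : 0 <= nsq w') by (unfold nsq; nra).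
  assert (R1 : 0 < Re w) by lra. assert (R2 : 0 < Re w') by lra.
  assert (Q : forall v, 0 < Re v -> nsq v = Re v * Re v * (1 + Im v / Re v * (Im v / Re v))).
  { intros v Hv. unfold nsq. field. lra. }
  assert (G : forall v, 0 < Re v -> Re v / nsq v = / (Re v * (1 + Im v / Re v * (Im v / Re v)))).
  { intros v Hv. rewrite Q by exact Hv. field. split; [lra|].
    assert (0 < Re v * Re v) by nra. nra. }
  rewrite !G, Hs in Hr by assumption.
  set (t := Im w' / Re w') in *.
  assert (Ht : 0 < 1 + t * t) by nra.
  apply (f_equal Rinv) in Hr. rewrite !Rinv_inv in Hr.
  assert (E : Re w = Re w') by (apply Rmult_eq_reg_r with (1 + t * t); lra).
  apply C_ext; [exact E|].
  unfold t in Hs. rewrite <- E in Hs. apply Rmult_eq_reg_r with (/ Re w); [exact Hs|].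
  apply Rinv_neq_0_compat; lra.
Qed.

Lemma calW_wrad w : calW w -> 0 < Re w /\ 1 < wrad w.
Proof.
  rewrite calW_iff. intro H. assert (P : 0 <= nsq w) by (unfold nsq; nra).
  split; [lra|]. assert (Hw : w <> RtoC 0) by (intros ->; simpl in *; lra).
  assert (Hn := nsq_pos _ Hw). unfold wrad.
  apply Rmult_lt_reg_r with (nsq w); [exact Hn|]. unfold Rdiv. rewrite Rmult_assoc, Rinv_l; lra.
Qed.

Definition inv_x (w : C) : R := xi (wslope w, wrad w).
Definition inv_k (w : C) : R := kappa (inv_x w, wslope w).
Definition inv_re (w : C) : R := 2 * sqrt (inv_x w) / sqrt (1 + inv_k w * inv_k w).
(** Undo the two fibrewise changes of coordinates, then return from (x, k) to
    r = 2 sqrt x and the direction (1, k) / sqrt(1 + k^2). *)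
Definition mean_map_inv (w : C) : C := (inv_re w, inv_k w * inv_re w).

Lemma inv_x_pos w : calW w -> 0 < inv_x w.
Proof. intro H. apply (xi_spec (wslope w, wrad w)). apply calW_wrad, H. Qed.

Lemma sqrt_1_sq k : 0 < sqrt (1 + k * k).
Proof. apply sqrt_lt_R0; nra. Qed.

Lemma inv_re_pos w : calW w -> 0 < inv_re w.
Proof.
  intro H. unfold inv_re. generalize (sqrt_lt_R0 _ (inv_x_pos w H)), (sqrt_1_sq (inv_k w)); intros.
  apply Rdiv_lt_0_compat; lra.
Qed.

Lemma inv_coords w : calW w ->
  xcoord (mean_map_inv w) = inv_x w /\ kcoord (mean_map_inv w) = inv_k w.
Proof.
  intro H. assert (Hx := inv_x_pos w H). assert (Hr := inv_re_pos w H).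
  assert (Hk := sqrt_1_sq (inv_k w)). split.
  - unfold xcoord, mean_map_inv; simpl Re; simpl Im.
    replace (inv_re w * inv_re w + inv_k w * inv_re w * (inv_k w * inv_re w))
      with (inv_re w * inv_re w * (1 + inv_k w * inv_k w)) by ring.
    unfold inv_re.
    replace (1 + inv_k w * inv_k w) with (sqrt (1 + inv_k w * inv_k w) * sqrt (1 + inv_k w * inv_k w)) at 3
      by (apply sqrt_sqrt; nra).
    rewrite <- (sqrt_sqrt (inv_x w)) at 3 by lra. field. lra.
  - unfold kcoord, mean_map_inv; simpl Re; simpl Im. field. lra.
Qed.

Lemma inv_left z : 0 < Re z -> mean_map_inv (mean_map z) = z.
Proof.
  intro H. assert (Hx := xcoord_pos z H). destruct (mean_map_coords z H) as [HW [Hs Hr]].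
  assert (Ek : kappa (xcoord z, wslope (mean_map z)) = kcoord z) by (rewrite Hs; now apply kappa_slope).
  assert (Ex : inv_x (mean_map z) = xcoord z).
  { unfold inv_x. rewrite Hr.
    replace (cfracR (xcoord z, kcoord z)) with (radial (wslope (mean_map z), xcoord z)).
    - now apply xi_radial.
    - unfold radial, swap_kappa. simpl Re; simpl Im. now rewrite Ek. }
  assert (Ekk : inv_k (mean_map z) = kcoord z) by (unfold inv_k; now rewrite Ex).
  assert (Er : inv_re (mean_map z) = Re z).
  { unfold inv_re. rewrite Ex, Ekk.
    replace (xcoord z) with ((Re z / 2 * sqrt (1 + kcoord z * kcoord z)) * (Re z / 2 * sqrt (1 + kcoord z * kcoord z))).
    - generalize (sqrt_1_sq (kcoord z)); intro. rewrite sqrt_square by nra. field. lra.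
    - transitivity (Re z / 2 * (Re z / 2) * (sqrt (1 + kcoord z * kcoord z) * sqrt (1 + kcoord z * kcoord z))); [ring|].
      rewrite sqrt_sqrt by nra. unfold kcoord, xcoord. field. lra. }
  unfold mean_map_inv. rewrite Er, Ekk. apply C_ext; [reflexivity|]. unfold kcoord; simpl. unfold Re, Im. field.
  unfold Re in H; lra.
Qed.

Lemma mean_map_inv_V w : calW w -> 0 < Re (mean_map_inv w).
Proof. intro H. simpl. now apply inv_re_pos. Qed.

Lemma inv_right w : calW w -> mean_map (mean_map_inv w) = w.
Proof.
  intro H. assert (HV := mean_map_inv_V w H). destruct (mean_map_coords _ HV) as [HW [Hs Hr]].
  destruct (inv_coords w H) as [Ex Ek]. rewrite Ex, Ek in Hs, Hr.
  assert (Hx := inv_x_pos w H). destruct (calW_wrad w H) as [_ Ha].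
  apply wcoords_inj; auto.
  - rewrite Hs. exact (proj2 (kappa_spec (inv_x w, wslope w) Hx)).
  - rewrite Hr. exact (proj2 (xi_spec (wslope w, wrad w) Ha)).
Qed.

Lemma Cmod_mean_map_inv w : calW w -> Cmod (mean_map_inv w) = 2 * sqrt (inv_x w).
Proof.
  intro H. rewrite Cmod_sqrt.
  replace (Re (mean_map_inv w) * Re (mean_map_inv w) + Im (mean_map_inv w) * Im (mean_map_inv w))
    with (4 * xcoord (mean_map_inv w)) by (unfold xcoord; field).
  destruct (inv_coords w H) as [-> _]. assert (Hx := inv_x_pos w H).
  rewrite sqrt_mult by lra. f_equal. replace 4 with (2 * 2) by ring. apply sqrt_square; lra.
Qed.

Lemma mean_map_smooth : smooth_on calV mean_map.
Proof.
  intro n.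
  assert (Hk : class_C n right_half kcoord).
  { apply class_C_div; [|apply class_C_Im|apply class_C_Re]. unfold right_half; intros; lra. }
  assert (Hx : class_C n right_half xcoord).
  { apply class_C_mult; [apply class_C_plus; apply class_C_mult; auto using class_C_Re, class_C_Im|apply class_C_const]. }
  assert (Hxp : forall z, right_half z -> right_half (xcoord z, kcoord z)) by (intros z Hz; now apply xcoord_pos).
  destruct (cfrac_class_C n) as [H1 H2].
  set (u := fun z => cfracR (xcoord z, kcoord z)). set (v := fun z => cfracI (xcoord z, kcoord z)).
  assert (HR : class_C n right_half u)
    by (apply (class_C_comp n right_half right_half open_right_half); auto).
  assert (HI : class_C n right_half v)
    by (apply (class_C_comp n right_half right_half open_right_half); auto).
  assert (Hd : class_C n right_half (fun z => u z * u z + v z * v z))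
    by (apply class_C_plus; apply class_C_mult; auto).
  assert (Hd0 : forall z, right_half z -> u z * u z + v z * v z <> 0).
  { intros z Hz. assert (Hu : 1 < u z) by exact (cfracR_gt _ (Hxp z Hz)). nra. }
  assert (HVR : forall z, calV z -> right_half z) by (intros z; apply calV_iff).
  assert (Hz : forall z, right_half z -> cfrac 0 (xcoord z) (kcoord z) <> RtoC 0).
  { intros z Hz. apply cfrac_nz. generalize (xcoord_pos z Hz); lra. }
  split; apply (class_C_sub n right_half calV HVR).
  - apply (class_C_ext n right_half (fun z => u z / (u z * u z + v z * v z)));
      [apply open_right_half| |now apply class_C_div].
    intros z Hzz. rewrite mean_map_cfrac, Re_inv by auto. reflexivity.
  - apply (class_C_ext n right_half (fun z => - v z / (u z * u z + v z * v z)));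
      [apply open_right_half| |apply class_C_div; auto using class_C_opp].
    intros z Hzz. rewrite mean_map_cfrac, Im_inv by auto. reflexivity.
Qed.

Lemma mean_map_inv_smooth : smooth_on calW mean_map_inv.
Proof.
  intro n.
  assert (HRe : forall w, calW w -> Re w <> 0) by (intros w Hw; destruct (calW_wrad w Hw); lra).
  assert (Hns : forall w, calW w -> nsq w <> 0).
  { intros w Hw. destruct (calW_wrad w Hw). unfold nsq. nra. }
  assert (Hs : class_C n calW wslope) by (apply class_C_div; auto using class_C_Re, class_C_Im).
  assert (Hr : class_C n calW wrad).
  { apply class_C_div; auto using class_C_Re.
    apply class_C_plus; apply class_C_mult; auto using class_C_Re, class_C_Im. }
  assert (Hx : class_C n calW inv_x).
  { apply (class_C_comp n above_one calW open_above_one xi); auto using xi_class_C.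
    intros w Hw. apply calW_wrad, Hw. }
  assert (Hk : class_C n calW inv_k).
  { apply (class_C_comp n right_half calW open_right_half kappa); auto using kappa_class_C.
    intros w Hw. now apply inv_x_pos. }
  assert (Hc : class_C n calW inv_re).
  { apply class_C_div.
    - intros w _. generalize (sqrt_1_sq (inv_k w)); lra.
    - apply (class_C_mult n calW (fun _ => 2)); [apply class_C_const|].
      apply class_C_sqrt; [exact inv_x_pos|exact Hx].
    - apply class_C_sqrt; [intros; nra|]. apply (class_C_plus n calW (fun _ => 1)); [apply class_C_const|].
      now apply class_C_mult. }
  split; [exact Hc|]. exact (class_C_mult n calW inv_k inv_re Hk Hc).
Qed.

Lemma wcoords_polar rho a : 0 < rho -> half_pi_range a ->
  wslope (polar rho a) = tan a /\ wrad (polar rho a) = cos a / rho.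
Proof.
  intros Hr Ha. assert (Hc := cos_half_pi a Ha). unfold wslope, wrad. rewrite nsq_polar.
  unfold polar, Re, Im; cbn [fst snd]. unfold tan. split; field; lra.
Qed.

Lemma calW_polar rho a : half_pi_range a -> 0 < rho < cos a -> calW (polar rho a).
Proof. intros Ha Hr. now exists rho, a. Qed.

(** For fixed argument a the modulus R enters only through cos a / R. *)
Lemma mean_map_inv_radial : radially_strictly_decreasing mean_map_inv.
Proof.
  intros a R1 R2 Ha H1 H12 H2. assert (Hc := cos_half_pi a Ha).
  rewrite !Cmod_mean_map_inv by (apply calW_polar; auto; lra).
  assert (Hx2 := inv_x_pos (polar R2 a) (calW_polar R2 a Ha ltac:(lra))).
  apply Rmult_lt_compat_l; [lra|]. apply sqrt_lt_1_alt. split; [lra|].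
  unfold inv_x. destruct (wcoords_polar R1 a H1 Ha) as [-> ->], (wcoords_polar R2 a ltac:(lra) Ha) as [-> ->].
  apply xi_increasing.
  - apply Rmult_lt_reg_r with R2; [lra|]. unfold Rdiv. rewrite Rmult_assoc, Rinv_l; lra.
  - apply Rmult_lt_compat_l; [exact Hc|]. apply Rinv_lt_contravar; nra.
Qed.

Lemma isogone_polar a z : isogone a z ->
  half_pi_range a /\ 0 < Re z /\ exists rho, 0 < rho < cos a /\ mean_map z = polar rho a.
Proof.
  intros [HV HA]. apply calV_iff in HV. destruct (mean_map_coords z HV) as [[rho [a' [Ha' [Hr E]]]] _].
  rewrite E, Arg_half_pi in HA by (auto; lra). subst a'.
  split; [exact Ha'|]. split; [exact HV|]. exists rho. now split.
Qed.

(** Equivalent to the radial monotonicity of the inverse map, since the isogone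
    with argument a is the preimage of the chord of direction a. *)
Lemma isogone_decreasing a : strictly_decreasing_along_isogone a.
Proof.
  intros z1 z2 I1 I2 Hlt.
  destruct (isogone_polar a z1 I1) as [Ha [V1 [r1 [Hr1 E1]]]].
  destruct (isogone_polar a z2 I2) as [_ [V2 [r2 [Hr2 E2]]]].
  rewrite E1, E2, !Cmod_polar by lra.
  destruct (Rlt_le_dec r2 r1) as [h|h]; [exact h|exfalso].
  assert (G1 := inv_left z1 V1). assert (G2 := inv_left z2 V2). rewrite E1 in G1. rewrite E2 in G2.
  destruct h as [h|h].
  - generalize (mean_map_inv_radial a r1 r2 Ha (proj1 Hr1) h (proj2 Hr2)). rewrite G1, G2. lra.
  - subst r2. rewrite G1 in G2. subst z2. lra.
Qed.

Theorem lemma6p13 :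
  (forall z : C, calV z <-> 0 < Re z) /\
  (forall w : C, calW w <-> Cmod (w - RtoC (1 / 2))%C < 1 / 2) /\
  (forall w : C, calW w <-> 1 < Re (/ w)%C) /\
  (forall a : R, half_pi_range a -> strictly_decreasing_along_isogone a) /\
  (exists g : C -> C,
     diffeomorphism calV calW mean_map g /\ radially_strictly_decreasing g) /\
  (forall a : R, half_pi_range a ->
     strictly_decreasing_along_isogone a /\
     is_image mean_map (isogone a)
       (open_segment (RtoC 0) (polar (cos a) a))).
Proof.
  split; [exact calV_iff|].
  split; [intro w; rewrite calW_iff; apply disk_iff|].
  split; [intro w; rewrite calW_iff; apply half_plane_iff|].
  split; [intros a _; apply isogone_decreasing|].
  split.
  - exists mean_map_inv. split; [|exact mean_map_inv_radial].
    split; [|split; [exact mean_map_smooth|exact mean_map_inv_smooth]].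
    split; [|split; [|split]].
    + intros z Hz. apply mean_map_coords, calV_iff, Hz.
    + intros w Hw. apply calV_iff. now apply mean_map_inv_V.
    + intros z Hz. apply inv_left, calV_iff, Hz.
    + exact inv_right.
  - intros a Ha. split; [apply isogone_decreasing|]. assert (Hc := cos_half_pi a Ha).
    assert (Hseg : forall t, (RtoC (1 - t) * RtoC 0 + RtoC t * polar (cos a) a)%C = polar (t * cos a) a).
    { intro t. unfold polar. apply C_ext; simpl; ring. }
    intro w. split.
    + intros [t [Ht ->]]. rewrite Hseg.
      assert (Hr : 0 < t * cos a < cos a) by nra.
      assert (HW := calW_polar _ a Ha Hr).
      exists (mean_map_inv (polar (t * cos a) a)). split; [|now apply inv_right].
      split; [apply calV_iff; now apply mean_map_inv_V|].
      rewrite inv_right by exact HW. apply Arg_half_pi; [lra|exact Ha].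
    + intros [z [Hz <-]]. destruct (isogone_polar a z Hz) as [_ [_ [rho [Hr ->]]]].
      exists (rho / cos a). split.
      * split; [apply Rdiv_lt_0_compat; lra|].
        apply Rmult_lt_reg_r with (cos a); [exact Hc|]. unfold Rdiv. rewrite Rmult_assoc, Rinv_l; lra.
      * rewrite Hseg. f_equal. field. lra.
Qed.
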